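(* Let $\mathbb{F}$ be an algebraically closed field of characteristic $p>2$, let $T$ be a positive integer relatively prime to $p$, and let $W$ be a $\mathbb{Z}_2$-graded vector space over $\mathbb{F}$. Then every local subspace $S\subset\mathcal{E}_T(W)$ generates a vertex superalgebra $\langle S\rangle$ with an automorphism $g$ of order $T$. Moreover, $W$ becomes a faithful $g$-twisted super $\langle S\rangle$-module, with $Y_W(a(x),z)=a(z)$ for $a(x)\in\langle S\rangle$.
   Context: Conventions. $\mathbb{N}=\{0,1,2,\dots\}$; $\mathbb{D}=\{m/n\in\mathbb{Q}: p\nmid n\}$; for $\alpha\in\mathbb{D}$ the binomials $\binom{\alpha}{i}$ are viewed in $\mathbb{F}$ via $\mathbb{D}\to\mathbb{Z}/p\subset\mathbb{F}$; $(z_1+z_2)^\alpha:=\sum_{i\ge0}\binom{\alpha}{i}z_1^{\alpha-i}z_2^i$; $\delta(z)=\sum_{n\in\mathbb{Z}}z^n$; $\mathrm{Res}_z$ is the coefficient of $z^{-1}$. $\eta\in\mathbb{F}$ is a fixed primitive $T$-th root of unity. $\mathcal{E}_T(W)=\{a(x)\in(\mathrm{End}\,W)[[x^{1/T},x^{-1/T}]] : a(x)w\in W((x^{1/T}))\ \forall w\in W\}$. It is $\mathbb{Z}_2$-graded through the $\mathbb{Z}_2$-grading of $\mathrm{End}\,W$ (even = parity preserving, odd = parity reversing coefficients), with $|a(x)|$ the parity. The map $g$ acts by $g f(x^{1/T})=f(\eta^{-1}x^{1/T})$, and $\mathcal{E}_T(W)=\bigoplus_{r=0}^{T-1}\mathcal{E}_T(W)^r$,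 $\mathcal{E}_T(W)^r=\{a(x): g a(x)=\eta^r a(x)\}$. An element is homogeneous if it is homogeneous for both gradings. Homogeneous $a(x),b(x)$ are mutually local if for some $k\in\mathbb{N}$, $(x_1-x_2)^ka(x_1)b(x_2)=(-1)^{|a(x)||b(x)|}(x_1-x_2)^kb(x_2)a(x_1)$. A subspace $S\subset\mathcal{E}_T(W)$ is local if it is spanned by homogeneous elements and any two homogeneous elements of $S$ are mutually local. For homogeneous mutually local $a(x),b(x)\in\mathcal{E}_T(W)$ with $a(x)\in\mathcal{E}_T(W)^r$, and $n\in\mathbb{Z}$, set $$a(x)_nb(x)=\mathrm{Res}_{x_1}\mathrm{Res}_{x_0}\,x_0^n\Big(\tfrac{x_1-x_0}{x}\Big)^{r/T}\Big(x_0^{-1}\delta\Big(\tfrac{x_1-x}{x_0}\Big)a(x_1)b(x)-(-1)^{|a(x)||b(x)|}x_0^{-1}\delta\Big(\tfrac{x-x_1}{-x_0}\Big)b(x)a(x_1)\Big)\in\mathcal{E}_T(W),$$ extended bilinearly. $\langle S\rangle$ is the smallest subspace containing $S$ and the identity operator $1_W$ and closed under all products $a(x)_nb(x)$, $n\in\mathbb{Z}$; its vacuum is $1_W$, its vertex operator is $Y(a(x),x_0)b(x)=\sum_{n\in\mathbb{Z}}a(x)_nb(x)x_0^{-n-1}$, and its automorphism $g$ is the one induced by the map $g$ above. A vertex superalgebra is a $\mathbb{Z}_2$-graded space $V$ with an even vector $\mathbf 1$ and a linear map $v\mapsto Y(v,x)=\sum_{n\in\mathbb{Z}}v_nx^{-n-1}\in(\mathrm{End}\,V)[[x,x^{-1}]]$,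 with $u_nv$ of parity $|u|+|v|$, $u_nv=0$ for $n$ large, $Y(\mathbf 1,x)=1_V$, $Y(v,x)\mathbf 1\in V[[x]]$ with constant term $v$, and for $\mathbb{Z}_2$-homogeneous $u,v$ the Jacobi identity $$x_0^{-1}\delta\Big(\tfrac{x_1-x_2}{x_0}\Big)Y(u,x_1)Y(v,x_2)-(-1)^{|u||v|}x_0^{-1}\delta\Big(\tfrac{x_2-x_1}{-x_0}\Big)Y(v,x_2)Y(u,x_1)=x_2^{-1}\delta\Big(\tfrac{x_1-x_0}{x_2}\Big)Y(Y(u,x_0)v,x_2).$$ An automorphism is a one-to-one linear map of $V$ to itself fixing $\mathbf 1$ and compatible with $Y$. For an automorphism $g$ of order $T$ and $V^r=\{v: gv=\eta^rv\}$, a $g$-twisted $V$-module is a vector space $W$ with a linear map $v\mapsto Y_W(v,x)=\sum_{n\in\frac1T\mathbb{Z}}v_nx^{-n-1}\in(\mathrm{End}\,W)[[x^{1/T},x^{-1/T}]]$ such that for $u\in V^r$ ($0\le r\le T-1$): $Y_W(u,x)=\sum_{n\in\frac rT+\mathbb{Z}}u_nx^{-n-1}$, $u_nw=0$ for $n$ large, $Y_W(\mathbf 1,x)=1_W$, and the Jacobi identity holds with $Y$ on the left replaced by $Y_W$ and right side replaced by $x_2^{-1}\delta\big(\tfrac{x_1-x_0}{x_2}\big)\big(\tfrac{x_1-x_0}{x_2}\big)^{-r/T}Y_W(Y(u,x_0)v,x_2)$. It is a super module if $W=W_{\bar0}\oplus W_{\bar1}$ and $u_nW_\beta\subset W_{\alpha+\beta}$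 for $u\in V_\alpha$, $\alpha,\beta\in\mathbb{Z}_2$, $n\in\frac1T\mathbb{Z}$. Faithful means $v\mapsto Y_W(v,x)$ is injective.
   Formalization: ''Automorphism g of order T'' is read as g^T = 1 (order dividing T), with g the explicit map induced by f(x^{1/T}) -> f(eta^{-1}x^{1/T}); exact order T fails, e.g. for S = 0, W nonzero, T ≥ 2, where <S> = F·1_W and g = id. *)

(* Defs.v *)
From HB Require Import structures.
From mathcomp Require Import all_boot all_order all_algebra.
From mathcomp Require Import all_classical.

Set Implicit Arguments.
Unset Strict Implicit.
Unset Printing Implicit Defensive.

Import Order.TTheory GRing.Theory Num.Theory.
Local Open Scope classical_set_scope.
Local Open Scope ring_scope.

(** A formal series is given by its coefficient function on rational exponents.
    A series in x^(1/T) is one supported on (1/T)Z. An element of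
    (End W)[[x^(1/T), x^(-1/T)]] is a function [rat -> W -> W] with linear
    values; [rat -> W -> W] is an lmodType for the pointwise operations. All
    infinite sums are the finitely supported sums of fsbigop (which are 0 when
    the support is infinite); multivariable operator series are applied to a
    vector w before being multiplied by scalar series, as the sums involved are
    finite only in this sense. *)

(* exponents of (x0, x1, x2) *)
Definition expo := (rat * rat * rat)%type.

Definition X0 (c : rat) : expo := (c, 0, 0).
Definition X1 (c : rat) : expo := (0, c, 0).
Definition X2 (c : rat) : expo := (0, 0, c).

(* binomial coefficients of rational numbers whose denominator is prime to the
   characteristic; the quotient has to be formed in rat, as i! may vanish in F *)
Definition binq (al : rat) (i : nat) : rat :=
  (\prod_(j < i) (al - j%:R)) / i`!%:R.

Section ScalarSeries.
Context {F : fieldType}.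

(* multiplication by the monomial of exponent d *)
Definition mshift (M : Type) (d : expo) (u : expo -> M) : expo -> M :=
  fun e => u (e - d).

(* (y - z)^al, expanded in nonnegative integral powers of z *)
Definition subpow (y z : rat -> expo) (al : rat) : expo -> F := fun e =>
  \sum_(i \in [set: nat])
    ((if e == y (al - i%:R) + z i%:R then (-1) ^+ i * ratr (binq al i) else 0)
       : F).

(* ((y - z) / t)^al *)
Definition ratiopow (y z t : rat -> expo) (al : rat) : expo -> F :=
  mshift (t (- al)) (subpow y z al).

(* t^-1 delta((y - z) / (s t)), for a sign s *)
Definition delta (s : F) (t y z : rat -> expo) : expo -> F := fun e =>
  \sum_(n \in [set: int])
    s ^ n * mshift (t (- n%:~R - 1)) (subpow y z n%:~R) e.

Definition smul (W : lmodType F) (f : expo -> F) (u : expo -> W) : expo -> W :=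
  fun e => \sum_(d \in [set: expo]) f d *: u (e - d).

End ScalarSeries.

Section Series.
Context {F : fieldType}.

Definition subspace (U : lmodType F) (A : set U) : Prop :=
  submod_closed (mem A).

(* parities are booleans added with (+): false = even, true = odd *)
Definition graded (V : lmodType F) (V_ : bool -> set V) : Prop :=
  [/\ forall al, subspace (V_ al),
      forall v, exists v0 v1, [/\ V_ false v0, V_ true v1 & v = v0 + v1]
    & forall v, V_ false v -> V_ true v -> v = 0].

Definition sgn (al be : bool) : F := (-1) ^+ (al && be).

Definition series (W : lmodType F) := rat -> W -> W.

Definition opseries (T : nat) (W : lmodType F) (a : series W) : Prop :=
  (forall e, linear (a e)) /\
  (forall e, a e != 0 -> T%:R * e \is a Num.int).

Definition truncated (W : Type) (z : W) (c : rat -> W) : Prop :=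
  exists N : rat, forall e, e < N -> c e = z.

Definition idser (W : lmodType F) : series W :=
  fun e w => if e == 0 then w else 0.

(* a(x1) b(x2) w and b(x2) a(x1) w *)
Definition ser12 (W : lmodType F) (a b : series W) (w : W) : expo -> W :=
  fun e => let: (e0, e1, e2) := e in if e0 == 0 then a e1 (b e2 w) else 0.

Definition ser21 (W : lmodType F) (a b : series W) (w : W) : expo -> W :=
  fun e => let: (e0, e1, e2) := e in if e0 == 0 then b e2 (a e1 w) else 0.

(* left-hand side of the Jacobi identity, applied to w:
   x0^-1 delta((x1 - x2)/x0) a(x1) b(x2) w
     - (-1)^(al be) x0^-1 delta((x2 - x1)/(- x0)) b(x2) a(x1) w *)
Definition jacobi_lhs (W : lmodType F) (al be : bool) (a b : series W) (w : W) :
    expo -> W := fun e =>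
  smul (delta 1 X0 X1 X2) (ser12 a b w) e
  - sgn al be *: smul (delta (-1) X0 X2 X1) (ser21 a b w) e.

(* YW(Y(u, x0) v, x2) w *)
Definition iterate (V W : lmodType F) (Y : V -> series V) (YW : V -> series W)
    (u v : V) (w : W) : expo -> W :=
  fun e => let: (e0, e1, e2) := e in if e1 == 0 then YW (Y u e0 v) e2 w else 0.

End Series.

Arguments idser {F} W e w.

Section VertexSuperalgebras.
Context {F : fieldType}.

(* [Y v] is the series Y(v, x), so v_n is [Y v (- n - 1)] *)
Record vertex_superalgebra (V : lmodType F) (V_ : bool -> set V) (vac : V)
    (Y : V -> series V) : Prop := VertexSuperalgebra {
  va_graded : graded V_;
  va_vac_even : V_ false vac;
  va_linear : linear Y;
  va_series : forall v, opseries 1 (Y v);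
  va_parity : forall al be u v e,
    V_ al u -> V_ be v -> V_ (al (+) be) (Y u e v);
  va_truncated : forall u v, truncated 0 (fun e => Y u e v);
  va_vacuum : Y vac = idser V;
  va_creation : forall v, (forall e, e < 0 -> Y v e vac = 0) /\ Y v 0 vac = v;
  va_jacobi : forall al be u v, V_ al u -> V_ be v -> forall w e,
    jacobi_lhs al be (Y u) (Y v) w e
    = smul (delta 1 X2 X1 X0) (iterate Y Y u v w) e
}.

Record automorphism (V : lmodType F) (vac : V) (Y : V -> series V)
    (g : V -> V) : Prop := Automorphism {
  aut_linear : linear g;
  aut_bijective : bijective g;
  aut_vac : g vac = vac;
  aut_Y : forall u v e, g (Y u e v) = Y (g u) e (g v)
}.

(* The coefficient of x^e is u_n for n = - e - 1; hence n \in r/T + Z means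
   e + r/T \in Z, and u_n w = 0 for n large means truncation from below. *)
Record twisted_module (T : nat) (eta : F) (V : lmodType F) (V_ : bool -> set V)
    (vac : V) (Y : V -> series V) (g : V -> V) (W : lmodType F)
    (YW : V -> series W) : Prop := TwistedModule {
  tw_linear : linear YW;
  tw_series : forall v, opseries T (YW v);
  tw_support : forall (r : nat) u, (r < T)%N -> g u = eta ^+ r *: u ->
    forall e, YW u e != 0 -> e + r%:R / T%:R \is a Num.int;
  tw_truncated : forall (r : nat) u, (r < T)%N -> g u = eta ^+ r *: u ->
    forall w, truncated 0 (fun e => YW u e w);
  tw_vacuum : YW vac = idser W;
  tw_jacobi : forall (r : nat) al be u v, (r < T)%N -> g u = eta ^+ r *: u ->
    V_ al u -> V_ be v -> forall w e,
    jacobi_lhs al be (YW u) (YW v) w e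
    = smul (delta 1 X2 X1 X0)
        (smul (ratiopow X1 X0 X2 (- (r%:R / T%:R))) (iterate Y YW u v w)) e
}.

Definition super_module (V : lmodType F) (V_ : bool -> set V) (W : lmodType F)
    (W_ : bool -> set W) (YW : V -> series W) : Prop :=
  graded W_ /\
  forall al be u w e, V_ al u -> W_ be w -> W_ (al (+) be) (YW u e w).

End VertexSuperalgebras.

Section LocalSubspaces.
Context {F : fieldType}.
Variables (T : nat) (eta : F) (W : lmodType F) (W_ : bool -> set W).

Definition ET : set (series W) :=
  [set a | opseries T a /\ forall w, truncated 0 (fun e => a e w)].

(* f(x^(1/T)) |-> f(eta^-1 x^(1/T)); T e is an integer on the support *)
Definition gmap (a : series W) : series W :=
  fun e => eta ^ (- Num.floor (T%:R * e)) *: a e.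

Definition op_parity (al : bool) (a : series W) : Prop :=
  forall e be w, W_ be w -> W_ (al (+) be) (a e w).

Definition homog (r : nat) (al : bool) : set (series W) :=
  [set a | [/\ ET a, (r < T)%N, gmap a = eta ^+ r *: a & op_parity al a]].

Definition homogeneous (a : series W) : Prop := exists r al, homog r al a.

(* mutual locality of series a, b of parities al, be *)
Definition mutually_local (al be : bool) (a b : series W) : Prop :=
  exists k : nat, forall w e,
    smul (subpow X1 X2 k%:R) (ser12 a b w) e
    = sgn al be *: smul (subpow X1 X2 k%:R) (ser21 a b w) e.

Definition local_subspace (S : set (series W)) : Prop :=
  [/\ S `<=` ET,
      subspace S,
      S = smallest (@subspace F (series W)) (S `&` homogeneous)
    & forall r s al be a b, S a -> S b -> homog r al a -> homog s be b ->
        mutually_local al be a b].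

(* a(x)_n b(x), for a of degree r and parity al, and b of parity be; the
   variable x is x2, and Res_x1 Res_x0 is the coefficient of x0^-1 x1^-1 *)
Definition nprod (r : nat) (al be : bool) (n : int) (a b : series W) :
    series W := fun e w =>
  mshift (X0 n%:~R)
    (smul (ratiopow X1 X0 X2 (r%:R / T%:R)) (jacobi_lhs al be a b w))
    (-1, -1, e).

Definition prod_closed (U : set (series W)) : Prop :=
  forall r s al be a b (n : int), U a -> U b -> homog r al a -> homog s be b ->
    mutually_local al be a b -> U (nprod r al be n a b).

(* <S>, the smallest such subspace of E_T(W) containing S *)
Definition gen (S : set (series W)) : set (series W) :=
  smallest
    (fun U => [/\ U `<=` ET, subspace U, U (idser W) & prod_closed U]) S.

Lemma gen_submod_closed (S : set (series W)) : submod_closed (mem (gen S)).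
Proof.
split=> [|c a b]; rewrite !inE.
  by move=> U [[_ [U0 _] _ _] _]; move: U0; rewrite inE.
move=> ga gb U US; have [[_ [_ Ulin] _ _] _] := US.
by have := Ulin c a b; rewrite !inE; apply; [exact: ga|exact: gb].
Qed.

Lemma gen_idser (S : set (series W)) : idser W \in gen S.
Proof. by rewrite inE => U [[]]. Qed.

Definition gen_pred (S : set (series W)) : {pred series W} := mem (gen S).

HB.instance Definition _ (S : set (series W)) :=
  GRing.isSubmodClosed.Build F (series W) (gen_pred S) (gen_submod_closed S).

Definition gen_space (S : set (series W)) := {a : series W | gen_pred S a}.

HB.instance Definition _ (S : set (series W)) :=
  SubType.on (gen_space S).
HB.instance Definition _ (S : set (series W)) :=
  [Choice of gen_space S by <:].
HB.instance Definition _ (S : set (series W)) :=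
  [SubChoice_isSubLmodule of gen_space S by <:].

Definition gen_vac (S : set (series W)) : gen_space S :=
  exist _ (idser W) (gen_idser S).

Definition gen_parity (S : set (series W)) (al : bool) : set (gen_space S) :=
  [set a | op_parity al (val a)].

End LocalSubspaces.

Arguments gen_parity {F} T eta {W} W_ S al.

(* Main.v *)
Require Import Defs.
From mathcomp Require Import all_boot all_order all_algebra.
From mathcomp Require Import all_classical.
From mathcomp Require Import ring lra zify.
Import Order.TTheory GRing.Theory Num.Theory.
Set Implicit Arguments.
Unset Strict Implicit.
Unset Printing Implicit Defensive.
Local Open Scope classical_set_scope.
Local Open Scope ring_scope.

(** A series is handled through its modes: [a_m] is the coefficient of
    [x^(- m - 1)]. For two series the basic object is the bracket [bra], the
    coefficients of
      [(x1 - x2)^l a(x1) b(x2) - eps (- x2 + x1)^l b(x2) a(x1)],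
    for [l] in [Z]. Multiplication by [x1 - x2] raises [l] by one, and locality of
    order [k] says that the bracket vanishes for [l >= k]. If [a] has degree [r],
    with [rho = r/T], the product [a_l b] is the bracket to which the power
    [(x1/x2)^(- rho)] has been applied, where [x1/x2 = 1 + (x1 - x2)/x2] is
    expanded in powers of [(x1 - x2)/x2]; these sums are finite by locality.
    Since powers with exponents in [(1/T)Z] can be inverted ([bpow_add]), the
    bracket is recovered from the products ([bra_rprod]), and this is the twisted
    Jacobi identity on [W] ([jacobi_modes]).

    For three series, [brac] is the array of the coefficients of
    [(x1 - x2)^l (x1 - x3)^m (x2 - x3)^n [[a, b], c]], each term of the bracket
    being expanded in its own region. It satisfies the relation
    [x1 - x3 = (x1 - x2) + (x2 - x3)], and vanishes if [l >= k], and also if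
    [n >= k] and [l + m + n >= 3 k] ([brac_dong]). Hence the powers of [x1/x2]
    and [x2/x3] act on it by finite sums, and so do those of [x1/x3]
    ([brac_fin]). Dong's lemma follows ([loc_rprod]): products of mutually local
    series are local with the other ones. The iterated products [(a_l b)_n c] and [a_m (b_n c)] are obtained from
    [[a, b], c] and [a, [b, c]] by applying powers of these ratios
    ([rprod_left], [rprod_right]), whose exponents depend on the degrees of [a]
    and [b]. As [x1/x3 = (x1/x2) (x2/x3)] ([brac_bpow13]), the same powers occur on
    both sides, and the Jacobi identity [[a, b], c] = [a, [b, c]] - (+/-) [b, [a, c]]
    turns into the Borcherds identity of the products ([rprod_borcherds]), in
    which the twist has disappeared. This is the Jacobi identity of the vertex
    superalgebra.

    The characteristic enters through the binomial coefficients only: if [T] is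
    prime to [p], those of the elements of [(1/T)Z] are [p]-integral ([pint_binq]),
    so that the Vandermonde identity holds for their images in the field
    ([bn_vandermonde]); nothing is ever divided by a factorial.

    Finally the space generated by [S] is the span of the iterated products of
    homogeneous elements of [S] and of the identity ([gen_sp]): this span is
    local by Dong's lemma, and splits into its homogeneous components, so that
    every statement reduces to homogeneous series by linearity. *)

(** * Binomial coefficients *)

Lemma binq0 al : binq al 0 = 1.
Proof. by rewrite /binq big_ord0 fact0 divr1. Qed.

Lemma binqS al i : i.+1%:R * binq al i.+1 = (al - i%:R) * binq al i.
Proof.
rewrite /binq big_ord_recr /= factS natrM.
have i1 : i.+1%:R != 0 :> rat by rewrite pnatr_eq0.
have fi : i`!%:R != 0 :> rat by rewrite pnatr_eq0 -lt0n fact_gt0.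
by field; rewrite fi nat1r i1.
Qed.

Lemma binq_nat n i : binq n%:R i = 'C(n, i)%:R.
Proof.
elim: i => [|i IH]; first by rewrite binq0 bin0.
have i1 : i.+1%:R != 0 :> rat by rewrite pnatr_eq0.
apply: (mulfI i1); rewrite binqS IH -natrM mul_bin_left natrM.
case: (leqP i n) => [le_in|lt_ni]; first by rewrite natrB.
by rewrite bin_small // !mulr0.
Qed.

Lemma binq_vandermonde al be N :
  \sum_(i < N.+1) binq al i * binq be (N - i)%N = binq (al + be) N.
Proof.
elim: N => [|N IH]; first by rewrite big_ord_recl big_ord0 !binq0 mulr1 addr0.
have N1 : N.+1%:R != 0 :> rat by rewrite pnatr_eq0.
apply: (mulfI N1); rewrite binqS -IH big_distrr /=.
transitivity (\sum_(i < N.+2) i%:R * binq al i * binq be (N.+1 - i)%N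
  + \sum_(i < N.+2) binq al i * ((N.+1 - i)%:R * binq be (N.+1 - i)%N)).
  rewrite -big_split /=; apply: eq_bigr => i _.
  have le_i : (i <= N.+1)%N by rewrite -ltnS.
  rewrite (natrB _ le_i); move: (binq _ _) (binq _ _) => x y; ring.
rewrite big_ord_recl !mul0r add0r [X in _ + X]big_ord_recr /= subnn mul0r mulr0.
rewrite addr0 -big_split big_distrr; apply: eq_bigr => i _.
have le_iN : (i <= N)%N by rewrite -ltnS.
rewrite /= /bump /= add1n subSS subSn // binqS binqS (natrB _ le_iN).
move: (binq _ _) (binq _ _) => x y; ring.
Qed.

Lemma binq_trinomial al i j :
  binq al (i + j) * 'C(i + j, i)%:R = binq al i * binq (al - i%:R) j.
Proof.
elim: j => [|j IH]; first by rewrite addn0 binn binq0.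
have j1 : j.+1%:R != 0 :> rat by rewrite pnatr_eq0.
apply: (mulfI j1); rewrite [RHS]mulrCA binqS [RHS]mulrCA -IH.
rewrite addnS [LHS]mulrCA -natrM.
have -> : (j.+1 * 'C((i + j).+1, i))%N = ((i + j).+1 * 'C(i + j, i))%N.
  by rewrite (mul_bin_down (i + j).+1 i) /= -addnS addKn.
rewrite natrM mulrCA mulrA binqS natrD; move: (binq _ _) => x; ring.
Qed.

Lemma binqN al i : binq (- al) i = (-1) ^+ i * binq (al + i%:R - 1) i.
Proof.
rewrite /binq mulrA; congr (_ / _).
rewrite -[X in (-1) ^+ X](card_ord i) -prodrN (reindex_inj rev_ord_inj) /=.
by apply: eq_bigr => j _; rewrite natrB //= -natr1; ring.
Qed.

Section PIntegral.
Variable F : fieldType.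

(** [q] has a denominator that is invertible in [F], so that [ratr q] is the
    reduction of [q] in [F]. *)
Definition pint (q : rat) := (denq q)%:~R != 0 :> F.

Lemma pint_frac (a b : int) : b%:~R != 0 :> F ->
  pint (a%:~R / b%:~R) /\ ratr (a%:~R / b%:~R) = a%:~R / b%:~R :> F.
Proof.
move=> bF; set q := a%:~R / b%:~R : rat.
have b0 : b != 0 by apply: contra bF => /eqP->.
have Eq : numq q * b = a * denq q.
  apply/eqP; rewrite -(eqr_int rat) !rmorphM /= numqE /q.
  have bq : b%:~R != 0 :> rat by rewrite intr_eq0.
  by apply/eqP; field.
have dvd : (denq q %| b)%Z.
  rewrite -(@Gauss_dvdzr _ (numq q)) ?Eq ?dvdz_mull //.
  by rewrite /coprimez gcdzC; have := coprime_num_den q; rewrite /coprime /gcdz => /eqP->.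
case/dvdzP: dvd => c bE.
have dF : pint q by apply: contraNneq bF => d0; rewrite bE rmorphM /= d0 mulr0.
split=> //; rewrite /ratr; apply: (mulIf bF); rewrite mulfVK // mulrAC.
by apply: (mulIf dF); rewrite mulfVK // -!rmorphM /= Eq.
Qed.

Lemma pintP q : pint q <-> exists a b : int, b%:~R != 0 :> F /\ q = a%:~R / b%:~R.
Proof.
split=> [dF|[a [b [bF ->]]]]; last by have [] := pint_frac a bF.
by exists (numq q), (denq q); rewrite divq_num_den.
Qed.

Lemma pintD q r : pint q -> pint r -> pint (q + r) /\
  ratr (q + r) = ratr q + ratr r :> F.
Proof.
move=> /pintP[a [b [bF ->]]] /pintP[c [d [dF ->]]].
have b0 : b%:~R != 0 :> rat.
  by rewrite intr_eq0; apply: contra bF => /eqP->.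
have d0 : d%:~R != 0 :> rat.
  by rewrite intr_eq0; apply: contra dF => /eqP->.
have -> : a%:~R / b%:~R + c%:~R / d%:~R = (a * d + c * b)%:~R / (b * d)%:~R :> rat.
  by rewrite !(rmorphM, rmorphD) /=; field; rewrite b0 d0.
have bdF : (b * d)%:~R != 0 :> F by rewrite rmorphM /= mulf_neq0.
have [-> ->] := pint_frac (a * d + c * b) bdF.
have [_ ->] := pint_frac a bF; have [_ ->] := pint_frac c dF.
by split=> //; rewrite !(rmorphM, rmorphD) /=; field; rewrite bF dF.
Qed.

Lemma pintM q r : pint q -> pint r -> pint (q * r) /\
  ratr (q * r) = ratr q * ratr r :> F.
Proof.
move=> /pintP[a [b [bF ->]]] /pintP[c [d [dF ->]]].
have b0 : b%:~R != 0 :> rat.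
  by rewrite intr_eq0; apply: contra bF => /eqP->.
have d0 : d%:~R != 0 :> rat.
  by rewrite intr_eq0; apply: contra dF => /eqP->.
have -> : a%:~R / b%:~R * (c%:~R / d%:~R) = (a * c)%:~R / (b * d)%:~R :> rat.
  by rewrite !rmorphM /=; field; rewrite b0 d0.
have bdF : (b * d)%:~R != 0 :> F by rewrite rmorphM /= mulf_neq0.
have [-> ->] := pint_frac (a * c) bdF.
have [_ ->] := pint_frac a bF; have [_ ->] := pint_frac c dF.
by split=> //; rewrite !rmorphM /=; field; rewrite bF dF.
Qed.

Lemma pint_int (z : int) : pint z%:~R.
Proof. by rewrite /pint denq_int oner_eq0. Qed.

Lemma ratr_sum_pint (I : Type) (s : seq I) (f : I -> rat) :
  (forall i, pint (f i)) -> pint (\sum_(i <- s) f i) /\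
  ratr (\sum_(i <- s) f i) = \sum_(i <- s) ratr (f i) :> F.
Proof.
move=> fP; elim: s => [|x s [IH1 IH2]]; first by rewrite !big_nil (ratr_nat _ 0); split=> //; exact: (pint_int 0).
rewrite !big_cons -IH2; exact: pintD.
Qed.

End PIntegral.

Lemma dvdz_prodB (I : Type) (s : seq I) (d : int) (f g : I -> int) :
  (forall i, d %| f i - g i)%Z -> (d %| \prod_(i <- s) f i - \prod_(i <- s) g i)%Z.
Proof.
move=> fg; elim: s => [|x s IH]; first by rewrite !big_nil subrr dvdz0.
rewrite !big_cons.
have -> : f x * \prod_(j <- s) f j - g x * \prod_(j <- s) g j
   = f x * (\prod_(j <- s) f j - \prod_(j <- s) g j)
     + (f x - g x) * \prod_(j <- s) g j by ring.
by apply: rpredD; [apply: dvdz_mull|apply: dvdz_mulr].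
Qed.

(** The product of [i] terms of an arithmetic progression whose step [t] is
    prime to [p] is divisible by the power of [p] dividing [i!]: modulo that
    power, it is [t ^+ i] times a product of consecutive integers. *)
Lemma dvdz_prod_arith (p t : nat) (m : int) (i : nat) : prime p -> coprime t p ->
  ((p ^ logn p i`!)%N %| \prod_(j < i) (m - j%:Z * t%:Z))%Z.
Proof.
move=> p_pr cotp; set q := (p ^ logn p i`!)%N.
have cotq : coprime t q by rewrite coprimeXr.
have q_gt0 : (0 < q)%N by rewrite expn_gt0 prime_gt0.
have [u [qu coqu]] : exists u, (q %| t%:Z * u - 1)%Z /\ coprimez q u.
  have [[u v] /= _ Euv] : exists2 uv : int * int, true &
      uv.1 * t%:Z + uv.2 * q%:Z = 1.
    have [u [v E]] := Bezoutz t%:Z q%:Z; exists (u, v) => //=.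
    by rewrite E /gcdz /= (eqP cotq).
  exists u; split; first by apply/dvdzP; exists (- v); rewrite -Euv; ring.
  by apply/coprimezP; exists (v, t%:Z) => /=; rewrite -Euv; ring.
set z := `|((m * u) %% q)%Z|%N.
have zE : (q %| u * m - z%:Z)%Z.
  rewrite /z gez0_abs ?modz_ge0 //; last by rewrite -lt0n.
  by apply/dvdzP; exists ((m * u) %/ q)%Z; rewrite mulrC {1}(divz_eq (m * u) q); ring.
have coqu' : coprimez q (u ^+ i) by rewrite coprimezXr.
rewrite -(Gauss_dvdzr _ coqu') -[X in u ^+ X](card_ord i) -prodr_const -big_split /=.
have: (q %| \prod_(j < i) (u * (m - j%:Z * t%:Z)) - \prod_(j < i) (z%:Z - j%:Z))%Z.
  apply: dvdz_prodB => j.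
  have -> : u * (m - j%:Z * t%:Z) - (z%:Z - j%:Z)
     = (u * m - z%:Z) - (t%:Z * u - 1) * j%:Z by ring.
  by rewrite rpredB // dvdz_mulr.
rewrite rpredBr //.
have -> : \prod_(j < i) (z%:Z - j%:Z) = (z ^_ i)%N.
  case: (leqP i z) => [le_iz|lt_zi].
    rewrite ffact_prod (big_morph Posz PoszM (erefl _)); apply: eq_bigr => j _.
    by rewrite subzn // (leq_trans _ le_iz) // ltnW.
  by rewrite ffact_small // (bigD1 (Ordinal lt_zi)) //= subrr mul0r.
by rewrite dvdzE /= -bin_ffact dvdn_mull // pfactor_dvdnn.
Qed.

Section Binomials.
Context {F : fieldType}.

(** The image in [F] of a binomial coefficient; the value is the expected one
    only if the denominator is invertible in [F], as it is for [al] in [(1/T)Z]. *)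
Definition bn (al : rat) (i : nat) : F := ratr (binq al i).

Lemma bn0 al : bn al 0 = 1.
Proof. by rewrite /bn binq0 (ratr_nat _ 1). Qed.

Lemma bn_nat n i : bn n%:R i = 'C(n, i)%:R.
Proof. by rewrite /bn binq_nat ratr_nat. Qed.

Lemma bn_eq0S i : bn 0 i.+1 = 0.
Proof. by rewrite (bn_nat 0) bin0n. Qed.

Lemma bn1 i : bn 1 i = (i <= 1)%N%:R.
Proof. by rewrite (bn_nat 1); case: i => [|[|i]]; rewrite ?bin0 ?bin1 ?bin_small. Qed.

Variable T : nat.
Hypothesis T_inv : T%:R != 0 :> F.

(** [al] lies in [(1/T)Z], the set of exponents of the series in [x^(1/T)]. *)
Definition tint (al : rat) := T%:R * al \is a Num.int.

Lemma tintD al be : tint al -> tint be -> tint (al + be).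
Proof. by rewrite /tint mulrDr; exact: rpredD. Qed.
Lemma tintN al : tint al -> tint (- al).
Proof. by rewrite /tint mulrN rpredN. Qed.
Lemma tintB al be : tint al -> tint be -> tint (al - be).
Proof. by move=> ? ?; apply: tintD => //; apply: tintN. Qed.
Lemma tint_int al : al \is a Num.int -> tint al.
Proof. by move=> al_int; rewrite /tint rpredM // natr_int. Qed.
Lemma tint_intr (n : int) : tint n%:~R.
Proof. exact/tint_int/intr_int. Qed.
Lemma tint_nat (n : nat) : tint n%:R.
Proof. exact: (tint_intr n). Qed.
Lemma tint_frac (r : nat) : tint (r%:R / T%:R).
Proof.
have T0 : T%:R != 0 :> rat.
  by rewrite pnatr_eq0; apply: contra T_inv => /eqP->.
by rewrite /tint mulrC divfK // natr_int.
Qed.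

Variable p : nat.
Hypothesis charF : p \in [pchar F].

(** The denominator of [C(al, i)] divides a power of [T] times the part of [i!]
    prime to [p]. *)
Lemma pint_binq al i : tint al -> pint F (binq al i).
Proof.
move=> /intrP[m Em].
have p_pr := pcharf_prime charF.
have T0 : T%:R != 0 :> rat.
  by rewrite pnatr_eq0; apply: contra T_inv => /eqP->.
have coT : coprime T p.
  by rewrite coprime_sym prime_coprime // (dvdn_pcharf charF).
have /dvdzP[Y EY] := @dvdz_prod_arith p T m i p_pr coT.
have [//|u cou Eu] := @pfactor_coprime p i`! p_pr; first exact: fact_gt0.
apply/pintP; exists Y, ((T ^ i * u)%N)%:Z; split.
  rewrite -pmulrn natrM natrX mulf_neq0 ?expf_neq0 //.
  by rewrite -(dvdn_pcharf charF) -prime_coprime.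
have q0 : (p ^ logn p i`!)%:R != 0 :> rat.
  by rewrite pnatr_eq0 -lt0n expn_gt0 prime_gt0.
have u0 : u%:R != 0 :> rat.
  rewrite pnatr_eq0; apply: contraTneq cou => ->.
  by rewrite /coprime gcdn0; have := prime_gt1 p_pr; case: (p) => [|[]].
rewrite -pmulrn natrM natrX /binq Eu natrM.
have Ti0 : T%:R ^+ i != 0 :> rat by rewrite expf_neq0.
have -> : \prod_(j < i) (al - j%:R) = (Y * (p ^ logn p i`!)%N)%:~R / T%:R ^+ i.
  rewrite -EY rmorph_prod /=; apply: (mulIf Ti0); rewrite divfK //.
  rewrite -[X in T%:R ^+ X](card_ord i) -prodr_const -big_split /=.
  by apply: eq_bigr => j _; rewrite rmorphB rmorphM /= -Em; ring.
rewrite rmorphM /= -pmulrn; move: q0 u0 Ti0; move: ((p ^ _)%:R) (u%:R) (T%:R ^+ i) => Q U V Q0 U0 V0.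
by field; rewrite V0 U0 Q0.
Qed.

Lemma bn_vandermonde al be N : tint al -> tint be ->
  \sum_(i < N.+1) bn al i * bn be (N - i)%N = bn (al + be) N.
Proof.
move=> Tal Tbe; rewrite /bn -binq_vandermonde.
have P i := pintM (pint_binq i Tal) (pint_binq (N - i)%N Tbe).
have [_ ->] := ratr_sum_pint (index_enum 'I_N.+1) (fun i : 'I_N.+1 => (P i).1).
by apply: eq_bigr => i _; rewrite (P i).2.
Qed.

Lemma bn_trinomial al i j : tint al ->
  bn al (i + j) * 'C(i + j, i)%:R = bn al i * bn (al - i%:R) j.
Proof.
move=> Tal; have Tali : tint (al - i%:R) by apply: tintB => //; exact: tint_nat.
rewrite /bn -(pintM (pint_binq i Tal) (pint_binq j Tali)).2 -binq_trinomial.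
have C := pint_int F ('C(i + j, i)%:Z); rewrite -pmulrn in C.
by rewrite (pintM (pint_binq _ Tal) C).2 ratr_nat.
Qed.

Lemma bnN al i : bn (- al) i = (-1) ^+ i * bn (al + i%:R - 1) i.
Proof. rewrite /bn binqN; move: (binq _ _) => x.
rewrite -signr_odd -[in RHS]signr_odd; case: (odd i); last by rewrite !mul1r.
by rewrite !mulN1r /ratr numqN denqN rmorphN mulNr. Qed.

(** The coefficients of [(1 - z / (1 + z))^al = (1 + z)^(- al)]. *)
Lemma bn_subst al N : tint al ->
  \sum_(j < N.+1) (-1) ^+ j * bn al j * bn (- j%:R) (N - j)%N = bn (- al) N.
Proof.
move=> Tal; rewrite bnN.
case: N => [|N]; first by rewrite big_ord_recl big_ord0 /= oppr0 !bn0 addr0 !mulr1.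
have -> : al + N.+1%:R - 1 = al + N%:R by rewrite -natr1; ring.
rewrite -bn_vandermonde ?big_distrr //; last exact: tint_nat.
apply: eq_bigr => -[j /= le_jN] _.
have -> : bn (- j%:R) (N.+1 - j) = (-1) ^+ (N.+1 - j) * bn N%:R (N.+1 - j).
  case: j le_jN => [|j] le_jN.
    by rewrite oppr0 subn0 bn_eq0S bn_nat bin_small // mulr0.
  rewrite bnN; congr (_ * bn _ _).
  by rewrite natrB // -!natr1; ring.
by rewrite mulrACA -exprD subnKC // ltnW.
Qed.

End Binomials.

(* The coefficients are never computed below, and comparing them by unfolding is
   expensive. *)
Local Opaque bn binq.

(** * Finitely supported sums over the natural numbers *)

Section NatSums.
Context {F : fieldType} {W : lmodType F}.
Implicit Types f g : nat -> W.

(** The sum of a family with finite support, and 0 if the support is infinite. *)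
Definition nsum (f : nat -> W) : W := \sum_(i \in [set: nat]) f i.

Lemma nsumE N f : (forall i, (N <= i)%N -> f i = 0) -> nsum f = \sum_(i < N) f i.
Proof.
move=> f0; rewrite -(big_mkord xpredT f) /nsum.
rewrite (fsbigE (index_iota 0 N)) ?iota_uniq //; last first.
  by move=> i _; rewrite mem_index_iota /= -leqNgt; exact: f0.
by rewrite big_seq_cond [RHS]big_seq_cond; apply: eq_bigl => i; rewrite in_setT.
Qed.

Lemma eq_nsum f g : f =1 g -> nsum f = nsum g.
Proof. by move=> fg; apply: eq_fsbigr => i _. Qed.

Lemma nsum0 f : (forall i, f i = 0) -> nsum f = 0.
Proof. by move=> f0; rewrite (@nsumE 0) ?big_ord0. Qed.

Lemma nsumZ N c f : (forall i, (N <= i)%N -> f i = 0) ->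
  nsum (fun i => c *: f i) = c *: nsum f.
Proof.
move=> f0; rewrite (nsumE f0) scaler_sumr; apply: nsumE => i /f0 ->.
exact: scaler0.
Qed.

Lemma nsumD N f g : (forall i, (N <= i)%N -> f i = 0) ->
  (forall i, (N <= i)%N -> g i = 0) -> nsum (fun i => f i + g i) = nsum f + nsum g.
Proof.
move=> f0 g0; rewrite (nsumE f0) (nsumE g0) -big_split; apply: nsumE => i Ni.
by rewrite f0 ?g0 ?addr0.
Qed.

Lemma nsum2E N (f : nat -> nat -> W) :
  (forall i j, (N <= i)%N || (N <= j)%N -> f i j = 0) ->
  nsum (fun i => nsum (f i)) = \sum_(i < N) \sum_(j < N) f i j.
Proof.
move=> f0; rewrite (@nsumE N) => [|i Ni]; last first.
  by apply: nsum0 => j; rewrite f0 ?Ni.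
by apply: eq_bigr => i _; apply: nsumE => j Nj; rewrite f0 ?Nj ?orbT.
Qed.

Lemma nsum_exchange N (f : nat -> nat -> W) :
  (forall i j, (N <= i)%N || (N <= j)%N -> f i j = 0) ->
  nsum (fun i => nsum (f i)) = nsum (fun j => nsum (f^~ j)).
Proof.
move=> f0; rewrite (nsum2E f0) exchange_big /= (@nsum2E N) // => i j.
by rewrite orbC; apply: f0.
Qed.

Lemma triangle_sum N (f : nat -> nat -> W) :
  (forall i j, (N <= i + j)%N -> f i j = 0) ->
  \sum_(i < N) \sum_(j < N) f i j = \sum_(n < N) \sum_(i < n.+1) f i (n - i)%N.
Proof.
move=> f0.
transitivity (\sum_(i < N) \sum_(n < N | (i <= n)%N) f i (n - i)%N).
  apply: eq_bigr => -[i /= iN] _.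
  rewrite (bigID (fun j : 'I_N => (i + j < N)%N)) /= [X in _ + X]big1 ?addr0; last first.
    by move=> j; rewrite -leqNgt => /f0.
  rewrite -(big_mkord (fun j => i + j < N)%N (f i)).
  rewrite -(big_mkord (fun n => i <= n)%N (fun n => f i (n - i)%N)).
  rewrite [RHS](@big_cat_nat _ _ _ i) //=; last exact: ltnW.
  rewrite [X in _ = X + _]big_nat_cond [X in _ = X + _]big1 ?add0r; last first.
    by move=> n /andP[n_lt i_le]; exfalso; lia.
  rewrite -[X in _ = \sum_(X <= _ < _ | _) _]add0n big_addn.
  rewrite [LHS](@big_cat_nat _ _ _ (N - i)) ?leq_subr //=.
  rewrite [X in _ + X]big_nat_cond [X in _ + X]big1 ?addr0; last first.
    by move=> n /andP[n_lt i_le]; exfalso; lia.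
  rewrite big_nat_cond [RHS]big_nat_cond; apply: eq_big => n.
    by lia.
  by rewrite addnK.
rewrite (exchange_big_dep xpredT) //=; apply: eq_bigr => n _.
rewrite -(big_mkord (fun i => i <= n)%N (fun i => f i (n - i)%N)).
rewrite (@big_cat_nat _ _ _ n.+1) //= [X in _ + X]big_nat_cond [X in _ + X]big1 ?addr0; last first.
  by move=> j /andP[j_lt j_le]; exfalso; lia.
rewrite -(big_mkord xpredT (fun i => f i (n - i)%N)) big_nat_cond [RHS]big_nat_cond.
by apply: eq_bigl => j; lia.
Qed.

(** Summation along antidiagonals. *)
Lemma nsum_triangle N (f : nat -> nat -> W) :
  (forall i j, (N <= i + j)%N -> f i j = 0) ->
  nsum (fun i => nsum (f i)) = nsum (fun n => \sum_(i < n.+1) f i (n - i)%N).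
Proof.
move=> f0; rewrite (@nsum2E N) => [|i j /orP[Nij|Nij]]; last first.
- by rewrite f0 // (leq_trans Nij) ?leq_addl.
- by rewrite f0 // (leq_trans Nij) ?leq_addr.
rewrite triangle_sum //; apply/esym/nsumE => n Nn; apply: big1 => -[i /= ni] _.
by rewrite f0 // subnKC // -ltnS.
Qed.

End NatSums.

Lemma nsum_linear (F : fieldType) (V W : lmodType F) (h : V -> W) N (f : nat -> V) :
  linear h -> (forall i, (N <= i)%N -> f i = 0) ->
  h (nsum f) = nsum (fun i => h (f i)).
Proof.
move=> hlin f0.
have hD u v : h (u + v) = h u + h v by have := hlin 1 u v; rewrite !scale1r.
have h0 : h 0 = 0 by apply: (addrI (h 0)); rewrite -hD !addr0.
rewrite (nsumE f0) (@nsumE _ _ N) => [|i /f0 -> //].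
by rewrite (big_morph h hD h0).
Qed.

(** * Powers of shift operators *)

Section ShiftPowers.
Context {F : fieldType} {W : lmodType F} {L : zmodType}.
Implicit Types (f g : L -> W) (d u v e : L) (s : F).

(** The action on arrays [L -> W] of the power [(1 + s E_d)^al], where [E_d] is
    the shift by [d], expanded in powers of [E_d]. *)
Definition bpow s (al : rat) d f : L -> W := fun e =>
  nsum (fun i => (s ^+ i * bn al i) *: f (e + d *+ i)).

(** [f] vanishes far away in the direction [d], resp. in the cone spanned by
    [u] and [v], from any starting point: the sums of [bpow] are finite. *)
Definition fin d f := forall e, exists N, forall i, (N <= i)%N -> f (e + d *+ i) = 0.
Definition fin2 u v f := forall e, exists N, forall i j,
  (N <= i + j)%N -> f (e + u *+ i + v *+ j) = 0.

Lemma fin2_fin u v f : fin2 u v f -> fin u f.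
Proof.
by move=> fuv e; have [N fN] := fuv e; exists N => i Ni; rewrite -(fN i 0%N) ?addn0 ?addr0.
Qed.

Lemma fin2C u v f : fin2 u v f -> fin2 v u f.
Proof.
by move=> fuv e; have [N fN] := fuv e; exists N => i j Nij; rewrite addrAC fN // addnC.
Qed.

Lemma fin2_cone a b a' b' u v f : (0 < a + b)%N -> (0 < a' + b')%N ->
  fin2 u v f -> fin2 (u *+ a + v *+ b) (u *+ a' + v *+ b') f.
Proof.
move=> ab ab' fuv e; have [N fN] := fuv e; exists N => i j Nij.
have -> : e + (u *+ a + v *+ b) *+ i + (u *+ a' + v *+ b') *+ j
   = e + u *+ (a * i + a' * j) + v *+ (b * i + b' * j).
  by rewrite !mulrnDr !mulrnDl !mulrnA -addrA addrACA addrA.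
by apply: fN; apply: (leq_trans Nij); nia.
Qed.

Lemma fin2_bpow s al u v f : fin2 u v f -> fin2 u v (bpow s al u f).
Proof.
move=> fuv e; have [N fN] := fuv e; exists N => i j Nij; apply: nsum0 => k.
rewrite [_ + u *+ k]addrAC -[e + _ + _]addrA -mulrnDr fN ?scaler0 //.
by rewrite (leq_trans Nij) // addnAC leq_addr.
Qed.

Lemma fin2_bpow_cone s al a b u v f : fin2 u v f ->
  fin2 u v (bpow s al (u *+ a + v *+ b) f).
Proof.
move=> fuv e; have [N fN] := fuv e; exists N => i j Nij; apply: nsum0 => k.
have -> : e + u *+ i + v *+ j + (u *+ a + v *+ b) *+ k
   = e + u *+ (i + a * k) + v *+ (j + b * k).
  rewrite mulrnDl !mulrnDr !mulrnA -!addrA; congr (_ + (_ + _)); exact: addrCA.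
by rewrite fN ?scaler0 //; lia.
Qed.

Lemma eq_bpow s al d f g e : (forall i, f (e + d *+ i) = g (e + d *+ i)) ->
  bpow s al d f e = bpow s al d g e.
Proof. by move=> fg; apply: eq_nsum => i; rewrite fg. Qed.

Lemma bpow_shift s al d v f e :
  bpow s al d (fun e => f (e + v)) e = bpow s al d f (e + v).
Proof. by apply: eq_nsum => i; rewrite addrAC. Qed.

Lemma bpow_fin_term s al d f e N : (forall i, (N <= i)%N -> f (e + d *+ i) = 0) ->
  forall i, (N <= i)%N -> (s ^+ i * bn al i) *: f (e + d *+ i) = 0.
Proof. by move=> fN i /fN ->; rewrite scaler0. Qed.

Lemma bpowZ s al d c f e : fin d f ->
  bpow s al d (fun e => c *: f e) e = c *: bpow s al d f e.
Proof.
move=> /(_ e)[N /bpow_fin_term fN]; rewrite -(nsumZ _ (fN s al)).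
by apply: eq_nsum => i; rewrite !scalerA mulrC.
Qed.

Lemma bpowD s al d f g e : fin d f -> fin d g ->
  bpow s al d (fun e => f e + g e) e = bpow s al d f e + bpow s al d g e.
Proof.
move=> /(_ e)[N fN] /(_ e)[M gM].
rewrite -(@nsumD _ _ (maxn N M)).
- by apply: eq_nsum => i; rewrite scalerDr.
- by move=> i; rewrite geq_max => /andP[Ni _]; apply: (bpow_fin_term _ _ fN).
- by move=> i; rewrite geq_max => /andP[_ Mi]; apply: (bpow_fin_term _ _ gM).
Qed.

Lemma bpowB s al d f g e : fin d f -> fin d g ->
  bpow s al d (fun e => f e - g e) e = bpow s al d f e - bpow s al d g e.
Proof.
move=> fd gd; rewrite -[in RHS]scaleN1r -(bpowZ _ _ _ _ gd) -bpowD //.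
  by apply: eq_bpow => i; rewrite scaleN1r.
by move=> e'; have [N gN] := gd e'; exists N => i /gN ->; rewrite scaler0.
Qed.

Lemma fin_shift d v f : fin d f -> fin d (fun e => f (e + v)).
Proof. by move=> fd e; have [N fN] := fd (e + v); exists N => i /fN <-; rewrite addrAC. Qed.

Lemma finZ d (c : F) f : fin d f -> fin d (fun e => c *: f e).
Proof. by move=> fd e; have [N fN] := fd e; exists N => i /fN ->; rewrite scaler0. Qed.

Lemma fin2B u v f g : fin2 u v f -> fin2 u v g -> fin2 u v (fun e => f e - g e).
Proof.
move=> fuv guv e; have [N fN] := fuv e; have [M gM] := guv e.
by exists (maxn N M) => i j; rewrite geq_max => /andP[/fN -> /gM ->]; rewrite subrr.
Qed.

Lemma bpow_rel s al d s' v v' f : fin d f ->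
  (forall e, f (e + v) = f e + s' *: f (e + v')) ->
  forall e, bpow s al d f (e + v) = bpow s al d f e + s' *: bpow s al d f (e + v').
Proof.
move=> fd fv e; rewrite -!bpow_shift -bpowZ; last exact: fin_shift.
rewrite -bpowD //; first by apply: eq_bpow => i; rewrite fv.
exact/finZ/fin_shift.
Qed.

Lemma bpow0 s d f e : bpow s 0 d f e = f e.
Proof.
rewrite /bpow (@nsumE _ _ 1) => [|[|i] // _]; last by rewrite bn_eq0S mulr0 scale0r.
by rewrite big_ord1 expr0 bn0 mulr1 scale1r addr0.
Qed.

Lemma bpow1 s d f e : bpow s 1 d f e = f e + s *: f (e + d).
Proof.
rewrite /bpow (@nsumE _ _ 2) => [|[|[|i]] // _]; last by rewrite bn1 mulr0 scale0r.
by rewrite big_ord_recl big_ord1 /= !bn1 !mulr1 expr0 scale1r expr1 addr0.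
Qed.

Lemma bpowC s s' al be d d' f e : fin2 d d' f ->
  bpow s al d (bpow s' be d' f) e = bpow s' be d' (bpow s al d f) e.
Proof.
move=> /(_ e)[N fN].
pose g i j := (s ^+ i * bn al i * (s' ^+ j * bn be j)) *: f (e + d *+ i + d' *+ j).
have g0 i j : (N <= i)%N || (N <= j)%N -> g i j = 0.
  by move=> Nij; rewrite /g fN ?scaler0 //; lia.
transitivity (nsum (fun i => nsum (g i))).
  apply: eq_nsum => i; rewrite -(@nsumZ _ _ N) => [|j Nj].
    by apply: eq_nsum => j; rewrite scalerA.
  by rewrite fN ?scaler0 // (leq_trans Nj) ?leq_addl.
rewrite (nsum_exchange g0); apply: eq_nsum => j; rewrite -(@nsumZ _ _ N) => [|i Ni].
  by apply: eq_nsum => i; rewrite scalerA mulrC addrAC.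
by rewrite addrAC fN ?scaler0 // (leq_trans Ni) ?leq_addr.
Qed.

(** A sequence of arrays in which each term is [E_u + s E_v] applied to the
    preceding one. *)
Lemma shift_binomial s u v (h : nat -> L -> W) n e :
  (forall n e, h n.+1 e = h n (e + u) + s *: h n (e + v)) ->
  h n e = \sum_(i < n.+1) (s ^+ i * 'C(n, i)%:R) *: h 0%N (e + v *+ i + u *+ (n - i)).
Proof.
move=> hS; elim: n e => [|n IH] e.
  by rewrite big_ord1 bin0 expr0 mul1r scale1r !addr0.
pose k i j := h 0%N (e + v *+ i + u *+ j).
have ku i j : h 0%N (e + u + v *+ i + u *+ j) = k i j.+1.
  by rewrite /k -!addrA; congr (h _ (_ + _)); rewrite addrCA -mulrS.
have kv i j : h 0%N (e + v + v *+ i + u *+ j) = k i.+1 j.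
  by rewrite /k mulrS addrA.
rewrite hS !IH scaler_sumr.
under eq_bigr do rewrite ku; under [X in _ + X]eq_bigr do rewrite kv scalerA mulrA -exprS.
rewrite big_ord_recl [X in _ + X = _]big_ord_recr [RHS]big_ord_recl big_ord_recr /=.
rewrite /bump /= !add1n subSS subnn !subn0 !bin0 !binn -[h _ _]/(k 0 n.+1)%N.
rewrite -[h _ (_ + v *+ n.+1 + _)]/(k n.+1 0)%N -addrA; congr (_ + _).
rewrite addrA; congr (_ + _); rewrite -big_split.
apply: eq_bigr => -[i /= lt_in] _.
by rewrite !add1n subSS binS natrD mulrDr scalerDl subnSK.
Qed.

Variables T p : nat.
Hypothesis T_inv : T%:R != 0 :> F.
Hypothesis charF : p \in [pchar F].

Lemma bpow_add s al be d f e : tint T al -> tint T be -> fin d f ->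
  bpow s al d (bpow s be d f) e = bpow s (al + be) d f e.
Proof.
move=> Tal Tbe /(_ e)[N fN].
pose g i j := (s ^+ (i + j) * (bn al i * bn be j)) *: f (e + d *+ (i + j)).
have g0 i j : (N <= i + j)%N -> g i j = 0.
  by move=> Nij; rewrite /g fN ?scaler0.
transitivity (nsum (fun i => nsum (g i))).
  apply: eq_nsum => i; rewrite -(@nsumZ _ _ N) => [|j Nj].
    by apply: eq_nsum => j; rewrite scalerA mulrACA -exprD -addrA -mulrnDr.
  by rewrite -addrA -mulrnDr fN ?scaler0 // (leq_trans Nj) ?leq_addl.
rewrite (nsum_triangle g0); apply: eq_nsum => n.
rewrite -(bn_vandermonde T_inv charF _ Tal Tbe) mulr_sumr scaler_suml.
by apply: eq_bigr => -[i /= ni] _; rewrite /g subnKC // -ltnS.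
Qed.

(** If [E_t = 1 + s E_d] on [f], then so are the integral powers. *)
Lemma bpow_int s d t f (n : int) e :
  (forall e, f (e + t) = f e + s *: f (e + d)) -> fin d f ->
  bpow s n%:~R d f e = f (e + t *~ n).
Proof.
move=> ft fd; have T1 := tint_intr T.
have nat_case (m : nat) e' : bpow s m%:R d f e' = f (e' + t *+ m).
  elim: m e' => [|m IH] e'; first by rewrite bpow0 addr0.
  rewrite -nat1r -(bpow_add _ _ (T1 1) (T1 m) fd) bpow1 !IH.
  by rewrite mulrSr addrA ft addrAC.
case: n => n; first exact: nat_case.
rewrite NegzE !mulrNz -[e in LHS](addrK (t *+ n.+1)) addrAC.
rewrite -(bpow_shift _ _ _ (t *+ n.+1)).
have -> : (n.+1%:~R : rat) = n.+1%:R by [].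
transitivity (bpow s (- n.+1%:R) d (bpow s n.+1%:R d f) (e - t *+ n.+1)).
  by apply: eq_bpow => i; rewrite nat_case.
rewrite bpow_add ?addNr ?bpow0 //; last exact: (T1 n.+1).
by apply: tintN; exact: (T1 n.+1).
Qed.

(** [(1 + E_u + E_v)^al = \sum_i C(al, i) E_v^i (1 + E_u)^(al - i)]. *)
Lemma bpow_split al t u v f e : tint T al ->
  (forall e, f (e + t) = f (e + u) + f (e + v)) -> fin2 u v f ->
  bpow 1 al t f e = nsum (fun i => bn al i *: bpow 1 (al - i%:R) u f (e + v *+ i)).
Proof.
move=> Tal ft fuv.
have ftn n e' : f (e' + t *+ n) =
    \sum_(i < n.+1) 'C(n, i)%:R *: f (e' + v *+ i + u *+ (n - i)).
  rewrite (@shift_binomial 1 u v (fun n e => f (e + t *+ n))) => [|{}n {}e'].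
    by apply: eq_bigr => i _; rewrite expr1n mul1r !addr0.
  by rewrite mulrSr addrA ft scale1r (addrAC _ u) (addrAC _ v).
have [N fN] := fuv e.
pose g i j := (bn al (i + j) * 'C(i + j, i)%:R) *: f (e + v *+ i + u *+ j).
have g0 i j : (N <= i + j)%N -> g i j = 0.
  by move=> Nij; rewrite /g addrAC fN ?scaler0 // addnC.
transitivity (nsum (fun n => \sum_(i < n.+1) g i (n - i)%N)).
  apply: eq_nsum => n; rewrite ftn expr1n mul1r scaler_sumr.
  by apply: eq_bigr => -[i /= ni] _; rewrite /g subnKC // scalerA.
rewrite -(nsum_triangle g0); apply: eq_nsum => i.
rewrite -(@nsumZ _ _ N) => [|j Nj].
  apply: eq_nsum => j; rewrite scalerA expr1n mul1r.
  by rewrite -(bn_trinomial T_inv charF).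
by rewrite addrAC fN ?scaler0 // (leq_trans Nj) ?leq_addr.
Qed.

(** If [E_t = 1 + E_d] on [f], then [(1 - E_(d - t))^al = (1 + E_d)^(- al)]. *)
Lemma bpow_inv al d t f e : tint T al ->
  (forall e, f (e + t) = f e + f (e + d)) -> fin d f ->
  bpow (-1) al (d - t) f e = bpow 1 (- al) d f e.
Proof.
move=> Tal ft fd; have [N fN] := fd e.
have ft1 e' : f (e' + t) = f e' + 1 *: f (e' + d) by rewrite scale1r.
pose g i j := ((-1) ^+ i * bn al i * bn (- i%:R) j) *: f (e + d *+ (i + j)).
have g0 i j : (N <= i + j)%N -> g i j = 0 by move=> Nij; rewrite /g fN ?scaler0.
transitivity (nsum (fun i => nsum (g i))).
  apply: eq_nsum => i.
  have -> : e + (d - t) *+ i = e + d *+ i + t *~ (- i%:Z).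
    by rewrite mulrNz -addrA mulrnBl.
  rewrite -(bpow_int _ _ ft1) // /bpow mulrNz -(@nsumZ _ _ N) => [|j Nj]; last first.
    by rewrite -addrA -mulrnDr fN ?scaler0 // (leq_trans Nj) ?leq_addl.
  by apply: eq_nsum => j; rewrite expr1n mul1r -addrA -mulrnDr scalerA.
rewrite (nsum_triangle g0); apply: eq_nsum => n.
rewrite expr1n mul1r -(bn_subst T_inv charF) // scaler_suml.
by apply: eq_bigr => -[i /= ni] _; rewrite /g subnKC // -ltnS.
Qed.

(** [(E_x - E_y)^l], expanded in powers of [E_y]. *)
Definition dpow (x y : L) (l : int) f : L -> W :=
  fun e => bpow (-1) l%:~R (y - x) f (e + x *~ l).

Lemma dpow0 x y f e : dpow x y 0 f e = f e.
Proof. by rewrite /dpow bpow0 addr0. Qed.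

Lemma dpowS x y l f e : fin (y - x) f ->
  dpow x y (l + 1) f e = dpow x y l f (e + x) - dpow x y l f (e + y).
Proof.
move=> fyx; rewrite /dpow intrD addrC.
rewrite -(bpow_add _ _ (tint_intr T 1) (tint_intr T l) fyx) bpow1 scaleN1r.
rewrite mulrzDr addrA; congr (bpow _ _ _ _ _ - bpow _ _ _ _ _).
  by rewrite addrAC.
by rewrite mulr1z -[_ + (y - x)]addrA (addrC x) subrK addrAC.
Qed.

Lemma eq_dpow x y l f g e : f =1 g -> dpow x y l f e = dpow x y l g e.
Proof. by move=> fg; apply: eq_bpow => i. Qed.

Lemma dpowZ x y l c f e : fin (y - x) f ->
  dpow x y l (fun e => c *: f e) e = c *: dpow x y l f e.
Proof. by move=> fyx; rewrite /dpow bpowZ. Qed.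

Lemma dpowD x y l f g e : fin (y - x) f -> fin (y - x) g ->
  dpow x y l (fun e => f e + g e) e = dpow x y l f e + dpow x y l g e.
Proof. by move=> fyx gyx; rewrite /dpow bpowD. Qed.

Lemma dpowC x y x' y' l l' f e : fin2 (y - x) (y' - x') f ->
  dpow x y l (dpow x' y' l' f) e = dpow x' y' l' (dpow x y l f) e.
Proof.
move=> f2; rewrite /dpow (bpow_shift _ _ _ (x' *~ l')) bpowC //.
by rewrite addrAC -(bpow_shift _ _ _ (x *~ l)).
Qed.

Lemma fin2_dpow a b x y l u v f : y - x = u *+ a + v *+ b ->
  fin2 u v f -> fin2 u v (dpow x y l f).
Proof.
move=> yx fuv e; have [N fN] := fin2_bpow_cone (-1) l%:~R a b fuv (e + x *~ l).
exists N => i j Nij; rewrite /dpow yx -(fN _ _ Nij); congr (bpow _ _ _ _ _).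
by rewrite (addrAC _ (v *+ j)) (addrAC _ _ (x *~ l)).
Qed.

(** The operator [E_x - E_y]. *)
Definition shiftB (x y : L) f : L -> W := fun e => f (e + x) - f (e + y).

Lemma shiftB_binomial x y n f e : iter n (shiftB x y) f e =
  \sum_(i < n.+1) ((-1) ^+ i * 'C(n, i)%:R) *: f (e + y *+ i + x *+ (n - i)).
Proof.
rewrite (@shift_binomial (-1) x y (fun n => iter n (shiftB x y) f)) //.
by move=> m e'; rewrite scaleN1r.
Qed.

(** Nonnegative powers need no finiteness condition. *)
Lemma dpow_nat x y (n : nat) f e : dpow x y n f e = iter n (shiftB x y) f e.
Proof.
rewrite shiftB_binomial /dpow /bpow (@nsumE _ _ n.+1) => [|i lt_ni]; last first.
  by rewrite bn_nat bin_small // mulr0 scale0r.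
apply: eq_bigr => -[i /= le_in] _; rewrite bn_nat; congr (_ *: f _).
rewrite -!addrA; congr (_ + _); rewrite mulrnBl -[x *~ n]/(x *+ n).
by rewrite mulrnBr // addrCA addrA.
Qed.

Lemma dpow_natN x y (n : nat) f e :
  dpow x y n f e = (-1) ^+ n *: dpow y x n f e.
Proof.
rewrite !dpow_nat; elim: n e => [|n IH] e; first by rewrite expr0 scale1r.
rewrite 2!iterS /shiftB !IH -scalerBr exprS mulN1r scaleNr -scalerN opprB.
by [].
Qed.

End ShiftPowers.

(** * Brackets of two series *)

Lemma pairDE (M N : zmodType) (a c : M) (b d : N) : (a, b) + (c, d) = (a + c, b + d).
Proof. by []. Qed.
Lemma pairNE (M N : zmodType) (a : M) (b : N) : - (a, b) = (- a, - b).
Proof. by []. Qed.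
Lemma pairMnE' (M N : zmodType) (a : M) (b : N) n : (a, b) *+ n = (a *+ n, b *+ n).
Proof. by rewrite pairMnE. Qed.
Lemma pairMzE (M N : zmodType) (a : M) (b : N) (l : int) : (a, b) *~ l = (a *~ l, b *~ l).
Proof. by case: l => n; rewrite /intmul pairMnE. Qed.
Definition pairE := (pairMzE, pairMnE', pairNE, pairDE).

Lemma rat_lt_nat (x : rat) : exists n : nat, x < n%:R.
Proof.
exists (Num.bound `|x|); apply: le_lt_trans (ler_norm x) _; exact: archi_boundP.
Qed.

Section TwoSeries.
Context {F : fieldType} {W : lmodType F}.
Implicit Types (a b c : rat -> W -> W) (w : W) (l : int) (m n x y z q : rat).

(** A field is given by its modes [a m], the coefficients of [x^(- m - 1)]. *)
Record field a : Prop := Field {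
  field_lin : forall m, linear (a m);
  field_tr : forall w, exists N : rat, forall m, N < m -> a m w = 0 }.

Lemma field0 a m : field a -> a m 0 = 0.
Proof.
case=> lin _; have := lin m 1 0 0; rewrite !scale1r addr0 => E.
by apply: (addrI (a m 0)); rewrite -E addr0.
Qed.

Lemma fieldZ a m (k : F) w : field a -> a m (k *: w) = k *: a m w.
Proof. by move=> fa; have := field_lin fa m k w 0; rewrite field0 // !addr0. Qed.

Lemma fieldD a m w w' : field a -> a m (w + w') = a m w + a m w'.
Proof. by move=> fa; have := field_lin fa m 1 w w'; rewrite !scale1r. Qed.

Lemma field_nsum a m N (f : nat -> W) : field a -> (forall i, (N <= i)%N -> f i = 0) ->
  a m (nsum f) = nsum (fun i => a m (f i)).
Proof. by case=> lin _; apply: nsum_linear. Qed.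

Lemma field_trN a w x : field a -> exists N : nat, forall i y, (N <= i)%N ->
  x + i%:R <= y -> a y w = 0.
Proof.
move=> fa; have [N aN] := field_tr fa w; have [M ltM] := rat_lt_nat (N - x).
exists M => i y Mi xy; apply: aN; apply: lt_le_trans xy; rewrite -ltrBlDl.
by apply: lt_le_trans ltM _; rewrite ler_nat.
Qed.

(** The array of the coefficients of [a(x1) b(x2) w], indexed by the modes;
    the shifts by [ax1] and [ax2] are the multiplications by [x1] and [x2]. *)
Definition ax1 : rat * rat := (1, 0).
Definition ax2 : rat * rat := (0, 1).
Definition two a b w : rat * rat -> W := fun e => a e.1 (b e.2 w).

(** The coefficient of [x1^(- m - 1) x2^(- n - 1)] in
    [(x1 - x2)^l a(x1) b(x2) w], expanded in powers of [x2]. *)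
Definition oprod l a b w m n : W := dpow ax1 ax2 l (two a b w) (m, n).

Lemma oprodE l a b w m n : oprod l a b w m n = nsum (fun i =>
  ((-1) ^+ i * bn l%:~R i) *: a (m + l%:~R - i%:R) (b (n + i%:R) w)).
Proof.
apply: eq_nsum => i; rewrite /two /ax1 /ax2 !pairE /= !subr0 !sub0r !mul0rz.
by rewrite mulNrn !addr0.
Qed.

Lemma two_fin a b w : field a -> field b -> fin (ax2 - ax1) (two a b w).
Proof.
move=> fa fb [m n]; have [N bN] := field_trN w n fb; exists N => i Ni.
by rewrite /two /ax1 /ax2 !pairE /= (bN i) ?field0 // subr0.
Qed.

Variables T p : nat.
Hypothesis T_inv : T%:R != 0 :> F.
Hypothesis charF : p \in [pchar F].

Lemma oprodS l a b w m n : field a -> field b ->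
  oprod (l + 1) a b w m n = oprod l a b w (m + 1) n - oprod l a b w m (n + 1).
Proof.
move=> fa fb; rewrite /oprod (dpowS T_inv charF _ _ (two_fin w fa fb)).
by rewrite /ax1 /ax2 !pairE !addr0.
Qed.

Lemma oprod_lin l a b m n : field a -> field b -> linear (fun w => oprod l a b w m n).
Proof.
move=> fa fb k w w'; rewrite /oprod /=.
rewrite -dpowZ; last exact: two_fin.
rewrite -dpowD; [|move=> e|exact: two_fin]; last first.
  by have [N N0] := two_fin w fa fb e; exists N => i /N0 ->; exact: scaler0.
by apply: eq_dpow => e; rewrite /two !(fieldD, fieldZ).
Qed.

(** Mutual locality of order [k], for the sign [eps], in terms of modes. *)
Definition loc (eps : F) (k : nat) a b := forall w m n,
  oprod k a b w m n = (eps * (-1) ^+ k) *: oprod k b a w n m.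

Lemma loc_le eps (k l : nat) a b : field a -> field b -> loc eps k a b -> (k <= l)%N ->
  loc eps l a b.
Proof.
move=> fa fb lab /subnK <-; elim: (l - k)%N => [|d IH] w m n; first exact: lab.
have -> : ((d.+1 + k)%N : int) = (d + k)%N%:Z + 1 by rewrite addSn -addn1 PoszD.
rewrite !oprodS // !IH addSn exprS mulN1r -scalerBr.
by rewrite mulrN scaleNr -scalerN opprB.
Qed.

Lemma loc_sym eps (k : nat) a b : eps * eps = 1 -> loc eps k a b -> loc eps k b a.
Proof.
move=> eps2 lab w m n; rewrite lab scalerA mulrACA eps2 mul1r -exprMn mulrNN mulr1.
by rewrite expr1n scale1r.
Qed.

(** The coefficients of
    [(x1 - x2)^l a(x1) b(x2) w - eps (- x2 + x1)^l b(x2) a(x1) w]. *)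
Definition bra (eps : F) a b w (e : int * rat * rat) : W :=
  oprod e.1.1 a b w e.1.2 e.2 - (eps * (-1) ^ e.1.1) *: oprod e.1.1 b a w e.2 e.1.2.

Lemma braE eps a b w l m n : bra eps a b w (l, m, n) =
  oprod l a b w m n - (eps * (-1) ^ l) *: oprod l b a w n m.
Proof. by []. Qed.

Lemma signz_sqr l : ((-1) ^ l * (-1) ^ l : F) = 1.
Proof. by case: l => k; rewrite /exprz ?invr_sign -expr2 sqrr_sign. Qed.

Lemma bra_sym eps a b w l m n : eps * eps = 1 ->
  bra eps a b w (l, m, n) = - (eps * (-1) ^ l) *: bra eps b a w (l, n, m).
Proof.
move=> eps2; rewrite !braE scaleNr -scalerN opprB scalerBr scalerA mulrACA eps2 signz_sqr.
by rewrite mulr1 scale1r.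
Qed.

Lemma bra_lin eps a b e : field a -> field b -> linear (fun w => bra eps a b w e).
Proof.
move=> fa fb k w w'; rewrite /bra /= !oprod_lin // (scalerDr (eps * _)) opprD.
by rewrite addrACA scalerBr !scalerA [k * _]mulrC.
Qed.

Lemma braS eps a b w l m n : field a -> field b ->
  bra eps a b w (l + 1, m, n) = bra eps a b w (l, m + 1, n) - bra eps a b w (l, m, n + 1).
Proof.
move=> fa fb; rewrite !braE !oprodS // expfzDr ?oppr_eq0 ?oner_eq0 // expr1z mulrN1.
by rewrite mulrN scaleNr opprK scalerBr !opprB addrACA [RHS]addrACA; congr (_ + _); rewrite addrC.
Qed.

Lemma bra_loc eps (k : nat) a b w l m n : field a -> field b -> loc eps k a b ->
  k%:Z <= l -> bra eps a b w (l, m, n) = 0.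
Proof.
move=> fa fb lab; case: l => // l; rewrite lez_nat => kl.
by rewrite braE (loc_le fa fb lab kl) subrr.
Qed.

Lemma oprod_field1 l a b m : field a -> field b -> field (fun n w => oprod l a b w m n).
Proof.
move=> fa fb; split=> [n|w]; first exact: oprod_lin.
have [N bN] := field_tr fb w; exists N => n ltn; rewrite oprodE nsum0 // => i.
rewrite bN ?field0 ?scaler0 //; apply: lt_le_trans ltn _; rewrite lerDl; exact: ler0n.
Qed.

Lemma oprod_field2 l a b n : field a -> field b -> field (fun m w => oprod l a b w m n).
Proof.
move=> fa fb; split=> [m|w]; first exact: oprod_lin.
have [Nb bN] := field_trN w n fb.
have /choice[Nf NfP] : forall i : nat, exists N : rat, forall m, N < m -> a m (b (n + i%:R) w) = 0.
  by move=> i; exact: field_tr.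
exists (\big[Num.max/0]_(i < Nb) Nf i - l%:~R + Nb%:R) => m ltm.
rewrite oprodE nsum0 // => i; case: (ltnP i Nb) => [lti|leN]; last first.
  by rewrite (bN i) ?field0 ?scaler0.
rewrite NfP ?scaler0 //.
have := le_bigmax 0 (fun i : 'I_Nb => Nf i) (Ordinal lti) => /= leN.
have : (i%:R <= Nb%:R :> rat) by rewrite ler_nat ltnW.
by move: ltm leN; set M := \big[_/_]_(_ < _) _; lra.
Qed.

Lemma field_lincomb (k : F) a b : field a -> field b -> field (fun m w => k *: a m w + b m w).
Proof.
move=> fa fb; split=> [m c w w'|w].
  rewrite !(fieldD _ _ _ fa, fieldD _ _ _ fb, fieldZ _ _ _ fa, fieldZ _ _ _ fb).
  by rewrite !scalerDr !scalerA mulrC addrACA.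
have [N aN] := field_tr fa w; have [M bM] := field_tr fb w.
by exists (Num.max N M) => m; rewrite gt_max => /andP[/aN -> /bM ->]; rewrite scaler0 addr0.
Qed.

Lemma field_zero : field (fun _ _ => 0).
Proof. by split=> [m c w w'|w]; [rewrite scaler0 addr0|exists 0]. Qed.

Lemma field_shift a q : field a -> field (fun m => a (m + q)).
Proof.
move=> fa; split=> [m|w]; first exact: field_lin.
have [N aN] := field_tr fa w; exists (N - q) => m ltm; apply: aN; lra.
Qed.

Lemma oprod_lincomb1 (k : F) l a a' b w m n : field a -> field a' -> field b ->
  oprod l (fun m w => k *: a m w + a' m w) b w m n
  = k *: oprod l a b w m n + oprod l a' b w m n.
Proof.
move=> fa fa' fb; rewrite /oprod -dpowZ; last exact: two_fin.
rewrite -dpowD; [|move=> e|exact: two_fin]; first by [].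
by have [N N0] := two_fin w fa fb e; exists N => i /N0 ->; exact: scaler0.
Qed.

Lemma oprod_lincomb2 (k : F) l a b b' w m n : field a -> field b -> field b' ->
  oprod l a (fun m w => k *: b m w + b' m w) w m n
  = k *: oprod l a b w m n + oprod l a b' w m n.
Proof.
move=> fa fb fb'; rewrite /oprod -dpowZ; last exact: two_fin.
rewrite -dpowD; [|move=> e|exact: two_fin].
  by apply: eq_dpow => e; rewrite /two fieldD // fieldZ.
by have [N N0] := two_fin w fa fb e; exists N => i /N0 ->; exact: scaler0.
Qed.

Lemma oprod_shift1 q l a b w m n :
  oprod l (fun m => a (m + q)) b w m n = oprod l a b w (m + q) n.
Proof.
rewrite !oprodE; apply: eq_nsum => i; congr (_ *: a _ _); ring.
Qed.

Lemma oprod_shift2 q l a b w m n :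
  oprod l a (fun m => b (m + q)) w m n = oprod l a b w m (n + q).
Proof. by rewrite !oprodE; apply: eq_nsum => i; rewrite [n + q + _]addrAC. Qed.

Lemma bra_lincomb1 eps (k : F) a a' b w e : field a -> field a' -> field b ->
  bra eps (fun m w => k *: a m w + a' m w) b w e
  = k *: bra eps a b w e + bra eps a' b w e.
Proof.
move=> fa fa' fb; rewrite /bra oprod_lincomb1 // oprod_lincomb2 //.
rewrite (scalerDr (eps * _)) opprD addrACA scalerBr !scalerA.
by rewrite [k * _]mulrC.
Qed.

Lemma bra_lincomb2 eps (k : F) a b b' w e : field a -> field b -> field b' ->
  bra eps a (fun m w => k *: b m w + b' m w) w e
  = k *: bra eps a b w e + bra eps a b' w e.
Proof.
move=> fa fb fb'; rewrite /bra oprod_lincomb1 // oprod_lincomb2 //.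
rewrite (scalerDr (eps * _)) opprD addrACA scalerBr !scalerA.
by rewrite [k * _]mulrC.
Qed.

Lemma bra_zero1 eps b w e : field b -> bra eps (fun _ _ => 0) b w e = 0.
Proof.
move=> fb; rewrite /bra !oprodE !nsum0 ?scaler0 ?subr0 // => i /=; by rewrite ?(field0 _ fb) scaler0.
Qed.

Lemma field_sum H (k : 'I_H -> F) (c : 'I_H -> rat -> W -> W) :
  (forall i, field (c i)) -> field (fun m w => \sum_i k i *: c i m w).
Proof.
move=> fc; split=> [m d w w'|w].
  rewrite scaler_sumr -big_split; apply: eq_bigr => i _.
  by rewrite (fieldD _ _ _ (fc i)) (fieldZ _ _ _ (fc i)) scalerDr !scalerA [d * _]mulrC.
have /choice[N NP] := fun i => field_tr (fc i) w.
exists (\big[Num.max/0]_i N i) => m ltm; apply: big1 => i _; rewrite NP ?scaler0 //.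
apply: le_lt_trans ltm; exact: le_bigmax.
Qed.

Lemma bra_sum1 eps H (k : 'I_H -> F) (c : 'I_H -> rat -> W -> W) b w e :
  (forall i, field (c i)) -> field b ->
  bra eps (fun m w => \sum_i k i *: c i m w) b w e = \sum_i k i *: bra eps (c i) b w e.
Proof.
move=> fc fb; elim: H => [|H IH] in k c fc *.
  rewrite big_ord0; transitivity (bra eps (fun _ _ => 0) b w e); last exact: bra_zero1.
  congr (bra _ _ _ _ _).
  by apply/funext => m; apply/funext => w'; rewrite big_ord0.
rewrite big_ord_recl -(IH (fun i => k (lift ord0 i)) (fun i => c (lift ord0 i))) //.
rewrite -bra_lincomb1 //; last by apply: field_sum.
by congr (bra _ _ _ _ _); apply/funext => m; apply/funext => w'; rewrite big_ord_recl.
Qed.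

Lemma bra_shift1 eps q a b w l m n :
  bra eps (fun m => a (m + q)) b w (l, m, n) = bra eps a b w (l, m + q, n).
Proof. by rewrite !braE oprod_shift1 oprod_shift2. Qed.

Lemma bra_field eps l a b m : field a -> field b ->
  field (fun n w => bra eps a b w (l, m, n)).
Proof.
move=> fa fb; have f1 := oprod_field1 l m fa fb; have f2 := oprod_field2 l m fb fa.
suff -> : (fun n w => bra eps a b w (l, m, n)) = (fun n w =>
    - (eps * (-1) ^ l) *: oprod l b a w n m + oprod l a b w m n) by exact: field_lincomb.
by apply/funext => n; apply/funext => w; rewrite braE scaleNr addrC.
Qed.

(** ** Products of two series *)

(** The modes of [a(x)_l b(x)], for [a] with modes indexed by [rho + Z]: the
    residue in [x1] of the bracket of index [l] times [((x1 - x0)/x)^rho], which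
    is expanded in powers of [x0 = x1 - x]. *)
Definition rprod rho eps l a b : rat -> W -> W := fun q w =>
  bpow (-1) rho (1, -1, 0) (bra eps a b w) (l, rho, q - rho).

Lemma rprodE rho eps l a b q w : rprod rho eps l a b q w =
  nsum (fun i => ((-1) ^+ i * bn rho i) *: bra eps a b w (l + i%:Z, rho - i%:R, q - rho)).
Proof.
by apply: eq_nsum => i; rewrite !pairE mul0rn addr0 mulNrn natz.
Qed.

Section Product.
Variables (eps : F) (k : nat) (a b : rat -> W -> W).
Hypotheses (fa : field a) (fb : field b) (lab : loc eps k a b).

Lemma bra_fin w u v : fin ((1, u, v) : int * rat * rat) (bra eps a b w).
Proof.
move=> [[l m] n]; exists (`|k%:Z - l|)%N => i le_i.
by rewrite !pairE (bra_loc _ _ _ fa fb lab) //= natz; lia.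
Qed.

(** The product is [(x1/x2)^(- m)] applied to the bracket at the mode [m] of
    [a], for any [m] in [rho + Z]. *)
Lemma rprod_bpow rho l m q w : tint T rho -> m - rho \is a Num.int ->
  rprod rho eps l a b q w = bpow 1 (- m) (1, 0, -1) (bra eps a b w) (l, m, q - m).
Proof.
move=> Trho /intrP[d Ed]; have bf := bra_fin w 0 (-1).
have Et0 (l' : int) (m' n' : rat) : bra eps a b w (l', m' + 1, n' - 1) =
    bra eps a b w (l', m', n') + bra eps a b w (l' + 1, m', n' - 1).
  by rewrite (braS _ _ _ _ (n' - 1) fa fb) subrK [RHS]addrC subrK.
have Et e : bra eps a b w (e + (0, 1, -1)) = bra eps a b w e + bra eps a b w (e + (1, 0, -1)).
  by case: e => [[l' m'] n']; rewrite !pairE !addr0 -Et0.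
have -> : (l, m, q - m) = (l, rho, q - rho) + (0, 1, -1) *~ d.
  rewrite !pairE mul0rz addr0 mulNrz -Ed; congr (_, _, _); ring.
have Et1 e : bra eps a b w (e + (0, 1, -1)) = bra eps a b w e + 1 *: bra eps a b w (e + (1, 0, -1)).
  by rewrite scale1r.
rewrite -bpow_shift; under eq_bpow do rewrite -(bpow_int T_inv charF _ _ Et1 bf).
have Tm : tint T m by rewrite -(subrK rho m) Ed; apply: tintD => //; apply: tint_intr.
rewrite (bpow_add T_inv charF) //; [|exact: tintN|exact: tint_intr].
rewrite -Ed addKr -(bpow_inv T_inv charF _ Trho Et) //.
Qed.

Lemma rprod_sum H rho l m q w : tint T rho -> m - rho \is a Num.int -> k%:Z <= l + H%:Z ->
  rprod rho eps l a b q w =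
  \sum_(i < H) bn (- m) i *: bra eps a b w (l + i%:Z, m, q - m - i%:R).
Proof.
move=> Trho Em leH; rewrite (rprod_bpow _ _ _ Trho Em) /bpow (@nsumE _ _ H) => [|i Hi].
  apply: eq_bigr => i _; rewrite expr1n mul1r !pairE mul0rn addr0 mulNrn.
  by rewrite natz.
by rewrite !pairE (bra_loc _ _ _ fa fb lab) ?scaler0 //= natz; lia.
Qed.

(** The bracket is recovered from the products: the twisted Jacobi identity, in
    terms of modes. *)
Lemma bra_rprod rho l m n w : tint T rho -> m - rho \is a Num.int ->
  bra eps a b w (l, m, n) =
  nsum (fun i => bn m i *: rprod rho eps (l + i%:Z) a b (m + n - i%:R) w).
Proof.
move=> Trho Em; have bf := bra_fin w 0 (-1).
have Tm : tint T m.
  by rewrite -(subrK rho m); apply: tintD => //; apply: tint_int.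
have <- : bpow 1 (m - m) (1, 0, -1) (bra eps a b w) (l, m, n) = bra eps a b w (l, m, n).
  by rewrite subrr bpow0.
rewrite -(bpow_add T_inv charF _ _ Tm (tintN Tm) bf).
apply: eq_nsum => i; rewrite expr1n mul1r; congr (_ *: _).
rewrite (rprod_bpow _ _ _ Trho Em) !pairE mul0rn addr0 mulNrn.
by rewrite natz; congr (bpow _ _ _ _ (_, _, _)); ring.
Qed.

Lemma rprod_loc rho l q w : k%:Z <= l -> rprod rho eps l a b q w = 0.
Proof.
move=> kl; apply: nsum0 => i; rewrite !pairE (bra_loc _ _ _ fa fb lab) ?scaler0 //.
by rewrite natz; lia.
Qed.

Lemma rprod_field rho l : tint T rho -> field (rprod rho eps l a b).
Proof.
move=> Trho; pose H := `|k%:Z - l|%N.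
have leH : k%:Z <= l + H%:Z by rewrite /H; lia.
have rr : rho - rho \is a Num.int by rewrite subrr rpred0.
split=> [q c w w'|w].
  rewrite !(rprod_sum _ _ Trho rr leH) scaler_sumr -big_split; apply: eq_bigr => i _.
  by rewrite bra_lin // scalerDr !scalerA mulrC.
have /choice[Nf NfP] : forall i : 'I_H, exists N : rat, forall n, N < n ->
   bra eps a b w (l + i%:Z, rho, n) = 0.
  by move=> i; exact: (field_tr (bra_field _ _ _ fa fb)).
exists (\big[Num.max/0]_(i < H) Nf i + rho + H%:R) => q ltq.
rewrite (rprod_sum _ _ Trho rr leH) big1 // => i _; rewrite NfP ?scaler0 //.
have := le_bigmax 0 (fun i : 'I_H => Nf i) i => /= leN.
have : (i%:R <= H%:R :> rat) by rewrite ler_nat ltnW.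
by move: ltq leN; set M := \big[_/_]_(_ < _) _; lra.
Qed.

End Product.

(** The nonzero modes of [a] have their indices in [rho + Z]. *)
Definition supp rho a := forall m w, m - rho \isn't a Num.int -> a m w = 0.

Lemma supp_shift rho a m x w : supp rho a -> m - rho \isn't a Num.int ->
  x \is a Num.int -> a (m + x) w = 0.
Proof.
move=> sa Em Ex; apply: sa; apply: contra Em => Em.
by rewrite (_ : m - rho = m + x - rho - x); [rewrite rpredB|ring].
Qed.

Lemma oprod_supp1 rho l a b w m n : supp rho a -> m - rho \isn't a Num.int ->
  oprod l a b w m n = 0.
Proof.
move=> sa Em; rewrite oprodE; apply: nsum0 => i.
by rewrite -addrA (supp_shift _ sa) ?scaler0 // rpredB ?intr_int ?natr_int.
Qed.

Lemma oprod_supp2 rho l a b w m n : field a -> supp rho b -> n - rho \isn't a Num.int ->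
  oprod l a b w m n = 0.
Proof.
move=> fa sb En; rewrite oprodE; apply: nsum0 => i.
by rewrite (supp_shift _ sb) ?field0 ?scaler0 ?natr_int.
Qed.

Lemma bra_supp1 rho eps a b w l m n : field b -> supp rho a -> m - rho \isn't a Num.int ->
  bra eps a b w (l, m, n) = 0.
Proof.
by move=> fb sa Em; rewrite braE (oprod_supp1 _ _ _ _ sa) ?(oprod_supp2 _ _ _ fb sa) // scaler0 subrr.
Qed.

Lemma bra_supp2 sig eps a b w l m n : field a -> supp sig b -> n - sig \isn't a Num.int ->
  bra eps a b w (l, m, n) = 0.
Proof.
by move=> fa sb En; rewrite braE (oprod_supp1 _ _ _ _ sb) ?(oprod_supp2 _ _ _ fa sb) // scaler0 subrr.
Qed.

Lemma rprod_supp rho sig eps l a b : field a -> supp sig b ->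
  supp (rho + sig) (rprod rho eps l a b).
Proof.
move=> fa sb q w Eq; apply: nsum0 => i; rewrite !pairE (bra_supp2 _ _ _ _ fa sb) ?scaler0 //.
by rewrite mul0rn addr0; apply: contra Eq; congr (_ \is a Num.int); ring.
Qed.

End TwoSeries.

(** * Brackets of three series *)

Section ThreeSeries.
Context {F : fieldType} {W : lmodType F}.
Implicit Types (u v t a b c : rat -> W -> W) (w : W) (l m n : int) (x y z q : rat).

Let R3 := (rat * rat * rat)%type.

(** The array of the coefficients of [u(x1) v(x2) t(x3) w], and the shifts that
    are the multiplications by the variables. *)
Definition ay1 : R3 := (1, 0, 0).
Definition ay2 : R3 := (0, 1, 0).
Definition ay3 : R3 := (0, 0, 1).

Definition three u v t w : R3 -> W := fun e => u e.1.1 (v e.1.2 (t e.2 w)).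

(* The finiteness condition under which the powers of [x1 - x2], [x1 - x3] and
   [x2 - x3] expanded in the region [|x1| > |x2| > |x3|] can be applied. *)
Let fin3 (f : R3 -> W) := fin2 (ay2 - ay1) (ay3 - ay2) f.

Lemma ay31 : ay3 - ay1 = (ay2 - ay1) *+ 1 + (ay3 - ay2) *+ 1.
Proof. by rewrite !mulr1n [RHS]addrC addrA subrK. Qed.

Lemma three_fin u v t w : field u -> field v -> field t -> fin3 (three u v t w).
Proof.
move=> fu fv ft [[x y] z]; have [N tN] := field_trN w z ft.
have /choice[M MP] : forall j : nat, exists N : nat, forall i y', (N <= i)%N ->
    y - j%:R + i%:R <= y' -> v y' (t (z + j%:R) w) = 0 by move=> j; apply: field_trN.
exists (N + \max_(j < N) M j)%N => i j Nij.
rewrite /three /ay1 /ay2 /ay3 !pairE /=.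
have -> : z + (0 - 0) *+ i + (1 - 0) *+ j = z + j%:R by rewrite !subr0 mul0rn addr0.
case: (leqP N j) => [Nj|jN]; first by rewrite (tN j) ?(field0 _ fv) ?field0.
rewrite (MP j i) ?field0 //; last by rewrite subr0 sub0r mulNrn addrAC.
have leM : (M j <= \max_(j < N) M j)%N := @leq_bigmax 'I_N (fun j => M j) (Ordinal jN).
by move: Nij leM; set mx := \max_(_ < _) _; lia.
Qed.

Lemma fin3_12 l f : fin3 f -> fin3 (dpow ay1 ay2 l f).
Proof. by apply: (@fin2_dpow _ _ _ 1 0); rewrite addr0. Qed.
Lemma fin3_23 l f : fin3 f -> fin3 (dpow ay2 ay3 l f).
Proof. by apply: (@fin2_dpow _ _ _ 0 1); rewrite add0r. Qed.
Lemma fin3_13 l f : fin3 f -> fin3 (dpow ay1 ay3 l f).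
Proof. exact/fin2_dpow/ay31. Qed.

Lemma fin3_fin12 f : fin3 f -> fin (ay2 - ay1) f.
Proof. exact: fin2_fin. Qed.
Lemma fin3_fin23 f : fin3 f -> fin (ay3 - ay2) f.
Proof. by move=> f3; apply/fin2_fin/fin2C/f3. Qed.
Lemma fin3_f1213 f : fin3 f -> fin2 (ay2 - ay1) (ay3 - ay1) f.
Proof.
move=> f3; rewrite ay31 -[X in fin2 X](addr0 (ay2 - ay1)).
exact: (@fin2_cone _ _ _ 1 0 1 1).
Qed.
Lemma fin3_f1323 f : fin3 f -> fin2 (ay3 - ay1) (ay3 - ay2) f.
Proof.
move=> f3; rewrite ay31 -[X in fin2 _ X](add0r (ay3 - ay2)).
exact: (@fin2_cone _ _ _ 1 1 0 1).
Qed.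
Lemma fin3_fin13 f : fin3 f -> fin (ay3 - ay1) f.
Proof. by move=> /fin3_f1323/fin2_fin. Qed.

(** The coefficient of [x1^(- x - 1) x2^(- y - 1) x3^(- z - 1)] in
    [(x1 - x2)^l (x1 - x3)^m (x2 - x3)^n u(x1) v(x2) t(x3) w], expanded in the
    region [|x1| > |x2| > |x3|]. *)
Definition trip u v t w l m n x y z : W :=
  dpow ay1 ay2 l (dpow ay1 ay3 m (dpow ay2 ay3 n (three u v t w))) (x, y, z).

Section Fields.
Variables (u v t : rat -> W -> W) (w : W).
Hypotheses (fu : field u) (fv : field v) (ft : field t).

Let f3 := three_fin w fu fv ft.
Local Notation trip := (trip u v t w).

Lemma trip_132312 l m n x y z : trip l m n x y z =
  dpow ay1 ay3 m (dpow ay2 ay3 n (dpow ay1 ay2 l (three u v t w))) (x, y, z).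
Proof.
rewrite /trip dpowC; last exact/fin3_f1213/fin3_23/f3.
by apply: eq_dpow => e; rewrite dpowC //; exact: f3.
Qed.

Lemma trip_231312 l m n x y z : trip l m n x y z =
  dpow ay2 ay3 n (dpow ay1 ay3 m (dpow ay1 ay2 l (three u v t w))) (x, y, z).
Proof. by rewrite trip_132312 dpowC //; exact/fin3_f1323/fin3_12/f3. Qed.

Lemma trip_131223 l m n x y z : trip l m n x y z =
  dpow ay1 ay3 m (dpow ay1 ay2 l (dpow ay2 ay3 n (three u v t w))) (x, y, z).
Proof. by rewrite /trip dpowC //; exact/fin3_f1213/fin3_23/f3. Qed.

Lemma three12 l x y z : dpow ay1 ay2 l (three u v t w) (x, y, z) = oprod l u v (t z w) x y.
Proof.
by rewrite /oprod /dpow; apply: eq_nsum => i; rewrite /three /two /ay1 /ay2 /ax1 /ax2 !pairE /= !(mul0rz, subr0, mul0rn, addr0).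
Qed.

Lemma three23 l x y z : dpow ay2 ay3 l (three u v t w) (x, y, z) = u x (oprod l v t w y z).
Proof.
have [N tN] := two_fin w fv ft ((y, z) + ax1 *~ l).
rewrite /oprod (field_nsum _ fu (bpow_fin_term _ _ tN)); apply: eq_nsum => i.
by rewrite (fieldZ _ _ _ fu) /three /two /ay2 /ay3 /ax1 /ax2 !pairE /= !(mul0rz, subr0, mul0rn, addr0).
Qed.

Variables T p : nat.
Hypothesis T_inv : T%:R != 0 :> F.
Hypothesis charF : p \in [pchar F].

Lemma tripS12 l m n x y z :
  trip (l + 1) m n x y z = trip l m n (x + 1) y z - trip l m n x (y + 1) z.
Proof.
rewrite /trip (dpowS T_inv charF) ?/ay1 ?/ay2 ?pairE ?addr0 //.
exact/fin3_fin12/fin3_13/fin3_23/f3.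
Qed.

Lemma tripS13 l m n x y z :
  trip l (m + 1) n x y z = trip l m n (x + 1) y z - trip l m n x y (z + 1).
Proof.
rewrite !trip_131223 (dpowS T_inv charF) ?/ay1 ?/ay3 ?pairE ?addr0 //.
exact/fin3_fin13/fin3_12/fin3_23/f3.
Qed.

Lemma tripS23 l m n x y z :
  trip l m (n + 1) x y z = trip l m n x (y + 1) z - trip l m n x y (z + 1).
Proof.
rewrite !trip_231312 (dpowS T_inv charF) ?/ay2 ?/ay3 ?pairE ?addr0 //.
exact/fin3_fin23/fin3_13/fin3_12/f3.
Qed.

End Fields.
End ThreeSeries.

Section TripleBracket.
Context {F : fieldType} {W : lmodType F}.
Variables T p : nat.
Hypothesis T_inv : T%:R != 0 :> F.
Hypothesis charF : p \in [pchar F].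
Implicit Types (u v t a b c : rat -> W -> W) (w : W) (l m n : int) (x y z q : rat).

Lemma loc_int eps (k : nat) a b w l x y : field a -> field b -> loc eps k a b ->
  k%:Z <= l -> oprod l a b w x y = (eps * (-1) ^ l) *: oprod l b a w y x.
Proof.
by move=> fa fb lab; case: l => // l; rewrite lez_nat => kl; exact: (loc_le T_inv charF fa fb lab kl).
Qed.

Let swap12 (e : rat * rat * rat) := (e.1.2, e.1.1, e.2).
Let swap23 (e : rat * rat * rat) := (e.1.1, e.2, e.1.2).

Let simp := (@mul0rz, @subr0, @mul0rn, @addr0).

Lemma trip_swap12 eps (k : nat) u v t w l m n x y z : field u -> field v -> field t ->
  loc eps k u v -> k%:Z <= l ->
  trip u v t w l m n x y z = (eps * (-1) ^ l) *: trip v u t w l n m y x z.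
Proof.
move=> fu fv ft luv kl; set s := eps * _.
pose h := dpow ay1 ay2 l (three v u t w).
have h3 := fin3_12 l (three_fin w fv fu ft).
rewrite trip_132312 // trip_231312 //.
transitivity (dpow ay1 ay3 m (dpow ay2 ay3 n (fun e => s *: h (swap12 e))) (x, y, z)).
  apply: eq_dpow => e; apply: eq_dpow => {e}[[[x' y'] z']].
  by rewrite three12 (loc_int _ _ _ fu fv luv kl) -three12.
transitivity (dpow ay1 ay3 m (fun e => s *: dpow ay1 ay3 n h (swap12 e)) (x, y, z)).
  apply: eq_dpow => e; rewrite -dpowZ; last exact/fin3_fin13/h3.
  by case: e => [[x' y'] z']; apply: eq_nsum => i; rewrite /swap12 /ay1 /ay2 /ay3 !pairE /=.
rewrite -dpowZ; last exact/fin3_fin23/fin3_13/h3.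
by apply: eq_nsum => i; rewrite /swap12 /ay1 /ay2 /ay3 !pairE /=.
Qed.

Lemma trip_swap23 eps (k : nat) u v t w l m n x y z : field u -> field v -> field t ->
  loc eps k v t -> k%:Z <= n ->
  trip u v t w l m n x y z = (eps * (-1) ^ n) *: trip u t v w m l n x z y.
Proof.
move=> fu fv ft lvt kn; set s := eps * _.
pose h := dpow ay2 ay3 n (three u t v w).
have h3 := fin3_23 n (three_fin w fu ft fv).
rewrite trip_131223 //.
transitivity (dpow ay1 ay3 m (dpow ay1 ay2 l (fun e => s *: h (swap23 e))) (x, y, z)).
  apply: eq_dpow => e; apply: eq_dpow => {e}[[[x' y'] z']].
  by rewrite three23 // (loc_int _ _ _ fv ft lvt kn) fieldZ // -three23.
transitivity (dpow ay1 ay3 m (fun e => s *: dpow ay1 ay3 l h (swap23 e)) (x, y, z)).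
  apply: eq_dpow => e; rewrite -dpowZ; last exact/fin3_fin13/h3.
  by case: e => [[x' y'] z']; apply: eq_nsum => i; rewrite /swap23 /ay1 /ay2 /ay3 !pairE /=.
rewrite -dpowZ; last exact/fin3_fin12/fin3_13/h3.
by apply: eq_nsum => i; rewrite /swap23 /ay1 /ay2 /ay3 !pairE /=.
Qed.

Lemma trip_13_0 u v t w l n x y z : field u -> field v -> field t ->
  trip u v t w l 0 n x y z = oprod n (fun y w => oprod l u v w x y) t w y z.
Proof.
move=> fu fv ft; rewrite trip_231312 //.
transitivity (dpow ay2 ay3 n (dpow ay1 ay2 l (three u v t w)) (x, y, z)).
  by apply: eq_dpow => e; rewrite dpow0.
by apply: eq_nsum => i; rewrite /ay2 /ay3 !pairE three12 /two /ax1 /ax2 /= !simp.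
Qed.

Lemma trip_23_0 u v t w l m x y z : field u -> field v -> field t ->
  trip u v t w l m 0 x y z = oprod m (fun x w => oprod l u v w x y) t w x z.
Proof.
move=> fu fv ft; rewrite trip_132312 //.
transitivity (dpow ay1 ay3 m (dpow ay1 ay2 l (three u v t w)) (x, y, z)).
  by apply: eq_dpow => e; rewrite dpow0.
by apply: eq_nsum => i; rewrite /ay1 /ay3 !pairE three12 /two /ax1 /ax2 /= !simp.
Qed.

Lemma trip_13_0' u v t w l n x y z : field u -> field v -> field t ->
  trip u v t w l 0 n x y z = oprod l u (fun y w => oprod n v t w y z) w x y.
Proof.
move=> fu fv ft.
transitivity (dpow ay1 ay2 l (dpow ay2 ay3 n (three u v t w)) (x, y, z)).
  by apply: eq_dpow => e; rewrite dpow0.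
by apply: eq_nsum => i; rewrite /ay1 /ay2 !pairE three23 // /two /ax1 /ax2 /= !simp.
Qed.

Lemma trip_12_0' u v t w m n x y z : field u -> field v -> field t ->
  trip u v t w 0 m n x y z = oprod m u (fun z w => oprod n v t w y z) w x z.
Proof.
move=> fu fv ft; rewrite /trip dpow0.
by apply: eq_nsum => i; rewrite /ay1 /ay3 !pairE three23 // /two /ax1 /ax2 /= !simp.
Qed.

(** The coefficient of [x1^(- x - 1) x2^(- y - 1) x3^(- z - 1)] in the product of
    [(x1 - x2)^l (x1 - x3)^m (x2 - x3)^n] and [[[a(x1), b(x2)], c(x3)] w]; the
    rational function is expanded, in each of the four terms of the
    (super)bracket, in the region prescribed by the order of the factors. *)
Definition brac (eab eac ebc : F) a b c w (l m n : int) (x y z : rat) : W :=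
  trip a b c w l m n x y z
  - (eab * (-1) ^ l) *: trip b a c w l n m y x z
  - (eac * (-1) ^ m * (ebc * (-1) ^ n)) *: trip c a b w m n l z x y
  + (eab * (-1) ^ l * (eac * (-1) ^ m * (ebc * (-1) ^ n))) *: trip c b a w n m l z y x.

Lemma signzS l : (-1) ^ (l + 1) = - (-1) ^ l :> F.
Proof. by rewrite expfzDr ?oppr_eq0 ?oner_eq0 // expr1z mulrN1. Qed.

Section Brac.
Variables (eab eac ebc : F) (a b c : rat -> W -> W) (w : W).
Hypotheses (fa : field a) (fb : field b) (fc : field c).
Local Notation br := (brac eab eac ebc a b c w).

Let tS12 (a b c : rat -> W -> W) (fa : field a) (fb : field b) (fc : field c) :=
  tripS12 w fa fb fc T_inv charF.
Let tS13 (a b c : rat -> W -> W) (fa : field a) (fb : field b) (fc : field c) :=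
  tripS13 w fa fb fc T_inv charF.
Let tS23 (a b c : rat -> W -> W) (fa : field a) (fb : field b) (fc : field c) :=
  tripS23 w fa fb fc T_inv charF.

Let lin4 (s1 s2 s3 : F) (v1 v1' v2 v2' v3 v3' v4 v4' : W) :
  v1 - v1' - s1 *: (v2 - v2') - s2 *: (v3 - v3') + s3 *: (v4 - v4')
  = (v1 - s1 *: v2 - s2 *: v3 + s3 *: v4) - (v1' - s1 *: v2' - s2 *: v3' + s3 *: v4').
Proof.
have E (u u' : W) : u - u' = u + - u' by [].
rewrite !scalerBr !opprD !opprK [v1 - v1' + _]addrACA.
rewrite [_ + (- (s2 *: v3) + _)]addrACA [LHS]addrACA.
by [].
Qed.

Let flipm (s : F) (u v v' : W) : u - - (s *: (v - v')) = u - s *: (v' - v).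
Proof. by rewrite -scalerN opprB. Qed.

Let lin4m (s1 s2 s3 : F) (v1 v1' v2 v2' v3 v3' v4 v4' : W) :
  v1 - v1' - s1 *: (v2 - v2') - s2 *: (v3 - v3') - s3 *: (v4' - v4)
  = (v1 - s1 *: v2 - s2 *: v3 + s3 *: v4) - (v1' - s1 *: v2' - s2 *: v3' + s3 *: v4').
Proof. by rewrite -[- (s3 *: _)]scalerN opprB lin4. Qed.

Lemma bracS12 l m n x y z :
  br (l + 1) m n x y z = br l m n (x + 1) y z - br l m n x (y + 1) z.
Proof.
rewrite /brac !signzS (tS12 fa fb fc) (tS12 fb fa fc) (tS23 fc fa fb) (tS23 fc fb fa).
by rewrite !(mulrN, mulNr) !scaleNr flipm lin4m.
Qed.

Lemma bracS13 l m n x y z :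
  br l (m + 1) n x y z = br l m n (x + 1) y z - br l m n x y (z + 1).
Proof.
rewrite /brac !signzS (tS13 fa fb fc) (tS23 fb fa fc) (tS12 fc fa fb) (tS13 fc fb fa).
by rewrite !(mulrN, mulNr) !scaleNr flipm lin4m.
Qed.

Lemma bracS23 l m n x y z :
  br l m (n + 1) x y z = br l m n x (y + 1) z - br l m n x y (z + 1).
Proof.
rewrite /brac !signzS (tS23 fa fb fc) (tS13 fb fa fc) (tS13 fc fa fb) (tS12 fc fb fa).
by rewrite !(mulrN, mulNr) !scaleNr flipm lin4m.
Qed.

(** [x1 - x3 = (x1 - x2) + (x2 - x3)] *)
Lemma brac_rel l m n x y z :
  br l (m + 1) n x y z = br (l + 1) m n x y z + br l m (n + 1) x y z.
Proof. by rewrite bracS12 bracS13 bracS23 addrA subrK. Qed.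

Variable k : nat.
Hypotheses (lab : loc eab k a b) (lac : loc eac k a c) (lbc : loc ebc k b c).

Lemma brac_loc12 l m n x y z : k%:Z <= l -> br l m n x y z = 0.
Proof.
move=> kl; rewrite /brac (trip_swap12 _ _ _ _ _ _ fa fb fc lab kl).
rewrite (trip_swap23 _ _ _ _ _ _ fc fa fb lab kl) subrr sub0r.
by rewrite scalerA [_ * (eab * _)]mulrC addNr.
Qed.

Lemma brac_loc13_23 l m n x y z : k%:Z <= m -> k%:Z <= n -> br l m n x y z = 0.
Proof.
move=> km kn; rewrite /brac (trip_swap23 _ _ _ _ _ _ fa fb fc lbc kn).
rewrite (trip_swap12 _ _ _ _ _ _ fa fc fb lac km).
rewrite (trip_swap23 _ _ _ _ _ _ fb fa fc lac km).
rewrite (trip_swap12 _ _ _ _ _ _ fb fc fa lbc kn).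
move: (eab * _) (eac * _) (ebc * _) => s1 s2 s3.
have z4 (u v : W) : u - v - u + v = 0 by rewrite addrAC subrK subrr.
by rewrite !scalerA (mulrC s3 s2) mulrA z4.
Qed.

(** The vanishing behind Dong's lemma, by induction on [n - k]: for [n = k] one of
    [l] and [m] is at least [k], and [x2 - x3 = (x1 - x3) - (x1 - x2)] lowers
    [n]. *)
Lemma brac_dong l m n x y z : k%:Z <= n -> 3 * k%:Z <= l + m + n -> br l m n x y z = 0.
Proof.
move=> kn; have -> : n = k%:Z + `|n - k%:Z|%N%:Z by lia.
elim: `|_|%N l m x y z => [|j IH] l m x y z le3.
  have [kl|km] : k%:Z <= l \/ k%:Z <= m by lia.
    exact: brac_loc12.
  by apply: brac_loc13_23; lia.
have -> : k%:Z + j.+1%:Z = k%:Z + j%:Z + 1 by lia.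
have E : br l m (k%:Z + j%:Z + 1) x y z =
    br l (m + 1) (k%:Z + j%:Z) x y z - br (l + 1) m (k%:Z + j%:Z) x y z.
  by rewrite brac_rel [X in X - _]addrC addrK.
by rewrite E !IH ?subrr //; lia.
Qed.

(** [[a, b], c]] as a bracket of the series [[a, b]] with [c]. *)
Lemma brac_bra l n x y z : br l 0 n x y z =
  bra (eac * ebc) (fun y w => bra eab a b w (l, x, y)) c w (n, y, z).
Proof.
have f1 := oprod_field1 l x fa fb; have f2 := oprod_field2 l x fb fa.
rewrite braE /brac.
have EX : (fun y w => bra eab a b w (l, x, y)) =
    (fun y w => - (eab * (-1) ^ l) *: oprod l b a w y x + oprod l a b w x y).
  by apply/funext => y'; apply/funext => w'; rewrite braE scaleNr addrC.
rewrite EX oprod_lincomb1 // oprod_lincomb2 // -trip_13_0 // -trip_13_0' //.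
rewrite -trip_23_0 // -trip_12_0' // expr0z mulr1 mulrA.
move: (eab * _) (eac * ebc * _) => s1 s2.
rewrite !scaleNr [- (s1 *: _) + trip a _ _ _ _ _ _ _ _ _]addrC scalerDr scalerN.
by rewrite opprD opprK scalerA (mulrC s2) addrA [RHS]addrAC.
Qed.

End Brac.

(** The triple bracket [[a, [b, c]]], as [[[b, c], a]] up to sign. *)
Definition bracr (eab eac ebc : F) a b c w (l m n : int) (x y z : rat) : W :=
  - (eab * (-1) ^ l * (eac * (-1) ^ m)) *: brac ebc eab eac b c a w n l m y z x.

Let sign_sqr (e : F) l : e * e = 1 -> (e * (-1) ^ l) * (e * (-1) ^ l) = 1.
Proof. by move=> e2; rewrite mulrACA e2 signz_sqr mulr1. Qed.

Let jacobi_alg (s1 s2 s3 : F) (A B C D P Q : W) :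
  s1 * s1 = 1 -> s2 * s2 = 1 -> s3 * s3 = 1 ->
  A - s1 *: B - (s2 * s3) *: C + (s1 * (s2 * s3)) *: D
  = - (s1 * s2) *: (P - s3 *: D - (s1 * s2) *: A + (s3 * (s1 * s2)) *: Q)
  - s1 *: (- (s1 * s3) *: (Q - s2 *: C - (s1 * s3) *: B + (s2 * (s1 * s3)) *: P)).
Proof.
move=> s11 s22 s33; rewrite !scaleNr !scalerN opprK [s1 *: ((s1 * _) *: _)]scalerA.
rewrite [s1 * (s1 * s3)]mulrA s11 mul1r !(scalerDr, scalerN, scalerA).
have -> : s1 * s2 * (s1 * s2) = 1 by rewrite mulrACA s11 s22 mulr1.
have -> : s1 * s2 * (s3 * (s1 * s2)) = s3.
  by rewrite mulrCA mulrACA s11 s22 !mulr1.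
have -> : s3 * (s1 * s3) = s1 by rewrite mulrCA s33 mulr1.
have -> : s3 * (s2 * (s1 * s3)) = s1 * s2.
  by rewrite mulrCA [s3 * _]mulrCA s33 mulr1 mulrC.
rewrite scale1r mulrA [s3 * s2]mulrC.
move: (s1 *: B) ((s2 * s3) *: C) ((s1 * s2 * s3) *: D) ((s1 * s2) *: P) (s3 *: Q) => b c d p' q.
rewrite !opprD !opprK !addrA [RHS](ACl (3*7*6*2*(1*8)*(4*5)))%AC /=.
by rewrite !addNr !addr0.
Qed.

Lemma brac_jacobi eab eac ebc a b c w l m n x y z :
  eab * eab = 1 -> eac * eac = 1 -> ebc * ebc = 1 ->
  brac eab eac ebc a b c w l m n x y z =
  bracr eab eac ebc a b c w l m n x y z
  - (eab * (-1) ^ l) *: bracr eab ebc eac b a c w l n m y x z.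
Proof. by move=> eab2 eac2 ebc2; rewrite /bracr /brac; apply: jacobi_alg; apply: sign_sqr. Qed.

End TripleBracket.

(** * Iterated products *)

Section IteratedProducts.
Context {F : fieldType} {W : lmodType F}.
Variables T p : nat.
Hypothesis T_inv : T%:R != 0 :> F.
Hypothesis charF : p \in [pchar F].
Implicit Types (a b c : rat -> W -> W) (w : W) (l m n : int) (x y z q : rat).

(** The indices [(l, m, n, x, y, z)] of the arrays of triple brackets: exponents
    of [x1 - x2], [x1 - x3], [x2 - x3], and modes of the three series. *)
Definition lat6 := (int * int * int * rat * rat * rat)%type.

Definition arr6 (f : int -> int -> int -> rat -> rat -> rat -> W) : lat6 -> W :=
  fun e => let: (l, m, n, x, y, z) := e in f l m n x y z.

(** The shifts that are the multiplications by [(x1 - x2)/x2], [(x1 - x3)/x3] and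
    [(x2 - x3)/x3]. *)
Definition d12 : lat6 := (1, 0, 0, 0, -1, 0).
Definition d13 : lat6 := (0, 1, 0, 0, 0, -1).
Definition d23 : lat6 := (0, 0, 1, 0, 0, -1).

Lemma d12E l m n x y z i :
  ((l, m, n, x, y, z) : lat6) + d12 *+ i = (l + i%:Z, m, n, x, y - i%:R, z).
Proof. by rewrite /d12 !pairE !mul0rn !addr0 mulNrn natz. Qed.
Lemma d13E l m n x y z i :
  ((l, m, n, x, y, z) : lat6) + d13 *+ i = (l, m + i%:Z, n, x, y, z - i%:R).
Proof. by rewrite /d13 !pairE !mul0rn !addr0 mulNrn natz. Qed.
Lemma d23E l m n x y z i :
  ((l, m, n, x, y, z) : lat6) + d23 *+ i = (l, m, n + i%:Z, x, y, z - i%:R).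
Proof. by rewrite /d23 !pairE !mul0rn !addr0 mulNrn natz. Qed.

Section Left.
Variables (eab eac ebc : F) (k : nat) (a b c : rat -> W -> W).
Hypotheses (fa : field a) (fb : field b) (fc : field c).
Hypotheses (lab : loc eab k a b) (lac : loc eac k a c) (lbc : loc ebc k b c).
Variables (rho al : rat).
Hypotheses (Trho : tint T rho) (al_rho : al - rho \is a Num.int).

Local Notation br w := (arr6 (brac eab eac ebc a b c w)).

(** The bracket of [a_l b] with [c]. *)
Lemma brac_rprod l n y z w :
  bra (eac * ebc) (rprod rho eab l a b) c w (n, y, z)
  = bpow 1 (- al) d12 (br w) (l, 0, n, al, y - al, z).
Proof.
pose H := `|k%:Z - l|%N; have leH : k%:Z <= l + H%:Z by rewrite /H; lia.
pose X (i : 'I_H) (q : rat) w := bra eab a b w (l + i%:Z, al, q + (- al - i%:R)).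
have fX i : field (X i).
  apply: (@field_shift _ _ (fun q w => bra eab a b w (l + i%:Z, al, q))).
  exact: bra_field.
transitivity (bra (eac * ebc) (fun q w => \sum_(i < H) bn (- al) i *: X i q w) c w (n, y, z)).
  congr (bra _ _ _ _ _); apply/funext => q; apply/funext => w'.
  rewrite (rprod_sum T_inv charF fa fb lab _ _ Trho al_rho leH).
  by apply: eq_bigr => i _; rewrite /X addrA.
rewrite bra_sum1 // /bpow (@nsumE _ _ H) => [|i Hi].
  apply: eq_bigr => i _; rewrite expr1n mul1r d12E /=; congr (_ *: _).
  rewrite (bra_shift1 _ _ (fun q w => bra eab a b w (l + i%:Z, al, q))).
  by rewrite brac_bra // addrA.
rewrite d12E /= (brac_loc12 T_inv charF _ _ _ fa fb fc lab) ?scaler0 //; lia.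
Qed.

(** Dong's lemma. *)
Lemma loc_rprod l : exists K : nat, loc (eac * ebc) K (rprod rho eab l a b) c.
Proof.
pose N := 3 * k%:Z - l.
exists (k + `|N|)%N => w y z.
apply/eqP; rewrite -subr_eq0 -[X in _ * X]/((-1) ^ (k + `|N|)%N%:Z).
rewrite -braE brac_rprod; apply/eqP/nsum0 => i; rewrite d12E /=.
by rewrite (brac_dong T_inv charF _ fa fb fc lab lac lbc) ?scaler0 // /N; lia.
Qed.

(** The modes of [(a_l b)_n c]: [(x1/x2)^(- al) (x2/x3)^(- (al + be))] applied to
    [[[a, b], c]]. *)
Lemma rprod_left l n q w rho' be : tint T rho' -> al + be - rho' \is a Num.int ->
  rprod rho' (eac * ebc) n (rprod rho eab l a b) c q w =
  bpow 1 (- (al + be)) d23 (bpow 1 (- al) d12 (br w)) (l, 0, n, al, be, q - al - be).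
Proof.
move=> Trho' al_be; have [K lK] := loc_rprod l.
have fX := rprod_field T_inv charF fa fb lab l Trho.
rewrite (rprod_bpow T_inv charF fX fc lK _ _ _ Trho' al_be).
have E1 : al + be - al = be by ring.
have E2 : q - (al + be) = q - al - be by ring.
by apply: eq_nsum => j; rewrite d23E !pairE mul0rn addr0 mulNrn natz brac_rprod E1 E2.
Qed.
End Left.

Section Right.
Variables (eab eac ebc : F) (k : nat) (a b c : rat -> W -> W).
Hypotheses (fa : field a) (fb : field b) (fc : field c).
Hypotheses (lab : loc eab k a b) (lac : loc eac k a c) (lbc : loc ebc k b c).
Hypotheses (eab2 : eab * eab = 1) (eac2 : eac * eac = 1) (ebc2 : ebc * ebc = 1).

Local Notation br w := (bracr eab eac ebc a b c w).

Let lba := loc_sym eab2 lab.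
Let lca := loc_sym eac2 lac.

Lemma bracr_loc23 w l m n x y z : k%:Z <= n -> br w l m n x y z = 0.
Proof. by move=> kn; rewrite /bracr (brac_loc12 T_inv charF _ _ _ fb fc fa lbc) ?scaler0. Qed.

Lemma bracr_dong w l m n x y z : k%:Z <= m -> 3 * k%:Z <= l + m + n -> br w l m n x y z = 0.
Proof.
move=> km le3; rewrite /bracr (brac_dong T_inv charF _ fb fc fa lbc lba lca) ?scaler0 //.
lia.
Qed.

Lemma bracr_rel w l m n x y z :
  br w (l + 1) m n x y z = br w l (m + 1) n x y z - br w l m (n + 1) x y z.
Proof.
rewrite /bracr !signzS !(mulrN, mulNr) opprK scaleNr opprK -scalerDr.
by rewrite (brac_rel T_inv charF _ _ _ _ fb fc fa) addrC.
Qed.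

Variables (rho al sig be : rat).
Hypotheses (Trho : tint T rho) (al_rho : al - rho \is a Num.int).
Hypotheses (Tsig : tint T sig) (be_sig : be - sig \is a Num.int).

Lemma loc_rprod_right n : exists K : nat, loc (eab * eac) K a (rprod sig ebc n b c).
Proof.
have [K lK] := loc_rprod fb fc fa lbc lba lca Tsig be_sig n.
by exists K; apply: loc_sym; first by rewrite mulrACA eab2 eac2 mulr1.
Qed.

(** The modes of [a_m (b_n c)]: [(x1/x3)^(- al) (x2/x3)^(- be)] applied to
    [[a, [b, c]]]. *)
Lemma rprod_right m n q w :
  rprod rho (eab * eac) m a (rprod sig ebc n b c) q w =
  bpow 1 (- al) d13 (bpow 1 (- be) d23 (arr6 (br w))) (0, m, n, al, be, q - al - be).
Proof.
have [K lK] := loc_rprod_right n.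
have fZ := rprod_field T_inv charF fb fc lbc n Tsig.
have e2 : eab * eac * (eab * eac) = 1 by rewrite mulrACA eab2 eac2 mulr1.
rewrite (rprod_bpow T_inv charF fa fZ lK _ _ _ Trho al_rho).
apply: eq_nsum => j; rewrite d13E !pairE mul0rn addr0 mulNrn natz; congr (_ *: _).
rewrite bra_sym // (brac_rprod eab eac fb fc fa lbc Tsig be_sig).
pose H := `|k%:Z - n|%N.
rewrite /bpow -(@nsumZ _ _ H) => [|i Hi]; last first.
  by rewrite d12E /= (brac_loc12 T_inv charF _ _ _ fb fc fa lbc) ?scaler0 //; lia.
have E : q - al - j%:R - be = q - al - be - j%:R by ring.
apply: eq_nsum => i; rewrite d12E d23E /= /bracr E expr0z !scalerA.
congr (_ *: _); ring.
Qed.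

End Right.

Section Borcherds.
Variables (eab eac ebc : F) (k : nat) (a b c : rat -> W -> W).
Hypotheses (fa : field a) (fb : field b) (fc : field c).
Hypotheses (lab : loc eab k a b) (lac : loc eac k a c) (lbc : loc ebc k b c).
Hypotheses (eab2 : eab * eab = 1) (eac2 : eac * eac = 1) (ebc2 : ebc * ebc = 1).

Lemma bracr_fin w : fin2 d13 d23 (arr6 (bracr eab eac ebc a b c w)).
Proof.
move=> [[[[[l m] n] x] y] z].
pose N1 := k%:Z - m; pose N2 := k%:Z - n; pose N3 := 3 * k%:Z - l - m - n.
exists (`|N1| + `|N2| + `|N3|)%N => i j Nij; rewrite d13E d23E /=.
case: (lerP k%:Z (n + j%:Z)) => [kn|nk].
  exact: (bracr_loc23 _ _ fa fb fc lbc).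
by apply: (bracr_dong fa fb fc lab lac lbc) => //; lia.
Qed.

Lemma bracr_bpow_loc w be' al' l m n x y z : k%:Z <= n ->
  bpow 1 al' d13 (bpow 1 be' d23 (arr6 (bracr eab eac ebc a b c w))) (l, m, n, x, y, z) = 0.
Proof.
move=> kn; apply: nsum0 => i; rewrite [bpow _ _ _ _ _]nsum0 ?scaler0 // => j.
by rewrite d13E d23E /= (bracr_loc23 _ _ fa fb fc lbc) ?scaler0 //; lia.
Qed.

Variables (rho sig : rat).
Hypotheses (Trho : tint T rho) (Tsig : tint T sig).

Let rr : rho - rho \is a Num.int. Proof. by rewrite subrr rpred0. Qed.
Let ss : sig - sig \is a Num.int. Proof. by rewrite subrr rpred0. Qed.

(** The sum over [i] restores the power [(x1 - x2)^l], expanded as the power of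
    [(x1 - x3) - (x2 - x3)]. *)
Lemma rprod_right_sum l m n q w :
  nsum (fun i => ((-1) ^+ i * bn l%:~R i) *:
    rprod rho (eab * eac) (m + l - i%:Z) a (rprod sig ebc (n + i%:Z) b c) q w)
  = bpow 1 (- rho) d13 (bpow 1 (- sig) d23 (arr6 (bracr eab eac ebc a b c w)))
      (l, m, n, rho, sig, q - rho - sig).
Proof.
set G := arr6 _; set P := bpow _ _ _ _.
have G2 := bracr_fin w; have G1 := fin2_fin (fin2C G2).
have PG : fin d13 (bpow 1 (- sig) d23 G) by apply/fin2_fin/fin2C/fin2_bpow/fin2C.
pose dl : lat6 := (0, -1, 1, 0, 0, 0); pose t : lat6 := (1, -1, 0, 0, 0, 0).
have dlE e i : e + dl *+ i = (e.1.1.1.1.1, e.1.1.1.1.2 - i%:Z, e.1.1.1.2 + i%:Z, e.1.1.2, e.1.2, e.2).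
  by case: e => [[[[[? ?] ?] ?] ?] ?]; rewrite /dl !pairE !mul0rn !addr0 mulNrn natz.
have Pt : forall e, P (e + t) = P e + -1 *: P (e + dl).
  apply: bpow_rel => //; apply: bpow_rel => // -[[[[[l' m'] n'] x'] y'] z'].
  rewrite /dl /t !pairE !addr0 scaleN1r /=.
  by rewrite (bracr_rel _ _ _ fa fb fc) subrK.
have Pfin : fin dl P.
  move=> [[[[[l' m'] n'] x'] y'] z']; pose N := k%:Z - n'; exists `|N|%N => i Ni.
  by rewrite dlE; apply: bracr_bpow_loc => /=; lia.
transitivity (bpow (-1) l%:~R dl P (0, m + l, n, rho, sig, q - rho - sig)).
  apply: eq_nsum => i; rewrite dlE /=; congr (_ *: _).
  exact: (rprod_right fa fb fc lab lac lbc).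
rewrite (bpow_int T_inv charF _ _ Pt Pfin) /t !pairE !mul0rz !addr0 mulNrz add0r.
by rewrite !intz addrK.
Qed.
End Borcherds.

Section Identity.
Variables (eab eac ebc : F) (k : nat) (a b c : rat -> W -> W).
Hypotheses (fa : field a) (fb : field b) (fc : field c).
Hypotheses (lab : loc eab k a b) (lac : loc eac k a c) (lbc : loc ebc k b c).
Hypotheses (eab2 : eab * eab = 1) (eac2 : eac * eac = 1) (ebc2 : ebc * ebc = 1).
Variables (rho sig : rat).
Hypotheses (Trho : tint T rho) (Tsig : tint T sig).

Local Notation br w := (arr6 (brac eab eac ebc a b c w)).
Let lba := loc_sym eab2 lab.

Let rr : rho - rho \is a Num.int. Proof. by rewrite subrr rpred0. Qed.

(* The triple bracket [[b, [a, c]]], at the indices of [[a, [b, c]]]. *)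
Let bracr' w l m n x y z := (eab * (-1) ^ l) *: bracr eab ebc eac b a c w l n m y x z.

Let bracr'_fin w : fin2 d23 d13 (arr6 (bracr' w)).
Proof.
move=> [[[[[l m] n] x] y] z].
have [N N0] := bracr_fin fb fa fc lba lbc lac eab2 ebc2 w (l, n, m, y, x, z).
exists N => i j /N0 E; rewrite d23E d13E; move: E; rewrite d13E d23E /= /bracr' => ->.
exact: scaler0.
Qed.

Lemma rprod_right_sum' l m n q w :
  (eab * (-1) ^ l) *: nsum (fun i => ((-1) ^+ i * bn l%:~R i) *:
    rprod sig (eab * ebc) (n + l - i%:Z) b (rprod rho eac (m + i%:Z) a c) q w)
  = bpow 1 (- sig) d23 (bpow 1 (- rho) d13 (arr6 (bracr' w)))
      (l, m, n, rho, sig, q - rho - sig).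
Proof.
rewrite (rprod_right_sum fb fa fc lba lbc lac eab2 ebc2 Tsig Trho).
have G2 := bracr_fin fb fa fc lba lbc lac eab2 ebc2 w.
have G1 := fin2_fin (fin2C G2).
have PG : fin d13 (bpow 1 (- rho) d23 (arr6 (bracr eab ebc eac b a c w))).
  exact/fin2_fin/fin2C/fin2_bpow/fin2C.
rewrite -bpowZ // [q - rho - sig]addrAC; apply: eq_nsum => i; congr (_ *: _).
rewrite d13E d23E -(bpowZ _ _ _ _ G1).
by apply: eq_nsum => j; rewrite d13E d23E.
Qed.

Lemma brac_fin : forall w, fin2 d13 d23 (br w).
Proof.
move=> w; have := fin2B (bracr_fin fa fb fc lab lac lbc eab2 eac2 w) (fin2C (bracr'_fin w)).
move=> fB [[[[[l m] n] x] y] z]; have [N N0] := fB (l, m, n, x, y, z).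
exists N => i j /N0; rewrite !d13E !d23E /= => <-.
exact: brac_jacobi.
Qed.

Lemma brac_fin12 w : fin2 d12 d23 (br w).
Proof.
move=> [[[[[l m] n] x] y] z].
pose N1 := k%:Z - l; pose N2 := k%:Z - n; pose N3 := 3 * k%:Z - l - m - n.
exists (`|N1| + `|N2| + `|N3|)%N => i j Nij; rewrite d12E d23E /=.
case: (lerP k%:Z (l + i%:Z)) => [kl|lk].
  exact: (brac_loc12 T_inv charF _ _ _ fa fb fc lab).
by apply: (brac_dong T_inv charF _ fa fb fc lab lac lbc); lia.
Qed.

(** [(x1/x3)^al = (x1/x2)^al (x2/x3)^al] on [[[a, b], c]]. *)
Lemma brac_bpow13 al w e : tint T al ->
  bpow 1 al d13 (br w) e = bpow 1 al d12 (bpow 1 al d23 (br w)) e.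
Proof.
move=> Tal; pose v : lat6 := (1, 0, 0, 0, 0, -1); pose t : lat6 := (0, 0, 0, 0, 1, -1).
have fin23 := fin2_fin (fin2C (brac_fin12 w)).
have vE e' i : e' + v *+ i = (e'.1.1.1.1.1 + i%:Z, e'.1.1.1.1.2, e'.1.1.1.2, e'.1.1.2, e'.1.2, e'.2 - i%:R).
  by case: e' => [[[[[? ?] ?] ?] ?] ?]; rewrite /v !pairE !mul0rn !addr0 mulNrn natz.
have fv : fin2 d23 v (br w).
  move=> [[[[[l m] n] x] y] z].
  pose N1 := k%:Z - l; pose N2 := k%:Z - n; pose N3 := 3 * k%:Z - l - m - n.
  exists (`|N1| + `|N2| + `|N3|)%N => i j Nij; rewrite vE d23E /=.
  case: (lerP k%:Z (l + j%:Z)) => [kl|lk].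
    exact: (brac_loc12 T_inv charF _ _ _ fa fb fc lab).
  by apply: (brac_dong T_inv charF _ fa fb fc lab lac lbc); lia.
have split13 e' : br w (e' + d13) = br w (e' + d23) + br w (e' + v).
  rewrite -[d13]mulr1n -[d23]mulr1n -[v]mulr1n vE.
  case: e' => [[[[[l m] n] x] y] z]; rewrite d13E d23E /=.
  by rewrite (brac_rel T_inv charF _ _ _ _ fa fb fc) addrC.
have shift t' : br w (t' + t) = br w t' + 1 *: br w (t' + d23).
  rewrite -[d23]mulr1n; case: t' => [[[[[l m] n] x] y] z]; rewrite d23E /t !pairE !addr0 /= scale1r.
  by rewrite (bracS23 T_inv charF _ _ _ _ fa fb fc) subrK [RHS]addrC subrK.
have term i : bpow 1 (al - i%:R) d23 (br w) (e + v *+ i) = bpow 1 al d23 (br w) (e + d12 *+ i).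
  rewrite -(bpow_add T_inv charF _ _ Tal (tintN (tint_nat T i)) fin23).
  transitivity (bpow 1 al d23 (fun e => br w (e + t *~ (- i%:Z))) (e + v *+ i)).
    by apply: eq_bpow => j; rewrite -(bpow_int T_inv charF _ _ shift fin23) mulrNz.
  rewrite bpow_shift vE; case: (e) => [[[[[l m] n] x] y] z].
  rewrite d12E /t !pairE !mul0rz !addr0 !mulrNz mulNrz opprK /=.
  by rewrite [z - _ + _]subrK.
rewrite (bpow_split T_inv charF _ Tal split13 fv); apply: eq_nsum => i.
by rewrite expr1n mul1r term.
Qed.

Lemma brac_bpow w e :
  bpow 1 (- rho) d13 (bpow 1 (- sig) d23 (br w)) e
  = bpow 1 (- (rho + sig)) d23 (bpow 1 (- rho) d12 (br w)) e.
Proof.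
have f13 := brac_fin w; have f12 := brac_fin12 w.
have fin23 := fin2_fin (fin2C f12).
have fin23' : fin d23 (bpow 1 (- rho) d12 (br w)) by exact/fin2_fin/fin2C/fin2_bpow.
rewrite (bpowC _ _ _ _ _ f13) opprD addrC.
rewrite -(bpow_add T_inv charF _ _ (tintN Tsig) (tintN Trho) fin23').
by apply: eq_bpow => i; rewrite (brac_bpow13 _ _ (tintN Trho)) (bpowC _ _ _ _ _ f12).
Qed.

(** The sum over [i] restores the power [(x1 - x3)^m], expanded as the power of
    [(x1 - x2) + (x2 - x3)]. *)
Lemma rprod_left_sum rho' l m n q w : tint T rho' -> rho + sig - rho' \is a Num.int ->
  nsum (fun i => bn m%:~R i *:
    rprod rho' (eac * ebc) (m + n - i%:Z) (rprod rho eab (l + i%:Z) a b) c q w)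
  = bpow 1 (- (rho + sig)) d23 (bpow 1 (- rho) d12 (br w))
      (l, m, n, rho, sig, q - rho - sig).
Proof.
move=> Trho' rs; set P := bpow _ _ _ _.
have f12 := brac_fin12 w; have f1 := fin2_fin f12.
have fP : fin d23 (bpow 1 (- rho) d12 (br w)) by exact/fin2_fin/fin2C/fin2_bpow.
pose dl : lat6 := (1, 0, -1, 0, 0, 0); pose t : lat6 := (0, 1, -1, 0, 0, 0).
have dlE e i : e + dl *+ i = (e.1.1.1.1.1 + i%:Z, e.1.1.1.1.2, e.1.1.1.2 - i%:Z, e.1.1.2, e.1.2, e.2).
  by case: e => [[[[[? ?] ?] ?] ?] ?]; rewrite /dl !pairE !mul0rn !addr0 mulNrn natz.
have Pt : forall e, P (e + t) = P e + 1 *: P (e + dl).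
  apply: bpow_rel => //; apply: bpow_rel => // -[[[[[l' m'] n'] x'] y'] z'].
  rewrite /dl /t !pairE !addr0 scale1r /=.
  by rewrite (brac_rel T_inv charF _ _ _ _ fa fb fc) subrK addrC.
have Pfin : fin dl P.
  move=> [[[[[l' m'] n'] x'] y'] z']; pose N := k%:Z - l'; exists `|N|%N => i Ni.
  rewrite dlE; apply: nsum0 => j; rewrite [bpow _ _ _ _ _]nsum0 ?scaler0 // => j'.
  by rewrite d23E d12E /= (brac_loc12 T_inv charF _ _ _ fa fb fc lab) ?scaler0 //; lia.
transitivity (bpow 1 m%:~R dl P (l, 0, m + n, rho, sig, q - rho - sig)).
  apply: eq_nsum => i; rewrite dlE expr1n mul1r /=; congr (_ *: _).
  exact: (rprod_left fa fb fc lab lac lbc).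
rewrite (bpow_int T_inv charF _ _ Pt Pfin) /t !pairE !mul0rz !addr0 mulNrz add0r.
by rewrite !intz [m + n]addrC addrK.
Qed.

(** The Borcherds identity for the products of series. *)
Lemma rprod_borcherds rho' l m n q w : tint T rho' -> rho + sig - rho' \is a Num.int ->
  nsum (fun i => ((-1) ^+ i * bn l%:~R i) *:
    rprod rho (eab * eac) (m + l - i%:Z) a (rprod sig ebc (n + i%:Z) b c) q w)
  - (eab * (-1) ^ l) *: nsum (fun i => ((-1) ^+ i * bn l%:~R i) *:
    rprod sig (eab * ebc) (n + l - i%:Z) b (rprod rho eac (m + i%:Z) a c) q w)
  = nsum (fun i => bn m%:~R i *:
    rprod rho' (eac * ebc) (m + n - i%:Z) (rprod rho eab (l + i%:Z) a b) c q w).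
Proof.
move=> Trho' rs; rewrite rprod_left_sum // rprod_right_sum' -brac_bpow.
rewrite (rprod_right_sum fa fb fc lab lac lbc eab2 eac2 Trho Tsig).
have f1 := bracr_fin fa fb fc lab lac lbc eab2 eac2 w.
have f2 := bracr'_fin w; rewrite (bpowC _ _ _ _ _ f2).
have f1' := fin2C f1; have h1 := fin2_fin f1'; have h2 := fin2_fin f2.
have g1 := fin2_fin (fin2C (fin2_bpow 1 (- sig) f1')).
have g2 := fin2_fin (fin2C (fin2_bpow 1 (- sig) f2)).
rewrite -(bpowB _ _ _ g1 g2); apply: eq_bpow => i.
rewrite -(bpowB _ _ _ h1 h2); apply: eq_bpow => j.
move: (_ + d23 *+ j) => [[[[[l' m'] n'] x] y] z].
by rewrite /= -brac_jacobi.
Qed.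
End Identity.

End IteratedProducts.

(** * Formal series and modes *)

Lemma fsum_single (I : choiceType) (V : zmodType) (i : I) (g : I -> V) :
  (forall j, j <> i -> g j = 0) -> \sum_(j \in [set: I]) g j = g i.
Proof.
move=> g0; transitivity (\sum_(j \in [set i]) g j); last by rewrite fsbig_set1.
by apply/esym/fsbig_widen => // j [_ /= ji]; exact: g0.
Qed.

Section ScalarSeries.
Context {F : fieldType} {W : lmodType F}.
Implicit Types (u : expo -> W) (e d : expo).

(** Multiplication by a scalar series supported on a sequence of monomials. *)
Lemma smul_fam (f : expo -> F) (c : nat -> F) (phi : nat -> expo) u e :
  injective phi -> (forall i, f (phi i) = c i) ->
  (forall d, (forall i, d <> phi i) -> f d *: u (e - d) = 0) ->
  smul f u e = nsum (fun i => c i *: u (e - phi i)).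
Proof.
move=> phi_inj fphi f0; rewrite /smul /nsum.
rewrite -(fsbig_widen (phi @` [set: nat])) //; last first.
  by move=> d [_ /= nd]; apply: f0 => i di; apply: nd; exists i.
rewrite (fsbig_image _ phi) => [|i j _ _]; last exact: phi_inj.
by apply: eq_fsbigr => i _; rewrite fphi.
Qed.

Variables (y z : rat -> expo).

Lemma subpow_at al i : injective (fun j : nat => y (al - j%:R) + z j%:R) ->
  subpow y z al (y (al - i%:R) + z i%:R) = (-1) ^+ i * bn al i :> F.
Proof.
move=> inj; rewrite /subpow (@fsum_single _ _ i) ?eqxx // => j ji.
by case: eqP => // /inj /esym.
Qed.

Lemma subpow_out al e : (forall j : nat, e <> y (al - j%:R) + z j%:R) ->
  subpow y z al e = 0 :> F.
Proof. by move=> out; apply: fsbig1 => j _; case: eqP => // /out. Qed.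

End ScalarSeries.

Lemma nat_rat_inj (i j : nat) : i%:R = j%:R :> rat -> i = j.
Proof. by move/eqP; rewrite eqr_nat => /eqP. Qed.

Lemma int_rat_inj (i j : int) : i%:~R = j%:~R :> rat -> i = j.
Proof. by move/eqP; rewrite eqr_int => /eqP. Qed.

Section Bridge.
Context {F : fieldType}.
Implicit Types (W : lmodType F) (l m n : int).

Lemma fam12_inj al : injective (fun j : nat => X1 (al - j%:R) + X2 j%:R).
Proof. by move=> i j []; rewrite /X1 /X2 !add0r => _ /nat_rat_inj. Qed.
Lemma fam21_inj al : injective (fun j : nat => X2 (al - j%:R) + X1 j%:R).
Proof. by move=> i j []; rewrite /X1 /X2 !add0r => /nat_rat_inj. Qed.
Lemma fam10_inj al : injective (fun j : nat => X1 (al - j%:R) + X0 j%:R).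
Proof. by move=> i j []; rewrite /X1 /X0 !add0r => /nat_rat_inj. Qed.

(** Only one term of a delta function contributes to a given exponent of [t]. *)
Lemma delta0_at s y z n d1 d2 :
  (forall al d, subpow y z al d != 0 :> F -> d.1.1 = 0) ->
  delta s X0 y z (- n%:~R - 1, d1, d2) = s ^ n * subpow y z n%:~R (0, d1, d2) :> F.
Proof.
move=> yz0; rewrite /delta (@fsum_single _ _ n) => [|k kn].
  by rewrite /mshift /X0 /= !pairE !subr0 subrr.
case: (eqVneq (mshift (X0 (- k%:~R - 1)) (subpow y z k%:~R) (- n%:~R - 1, d1, d2) : F) 0) => [->|].
  by rewrite mulr0.
move=> /yz0; rewrite /X0 /= => E; case: kn; apply: int_rat_inj.
by move: E; move: (k%:~R : rat) (n%:~R : rat) => kk nn; lra.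
Qed.

Lemma delta0_out s y z d0 d1 d2 :
  (forall al d, subpow y z al d != 0 :> F -> d.1.1 = 0) ->
  d0 \isn't a Num.int -> delta s X0 y z (d0, d1, d2) = 0 :> F.
Proof.
move=> yz0 d0int; apply: fsbig1 => k _.
case: (eqVneq (mshift (X0 (- k%:~R - 1)) (subpow y z k%:~R) (d0, d1, d2) : F) 0) => [->|].
  by rewrite mulr0.
move=> /yz0; rewrite /X0 /= => E; move: d0int.
have -> : d0 = - k%:~R - 1 by move: E; move: (k%:~R : rat) => kk; lra.
by rewrite rpredB ?rpredN ?intr_int.
Qed.

Lemma subpow_supp (y z : rat -> expo) al d :
  subpow y z al d != 0 :> F -> exists j : nat, d = y (al - j%:R) + z j%:R.
Proof.
move=> nz; apply: contrapT => out; move: nz; rewrite subpow_out ?eqxx // => j E.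
by apply: out; exists j.
Qed.

Lemma subpow12_0 al d : subpow X1 X2 al d != 0 :> F -> d.1.1 = 0.
Proof. by case/subpow_supp => j ->; rewrite /X1 /X2 /= addr0. Qed.
Lemma subpow21_0 al d : subpow X2 X1 al d != 0 :> F -> d.1.1 = 0.
Proof. by case/subpow_supp => j ->; rewrite /X1 /X2 /= addr0. Qed.

(** The modes of a series: [md a m] is the coefficient of [x^(- m - 1)]. *)
Definition md W (a : series W) : rat -> W -> W := fun q => a (- q - 1).

Section Coefficients.
Context {W : lmodType F}.
Variables (a b : series W) (w : W).

(** The two terms of the left-hand side of the Jacobi identity. *)
Lemma delta12E l (m n : rat) :
  smul (delta 1 X0 X1 X2) (ser12 a b w) (- l%:~R - 1, - m - 1, - n - 1)
  = oprod l (md a) (md b) w m n.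
Proof.
rewrite (@smul_fam _ _ _ (fun i => (-1) ^+ i * bn l%:~R i)
  (fun i => (- l%:~R - 1, l%:~R - i%:R, i%:R))).
- rewrite oprodE; apply: eq_nsum => i; rewrite !pairE subrr /= ?eqxx /md.
  by congr (_ *: a _ (b _ _)); ring.
- by move=> i j [_ /nat_rat_inj].
- move=> i; rewrite delta0_at; last exact: subpow12_0.
  rewrite exp1rz mul1r -(subpow_at _ (@fam12_inj _)); congr subpow.
  by rewrite /X1 /X2 !pairE !add0r addr0.
- move=> [[d0 d1] d2] out; rewrite /ser12 !pairE.
  case: eqP => [E|]; last by rewrite scaler0.
  have d0E : d0 = - l%:~R - 1 := esym (subr0_eq E).
  rewrite d0E.
  rewrite delta0_at; last exact: subpow12_0.
  rewrite subpow_out ?mulr0 ?scale0r // => j; rewrite /X1 /X2 !pairE !add0r addr0 => -[E1 E2].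
  by apply: (out j); rewrite -E1 -E2 d0E.
Qed.

Lemma delta21E l (m n : rat) : field (md a) -> field (md b) ->
  smul (delta (-1) X0 X2 X1) (ser21 a b w) (- l%:~R - 1, - m - 1, - n - 1)
  = (-1) ^ l *: oprod l (md b) (md a) w n m.
Proof.
move=> fa fb; have [N N0] := two_fin w fb fa ((n, m) + ax1 *~ l).
rewrite /oprod -(nsumZ _ (bpow_fin_term _ _ N0)).
rewrite (@smul_fam _ _ _ (fun i => (-1) ^ l * ((-1) ^+ i * bn l%:~R i))
  (fun i => (- l%:~R - 1, i%:R, l%:~R - i%:R))).
- apply: eq_nsum => i; rewrite scalerA /two /ax1 /ax2 !pairE subrr /= ?eqxx /md.
  rewrite !(mul0rz, subr0, sub0r, addr0, mulNrn); congr (_ *: b _ (a _ _)); ring.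
- by move=> i j [/nat_rat_inj].
- move=> i; rewrite delta0_at; last exact: subpow21_0.
  rewrite -(subpow_at _ (@fam21_inj _)); congr (_ * subpow _ _ _ _).
  by rewrite /X1 /X2 !pairE !add0r addr0.
- move=> [[d0 d1] d2] out; rewrite /ser21 !pairE.
  case: eqP => [E|]; last by rewrite scaler0.
  have d0E : d0 = - l%:~R - 1 := esym (subr0_eq E).
  rewrite d0E.
  rewrite delta0_at; last exact: subpow21_0.
  rewrite subpow_out ?mulr0 ?scale0r // => j; rewrite /X1 /X2 !pairE !add0r addr0 => -[E1 E2].
  by apply: (out j); rewrite -E2 -E1 d0E.
Qed.

Lemma jacobi_lhsE al be l (m n : rat) : field (md a) -> field (md b) ->
  jacobi_lhs al be a b w (- l%:~R - 1, - m - 1, - n - 1)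
  = bra (sgn al be) (md a) (md b) w (l, m, n).
Proof. by move=> fa fb; rewrite /jacobi_lhs delta12E delta21E // braE scalerA. Qed.

Lemma jacobi_lhs_out al be e0 e1 e2 : e0 \isn't a Num.int ->
  jacobi_lhs al be a b w (e0, e1, e2) = 0.
Proof.
move=> e0int; rewrite /jacobi_lhs /smul !fsbig1 ?scaler0 ?subr0 // => -[[d0 d1] d2] _.
  rewrite /ser21 !pairE; case: eqP => [E|]; last by rewrite scaler0.
  have d0E : d0 = e0 := esym (subr0_eq E).
  by rewrite delta0_out ?scale0r ?d0E //; exact: subpow21_0.
rewrite /ser12 !pairE; case: eqP => [E|]; last by rewrite scaler0.
have d0E : d0 = e0 := esym (subr0_eq E).
by rewrite delta0_out ?scale0r ?d0E //; exact: subpow12_0.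
Qed.

Lemma subpow12E (k : nat) (m n : rat) :
  smul (subpow X1 X2 k%:R) (ser12 a b w) (0, - m - 1, - n - 1) = oprod k (md a) (md b) w m n.
Proof.
rewrite (@smul_fam _ _ _ (fun i => (-1) ^+ i * bn k%:R i)
  (fun i => X1 (k%:R - i%:R) + X2 i%:R)).
- rewrite oprodE; apply: eq_nsum => i; rewrite /X1 /X2 !pairE !addr0 add0r /ser12 /= ?subr0 ?eqxx /md.
  by congr (_ *: a _ (b _ _)); rewrite -?pmulrn; ring.
- exact: fam12_inj.
- by move=> i; rewrite subpow_at //; exact: fam12_inj.
- by move=> d out; rewrite subpow_out ?scale0r.
Qed.

Lemma subpow21E (k : nat) (m n : rat) :
  smul (subpow X1 X2 k%:R) (ser21 a b w) (0, - m - 1, - n - 1)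
  = (-1) ^+ k *: oprod k (md b) (md a) w n m.
Proof.
rewrite (@smul_fam _ _ _ (fun i => (-1) ^+ i * bn k%:R i)
  (fun i => X1 (k%:R - i%:R) + X2 i%:R)).
- transitivity (dpow ax1 ax2 k (fun e => md b e.2 (md a e.1 w)) (m, n)).
    apply: eq_nsum => i; rewrite /X1 /X2 /ax1 /ax2 !pairE /= !addr0 add0r /ser21 /= ?subr0 ?eqxx /md.
    rewrite !(mul0rz, subr0, sub0r, addr0, mulNrn).
    by congr (_ *: b _ (a _ _)); rewrite -?pmulrn; ring.
  rewrite dpow_natN; congr (_ *: _); apply: eq_nsum => i.
  by rewrite /two /ax1 /ax2 !pairE /= !(mul0rz, subr0, sub0r, addr0, mulNrn).
- exact: fam12_inj.
- by move=> i; rewrite subpow_at //; exact: fam12_inj.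
- by move=> d out; rewrite subpow_out ?scale0r.
Qed.

End Coefficients.

Lemma mutually_localP W al be (a b : series W) :
  mutually_local al be a b <-> exists k, loc (sgn al be) k (md a) (md b).
Proof.
split=> -[k lab]; exists k.
  move=> w m n; have := lab w (0, - m - 1, - n - 1).
  by rewrite subpow12E subpow21E scalerA.
move=> w [[e0 e1] e2]; have [->|e00] := eqVneq e0 0.
  rewrite (_ : e1 = - (- e1 - 1) - 1); last by ring.
  rewrite [in RHS](_ : e2 = - (- e2 - 1) - 1); last by ring.
  rewrite [in LHS](_ : e2 = - (- e2 - 1) - 1); last by ring.
  by rewrite subpow12E subpow21E lab scalerA.
rewrite /smul !fsbig1 ?scaler0 // => -[[d0 d1] d2] _.
  have [->|/subpow12_0 /= ->] := eqVneq (subpow X1 X2 k%:R (d0, d1, d2) : F) 0; first by rewrite scale0r.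
  by rewrite subr0 (negPf e00) scaler0.
have [->|/subpow12_0 /= ->] := eqVneq (subpow X1 X2 k%:R (d0, d1, d2) : F) 0; first by rewrite scale0r.
by rewrite subr0 (negPf e00) scaler0.
Qed.

(** Multiplication by [((x1 - x0)/x2)^al]. *)
Lemma smul_ratio W al (u : expo -> W) e0 e1 e2 :
  smul (ratiopow X1 X0 X2 al) u (e0, e1, e2) = nsum (fun j =>
    ((-1) ^+ j * bn al j) *: u (e0 - j%:R, e1 - al + j%:R, e2 + al)).
Proof.
rewrite (@smul_fam _ _ _ (fun i => (-1) ^+ i * bn al i)
  (fun i => X1 (al - i%:R) + X0 i%:R + X2 (- al))).
- apply: eq_nsum => i; rewrite /X1 /X0 /X2 !pairE !addr0 !add0r /=.
  by rewrite opprB opprK addrA addrAC.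
- by move=> i j /addIr; exact: fam10_inj.
- move=> i; rewrite /ratiopow /mshift addrK subpow_at //; exact: fam10_inj.
- move=> d out; rewrite /ratiopow /mshift subpow_out ?scale0r // => j E.
  by apply: (out j); rewrite -E subrK.
Qed.

(** The products are given by their modes. *)
Lemma nprodE W T r al be n (a b : series W) q w : field (md a) -> field (md b) ->
  md (nprod T r al be n a b) q w
  = rprod (r%:R / T%:R) (sgn al be) n (md a) (md b) q w.
Proof.
move=> fa fb; rewrite /md /nprod /mshift /X0 !pairE !subr0 smul_ratio rprodE.
set rho : rat := _ / _; apply: eq_nsum => i.
have E0 : -1 - n%:~R - i%:R = - (n + i%:Z)%:~R - 1 :> rat by rewrite intrD -pmulrn; ring.
have E1 : -1 - rho + i%:R = - (rho - i%:R) - 1 by ring.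
have E2 : - q - 1 + rho = - (q - rho) - 1 by ring.
by rewrite E0 E1 E2 jacobi_lhsE.
Qed.

End Bridge.

Lemma fsum_pair (F : fieldType) (W : lmodType F) N (g : nat -> nat -> W) :
  (forall i j, (N <= i + j)%N -> g i j = 0) ->
  \sum_(x \in [set: (nat * nat)%type]) g x.1 x.2 = nsum (fun i => nsum (g i)).
Proof.
move=> g0; rewrite (@nsum2E _ _ N) => [|i j /orP[Ni|Nj]]; last first.
- by rewrite g0 // (leq_trans Nj) // leq_addl.
- by rewrite g0 // (leq_trans Ni) // leq_addr.
pose r := [seq (i, j) | i <- iota 0 N, j <- iota 0 N].
have ur : uniq r by rewrite allpairs_uniq ?iota_uniq // => -[? ?] [? ?] _ _ [-> ->].
rewrite (fsbigE r) //; last first.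
  move=> [i j] _ /allpairsPdep nij; rewrite /= g0 // leqNgt; apply/negP => lt_ijN.
  by apply: nij; exists i, j; split; rewrite ?mem_iota //=; lia.
rewrite (eq_bigl xpredT) => [|x]; last by rewrite in_setT.
rewrite /r big_allpairs_dep /= -(big_mkord xpredT (fun i => \sum_(j < N) g i j)).
rewrite /index_iota subn0; apply: eq_bigr => i _.
by rewrite -(big_mkord xpredT (g i)) /index_iota subn0.
Qed.

Section JacobiRight.
Context {F : fieldType}.
Variables T p : nat.
Hypothesis T_inv : T%:R != 0 :> F.
Hypothesis charF : p \in [pchar F].

Lemma delta2_at s y z (n : int) d0 d1 :
  (forall al d, subpow y z al d != 0 :> F -> d.2 = 0) ->
  delta s X2 y z (d0, d1, - n%:~R - 1) = s ^ n * subpow y z n%:~R (d0, d1, 0) :> F.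
Proof.
move=> yz0; rewrite /delta (@fsum_single _ _ n) => [|k kn].
  by rewrite /mshift /X2 /= !pairE !subr0 subrr.
case: (eqVneq (mshift (X2 (- k%:~R - 1)) (subpow y z k%:~R) (d0, d1, - n%:~R - 1) : F) 0) => [->|].
  by rewrite mulr0.
move=> /yz0; rewrite /X2 /= => E; case: kn; apply: int_rat_inj.
by move: E; move: (k%:~R : rat) (n%:~R : rat) => kk nn; lra.
Qed.

Lemma delta2_supp s y z d0 d1 d2 :
  (forall al d, subpow y z al d != 0 :> F -> d.2 = 0) ->
  delta s X2 y z (d0, d1, d2) != 0 :> F -> exists n : int, d2 = - n%:~R - 1.
Proof.
move=> yz0 nz; apply: contrapT => out; move: nz; rewrite /delta fsbig1 ?eqxx // => k _.
case: (eqVneq (mshift (X2 (- k%:~R - 1)) (subpow y z k%:~R) (d0, d1, d2) : F) 0) => [->|].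
  by rewrite mulr0.
by move=> /yz0; rewrite /X2 /= => /subr0_eq E; case: out; exists k.
Qed.

Lemma subpow10_2 al d : subpow X1 X0 al d != 0 :> F -> d.2 = 0.
Proof. by case/subpow_supp => j ->; rewrite /X1 /X0 /= addr0. Qed.

Variables (V W : lmodType F) (Y : V -> series V) (YW : V -> series W) (u v : V) (w : W).
Hypothesis YW0 : forall q w, YW 0 q w = 0.

Lemma ratio_iterateE al e0 e2 (j : nat) :
  smul (ratiopow X1 X0 X2 al) (iterate Y YW u v w) (e0, al - j%:R, e2)
  = ((-1) ^+ j * bn al j) *: YW (Y u (e0 - j%:R) v) (e2 + al) w.
Proof.
rewrite smul_ratio /nsum (@fsum_single _ _ j) => [|i ij]; rewrite /iterate.
  by rewrite addrAC subrK subrr eqxx.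
case: eqP => [E|]; last by rewrite scaler0.
by case: ij; apply: nat_rat_inj; move: E; move: (i%:R : rat) (j%:R : rat) => x y; lra.
Qed.

Lemma ratio_iterate_supp al e0 e1 e2 :
  smul (ratiopow X1 X0 X2 al) (iterate Y YW u v w) (e0, e1, e2) <> 0 ->
  exists j : nat, e1 = al - j%:R.
Proof.
move=> nz; apply: contrapT => out; apply: nz; rewrite smul_ratio; apply: nsum0 => j.
rewrite /iterate; case: eqP => [E|]; last by rewrite scaler0.
by case: out; exists j; move: E; move: (j%:R : rat) => y; lra.
Qed.

Variable al : rat.
Local Notation rhs := (smul (delta 1 X2 X1 X0)
   (smul (ratiopow X1 X0 X2 al) (iterate Y YW u v w))).

Lemma jacobi_rhs_out e0 e1 e2 : e1 - al \isn't a Num.int -> rhs (e0, e1, e2) = 0.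
Proof.
move=> e1al; rewrite {1}/smul fsbig1 // => -[[d0 d1] d2] _.
case: (eqVneq (delta 1 X2 X1 X0 (d0, d1, d2) : F) 0) => [->|nz]; first by rewrite scale0r.
have [n d2E] := delta2_supp subpow10_2 nz; move: nz; rewrite d2E delta2_at; last exact: subpow10_2.
rewrite exp1rz mul1r => /subpow_supp[i]; rewrite /X1 /X0 !pairE !add0r addr0 => -[d0E d1E].
apply/eqP; rewrite scaler_eq0; apply/norP => -[_ /eqP].
move=> /ratio_iterate_supp[j E]; case/negP: e1al.
have -> : e1 - al = n%:~R - i%:R - j%:R.
  have E' : (e1 : rat) - (n%:~R - i%:R) = al - j%:R by rewrite -d1E.
  by move: E'; move: (n%:~R : rat) (i%:R : rat) (j%:R : rat) => x y z; lra.
by rewrite !rpredB ?intr_int ?natr_int.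
Qed.

Hypothesis Tal : tint T al.
Hypothesis Ytr : truncated 0 (fun e => Y u e v).

(** The right-hand side of the Jacobi identity: the binomial series of the delta
    function and of the ratio combine by the Vandermonde identity. *)
Lemma jacobi_rhsE e0 e1 e2 : e1 - al \is a Num.int ->
  rhs (e0, e1, e2) = nsum (fun h => bn (- e1 - 1) h *:
    YW (Y u (e0 - h%:R) v) (e2 + e1 + 1 + h%:R) w).
Proof.
move=> /intrP[K EK].
have e1E : e1 = K%:~R + al by rewrite -EK subrK.
pose X h := YW (Y u (e0 - h%:R) v) (e2 + e1 + 1 + h%:R) w.
have [N XN] : exists N : nat, forall h, (N <= h)%N -> X h = 0.
  have [M YM] := Ytr; have [N ltN] := rat_lt_nat (e0 - M); exists N => h Nh.
  rewrite /X YM ?YW0 // ltrBlDr -ltrBlDl; apply: lt_le_trans ltN _.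
  by rewrite ler_nat.
pose c i j : F := (-1) ^+ i * bn (K + (i + j)%N%:Z)%:~R i * ((-1) ^+ j * bn al j).
pose g i j := c i j *: X (i + j)%N.
have g0 i j : (N <= i + j)%N -> g i j = 0 by move=> Nij; rewrite /g XN ?scaler0.
(* The exponents at which both factors contribute; the two indices are the powers
   of [x0] taken from the delta function and from the ratio. *)
pose psi (x : nat * nat) : expo :=
  (x.1%:R, K%:~R + x.2%:R, - (K + (x.1 + x.2)%N%:Z)%:~R - 1).
transitivity (\sum_(x \in [set: (nat * nat)%type]) g x.1 x.2).
  rewrite {1}/smul -(fsbig_widen (psi @` [set: (nat * nat)%type])) //; last first.
    move=> [[d0 d1] d2] [_ /= out]; apply/eqP; rewrite scaler_eq0; apply/norP => -[nz].
    have [n d2E] := delta2_supp subpow10_2 nz; move: nz; rewrite d2E delta2_at; last exact: subpow10_2.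
    rewrite exp1rz mul1r => /subpow_supp[i]; rewrite /X1 /X0 !pairE !add0r addr0 => -[d0E d1E].
    move=> /eqP /ratio_iterate_supp[j E]; apply: out; exists (i, j) => //.
    have nE : n = K + (i + j)%N%:Z.
      have E' : (K%:~R + al : rat) - (n%:~R - i%:R) = al - j%:R by rewrite -d1E -e1E.
      apply: int_rat_inj; rewrite intrD PoszD intrD -!pmulrn; move: E'.
      by move: (n%:~R : rat) (K%:~R : rat) (i%:R : rat) (j%:R : rat) => x x' y z; lra.
    rewrite /psi /= d0E d2E d1E nE; congr (_, _, _); rewrite intrD PoszD intrD -!pmulrn; ring.
  rewrite (fsbig_image _ psi) => [|[i j] [i' j'] _ _ []]; last first.
    by rewrite /psi /= => /nat_rat_inj -> /addrI /nat_rat_inj ->.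
  apply: eq_fsbigr => -[i j] _; rewrite /psi /g /c /=.
  rewrite delta2_at; last exact: subpow10_2.
  rewrite exp1rz mul1r !pairE.
  have -> : e1 - (K%:~R + j%:R) = al - j%:R by rewrite e1E; ring.
  rewrite ratio_iterateE scalerA; congr (_ * _ *: YW (Y u _ v) _ w).
  - rewrite -(subpow_at _ (@fam10_inj _)); congr subpow.
    rewrite /X1 /X0 !pairE !add0r addr0; congr (_, _, _).
    by rewrite intrD PoszD intrD -!pmulrn; ring.
  - by rewrite natrD opprD addrA.
  - transitivity ((e2 : rat) - (- (K + (i + j)%N%:Z)%:~R - 1) + al); first by [].
    by rewrite e1E intrD PoszD intrD -!pmulrn natrD; ring.
rewrite (fsum_pair g0) (nsum_triangle g0); apply: eq_nsum => h.
rewrite -opprD bnN.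
have -> : e1 + 1 + h%:R - 1 = (K + h%:Z)%:~R + al by rewrite e1E intrD -pmulrn; ring.
rewrite -(bn_vandermonde T_inv charF _ (tint_intr T _) Tal) mulr_sumr scaler_suml.
apply: eq_bigr => -[i /= ih] _; have le_ih : (i <= h)%N by rewrite -ltnS.
by rewrite /g /c /X subnKC // mulrACA -exprD subnKC.
Qed.

End JacobiRight.

(** * Homogeneous series *)

Lemma subspaceP (F : fieldType) (U : lmodType F) (A : set U) :
  subspace A <-> A 0 /\ forall c u v, A u -> A v -> A (c *: u + v).
Proof.
split=> [[A0 Alin]|[A0 Alin]].
  split=> [|c u v Au Av]; first by move: A0; rewrite inE.
  by have := Alin c u v; rewrite !inE; apply.
by split=> [|c u v]; rewrite !inE //; exact: Alin.
Qed.

Section Subspaces.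
Context {F : fieldType} {U : lmodType F}.
Implicit Types (A B : set U).

Lemma subspace_sum A (I : Type) (s : seq I) (f : I -> U) :
  subspace A -> (forall i, A (f i)) -> A (\sum_(i <- s) f i).
Proof.
move=> /subspaceP[A0 Alin] Af; elim/big_ind: _ => // u v Au Av.
by rewrite -[u]scale1r; exact: Alin.
Qed.

Lemma subspaceZ A c u : subspace A -> A u -> A (c *: u).
Proof. by move=> /subspaceP[A0 Alin] Au; rewrite -[c *: u]addr0; exact: Alin. Qed.

Lemma subspaceB A u v : subspace A -> A u -> A v -> A (u - v).
Proof. by move=> /subspaceP[A0 Alin] Au Av; rewrite addrC -scaleN1r; exact: Alin. Qed.

Lemma subspaceD A u v : subspace A -> A u -> A v -> A (u + v).
Proof. by move=> /subspaceP[A0 Alin] Au Av; rewrite -[u]scale1r; exact: Alin. Qed.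

Lemma subspace_nsum A (f : nat -> U) : subspace A -> (forall i, A (f i)) -> A (nsum f).
Proof. by move=> Asub Af; apply: subspace_sum. Qed.

(** The linear span of a set. *)
Definition lspan A := smallest (@subspace F U) A.

Lemma lspan_subspace A : subspace (lspan A).
Proof.
apply/subspaceP; split=> [B [/subspaceP[B0 _] _] //|c u v Au Av B [Bsub AB]].
by have /subspaceP[_ Blin] := Bsub; apply: Blin; [exact: Au|exact: Av].
Qed.

Lemma sub_lspan A : A `<=` lspan A.
Proof. by move=> u Au B [_ AB]; exact: AB. Qed.

Lemma lspan_sub A B : subspace B -> A `<=` B -> lspan A `<=` B.
Proof. by move=> Bsub AB u; apply. Qed.

End Subspaces.

Lemma prim_exprz (F : fieldType) T (eta : F) (z : int) : T.-primitive_root eta ->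
  (eta ^ z == 1) = (T %| `|z|)%N.
Proof.
move=> prim; case: z => n; first by rewrite -(prim_order_dvd prim).
by rewrite /exprz invr_eq1 -(prim_order_dvd prim).
Qed.

Section Homogeneous.
Context {F : fieldType}.
Variables (T : nat) (eta : F).
Hypothesis T_gt0 : (0 < T)%N.
Hypothesis eta_prim : T.-primitive_root eta.
Context {W : lmodType F}.
Variable W_ : bool -> set W.
Implicit Types (a b : series W) (r s : nat) (al be : bool).

Local Notation deg r := ((r%:R / T%:R) : rat).

Let T0 : T%:R != 0 :> rat. Proof. by rewrite pnatr_eq0 -lt0n. Qed.

Lemma md_series a e : a e = md a (- e - 1).
Proof. by rewrite /md; congr a; ring. Qed.

Lemma md_inj a b : (forall q w, md a q w = md b q w) -> a = b.
Proof.
move=> ab; apply/funext => e; apply/funext => w.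
by rewrite (md_series a) (md_series b).
Qed.

Lemma field_mdP a : field (md a) <->
  (forall e, linear (a e)) /\ (forall w, truncated 0 (fun e => a e w)).
Proof.
split=> [[lin tr]|[lin tr]].
  split=> [e|w]; first by rewrite md_series.
  have [N aN] := tr w; exists (- N - 1) => e lte.
  by rewrite md_series aN //; move: lte; lra.
split=> [m|w]; first exact: lin.
have [N aN] := tr w; exists (- N - 1) => m ltm.
by rewrite /md aN //; move: ltm; lra.
Qed.

Lemma ET_field a : ET T a -> field (md a).
Proof. by move=> [[lin _] tr]; apply/field_mdP. Qed.

Lemma supp_mdP rho a : supp rho (md a) <-> forall e, a e != 0 -> e + rho \is a Num.int.
Proof.
split=> [sa e|sa m w Em].
  apply: contraR => Ee; apply/eqP/funext => w; rewrite md_series sa //.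
  apply: contra Ee => Ee; have -> : e + rho = - (- e - 1 - rho) - 1 by ring.
  by rewrite rpredB ?rpredN ?rpred1.
have [E0|/sa Ea] := eqVneq (a (- m - 1)) 0; first by rewrite /md E0.
case/negP: Em; have -> : m - rho = - (- m - 1 + rho) - 1 by ring.
by rewrite rpredB ?rpredN ?rpred1.
Qed.

(** The elements of degree [r] are the series with exponents in [- r/T + Z]. *)
Lemma gmap_suppP r a : opseries T a -> (r < T)%N ->
  gmap T eta a = eta ^+ r *: a <-> supp (deg r) (md a).
Proof.
move=> [alin aT] rT; have eta0 : eta != 0.
  apply/eqP => eta0; have := prim_expr_order eta_prim.
  by rewrite eta0 expr0n gtn_eqF // => /eqP; rewrite eq_sym oner_eq0.
have key e : a e != 0 -> (eta ^ (- Num.floor (T%:R * e)) == eta ^+ r) = (e + deg r \is a Num.int).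
  move=> /aT Te; set x := eta ^ Num.floor (T%:R * e).
  have x0 : x != 0 by exact: expfz_neq0.
  rewrite -invr_expz -/x -(inj_eq (mulfI x0)) divff // eq_sym.
  rewrite -[eta ^+ r]/(eta ^ r%:Z) /x -expfzDr // (prim_exprz _ eta_prim).
  set N := Num.floor _; have NE : T%:R * e = N%:~R by rewrite floorK.
  have eE : e + deg r = (N + r%:Z)%:~R / T%:R.
    by rewrite intrD -NE -pmulrn; field.
  rewrite eE; apply/idP/idP => [|/intrP[z Ez]].
    have -> : (T %| absz (N + r%:Z)%R)%N = (T%:Z %| N + r%:Z)%Z by rewrite dvdzE.
    case/dvdzP => z ->; rewrite rmorphM /= -pmulrn mulfK //; exact: intr_int.
  have : (N + r%:Z)%:~R = (z * T%:Z)%:~R :> rat by rewrite rmorphM /= -Ez -pmulrn divfK.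
  by move/int_rat_inj => ->; rewrite abszM dvdn_mull.
rewrite supp_mdP; split=> [ga e ae|sa].
  rewrite -key //; have : gmap T eta a e = (eta ^+ r *: a) e by rewrite ga.
  rewrite /gmap => E.
  have [w aw] : exists w, a e w != 0.
    apply: contrapT => /forallNP aw; case/eqP: ae; apply/funext => w.
    by apply/eqP; have /negP := aw w; rewrite negbK.
  have /eqP := congr1 (fun f => f w) E.
  by rewrite -subr_eq0 -scalerBl scaler_eq0 (negPf aw) orbF subr_eq0.
apply/funext => e; rewrite /gmap; have [ae|ae] := eqVneq (a e) 0.
  by rewrite ae scaler0; apply/funext => w; rewrite -[RHS]/(eta ^+ r *: (a e w)) ae scaler0.
have /eqP -> : eta ^ (- Num.floor (T%:R * e)) == eta ^+ r by rewrite key ?sa.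
by [].
Qed.

(** Homogeneity in terms of modes. *)
Lemma homogP r al a : homog T eta W_ r al a <->
  [/\ (r < T)%N, field (md a), supp (deg r) (md a) & op_parity W_ al a].
Proof.
split=> [[Ea rT ga pa]|[rT fa sa pa]].
  by split=> //; [exact: ET_field|apply/gmap_suppP => //; case: Ea].
have [lin tr] := (field_mdP a).1 fa.
have Ta : opseries T a.
  split=> // e /((supp_mdP _ _).1 sa) Ee.
  have -> : T%:R * e = T%:R * (e + deg r) - r%:R by field.
  by rewrite rpredB ?rpredM ?natr_int.
by split=> //; apply/gmap_suppP.
Qed.

Lemma graded_proj : graded W_ -> exists pr : bool -> W -> W,
  [/\ forall al, linear (pr al), forall al v, W_ al (pr al v),
      forall v, pr false v + pr true v = v &
      forall al be v, W_ be v -> pr al v = if al == be then v else 0].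
Proof.
move=> [sub dec disj].
have /choice[f fP] : forall v, exists x : W * W, [/\ W_ false x.1, W_ true x.2 & v = x.1 + x.2].
  by move=> v; have [v0 [v1 [? ? ?]]] := dec v; exists (v0, v1).
have uniq v x0 x1 : W_ false x0 -> W_ true x1 -> v = x0 + x1 -> (f v).1 = x0 /\ (f v).2 = x1.
  move=> Wx0 Wx1 vE; have [W0 W1 vE'] := fP v.
  have E : (f v).1 - x0 = x1 - (f v).2.
    by apply/eqP; rewrite subr_eq addrAC eq_sym subr_eq [x1 + x0]addrC -vE -vE'.
  have Z : (f v).1 - x0 = 0.
    by apply: disj; [exact: subspaceB|rewrite E; exact: subspaceB].
  by split; [exact: subr0_eq|apply/esym/subr0_eq; rewrite -E].
pose pr (al : bool) v := if al then (f v).2 else (f v).1.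
have prW al v : W_ al (pr al v) by rewrite /pr; case: al; have [] := fP v.
have prE v : pr false v + pr true v = v by rewrite /pr; have [_ _ <-] := fP v.
exists pr; split=> //.
- move=> al c u v.
  have E : c *: u + v = (c *: pr false u + pr false v) + (c *: pr true u + pr true v).
    by rewrite addrACA -scalerDr !prE.
  have W' be : W_ be (c *: pr be u + pr be v).
    by apply: subspaceD => //; apply: subspaceZ.
  by have [E0 E1] := uniq _ _ _ (W' false) (W' true) E; case: al.
- have W0 be : W_ be 0 by have /subspaceP[] := sub be.
  move=> al [] v Wv.
    by have [E0 E1] := uniq v 0 v (W0 false) Wv (esym (add0r v)); case: al.
  by have [E0 E1] := uniq v v 0 Wv (W0 true) (esym (addr0 v)); case: al.
Qed.

Variable pr : bool -> W -> W.
Hypothesis pr_lin : forall al, linear (pr al).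
Hypothesis pr_in : forall al v, W_ al (pr al v).
Hypothesis pr_sum : forall v, pr false v + pr true v = v.
Hypothesis pr_id : forall al be v, W_ be v -> pr al v = if al == be then v else 0.
Hypothesis W_sub : forall al, subspace (W_ al).

(** The component of parity [al] of a series, and its component of degree [r]
    and parity [al]; [pr al] is the projection of [W] onto [W_ al]. *)
Definition parc al a : series W := fun e w =>
  pr al (a e (pr false w)) + pr (~~ al) (a e (pr true w)).
Definition hcomp r al a : series W := fun e =>
  if e + deg r \is a Num.int then parc al a e else 0.

Lemma parc_linear al : linear (parc al).
Proof.
move=> c a b; apply/funext => e; apply/funext => w; rewrite /parc.
rewrite -[(c *: a + b) e (pr false w)]/(c *: (a e (pr false w)) + b e (pr false w)).
rewrite -[(c *: a + b) e (pr true w)]/(c *: (a e (pr true w)) + b e (pr true w)).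
by rewrite !pr_lin addrACA -scalerDr.
Qed.

Lemma hcomp_linear r al : linear (hcomp r al).
Proof.
move=> c a b; apply/funext => e; rewrite /hcomp parc_linear.
rewrite -[RHS]/(c *: (if _ then _ else _) + (if _ then _ else _)).
by case: ifP => // _; rewrite scaler0 addr0.
Qed.

Lemma parc_id al be a : field (md a) -> op_parity W_ be a ->
  parc al a = if al == be then a else 0.
Proof.
move=> fa pa; apply/funext => e; apply/funext => w; rewrite /parc.
have Wf := pa e _ _ (pr_in false w); have Wt := pa e _ _ (pr_in true w).
rewrite (pr_id _ Wf) (pr_id _ Wt) addbF addbT (inj_eq negb_inj).
case: eqP => _; last by rewrite addr0.
by rewrite (md_series a) -fieldD // pr_sum.
Qed.

Lemma hcomp_id r s al be a : (r < T)%N -> homog T eta W_ s be a ->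
  hcomp r al a = if (r == s) && (al == be) then a else 0.
Proof.
move=> rT /homogP[sT fa /supp_mdP sa pa]; apply/funext => e; rewrite /hcomp.
rewrite (parc_id _ fa pa); have [rs|rs] := eqVneq r s => /=.
  case: ifP => Er; first by case: ifP.
  case: ifP => // _; apply/esym/eqP; apply: contraFT Er => /sa.
  by rewrite rs.
case: ifP => // Er; case: ifP => // _; apply/eqP; apply: contraNT rs => /sa Es.
have /intrP[z Ez] : (r%:R - s%:R) / T%:R \is a @Num.int rat.
  have -> : (r%:R - s%:R) / T%:R = (e + deg r) - (e + deg s) :> rat by field.
  exact: rpredB.
have {}Ez : r%:Z - s%:Z = z * T%:Z.
  apply: int_rat_inj; rewrite rmorphB rmorphM /= -Ez -!pmulrn divfK //.
have z0 : z = 0 by nia.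
by apply/eqP; lia.
Qed.

End Homogeneous.

(** * Products of homogeneous series *)

Section Signs.
Context {F : fieldType}.
Implicit Types al be ga : bool.

Lemma sgn_sqr al be : sgn al be * sgn al be = 1 :> F.
Proof. by rewrite /sgn -expr2 sqrr_sign. Qed.

Lemma sgnC al be : sgn al be = sgn be al :> F.
Proof. by rewrite /sgn andbC. Qed.

Lemma sgnDr al be ga : sgn al (be (+) ga) = sgn al be * sgn al ga :> F.
Proof. by rewrite /sgn -signr_addb; case: al be ga => [] [] []. Qed.

Lemma sgnDl al be ga : sgn (al (+) be) ga = sgn al ga * sgn be ga :> F.
Proof. by rewrite !(sgnC _ ga) sgnDr. Qed.
End Signs.

Section Bilinearity.
Context {F : fieldType} {W : lmodType F}.
Variables T p : nat.
Hypothesis T_inv : T%:R != 0 :> F.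
Hypothesis charF : p \in [pchar F].
Implicit Types (a b c : rat -> W -> W).

Lemma loc_lincomb1 eps (k k' : nat) (d : F) a a' b : field a -> field a' -> field b ->
  loc eps k a b -> loc eps k' a' b ->
  loc eps (maxn k k') (fun m w => d *: a m w + a' m w) b.
Proof.
move=> fa fa' fb lab lab' w m n.
rewrite oprod_lincomb1 // oprod_lincomb2 // scalerDr scalerA [_ * d]mulrC -(scalerA d).
by rewrite (loc_le T_inv charF fa fb lab (leq_maxl _ _)) (loc_le T_inv charF fa' fb lab' (leq_maxr _ _)).
Qed.

Lemma rprod_lincomb1 rho eps (k k' : nat) (d : F) (n : int) a a' b q w :
  field a -> field a' -> field b -> loc eps k a b -> loc eps k' a' b ->
  rprod rho eps n (fun m w => d *: a m w + a' m w) b q w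
  = d *: rprod rho eps n a b q w + rprod rho eps n a' b q w.
Proof.
move=> fa fa' fb lab lab'; have f1 := bra_fin T_inv charF fa fb lab w (-1) 0.
have f2 := bra_fin T_inv charF fa' fb lab' w (-1) 0.
rewrite /rprod -(bpowZ _ _ _ _ f1) -(bpowD _ _ _ (finZ _ f1) f2).
by apply: eq_bpow => i; rewrite bra_lincomb1.
Qed.

Lemma rprod_lincomb2 rho eps (k k' : nat) (d : F) (n : int) a b b' q w :
  field a -> field b -> field b' -> loc eps k a b -> loc eps k' a b' ->
  rprod rho eps n a (fun m w => d *: b m w + b' m w) q w
  = d *: rprod rho eps n a b q w + rprod rho eps n a b' q w.
Proof.
move=> fa fb fb' lab lab'; have f1 := bra_fin T_inv charF fa fb lab w (-1) 0.
have f2 := bra_fin T_inv charF fa fb' lab' w (-1) 0.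
rewrite /rprod -(bpowZ _ _ _ _ f1) -(bpowD _ _ _ (finZ _ f1) f2).
by apply: eq_bpow => i; rewrite bra_lincomb2.
Qed.

End Bilinearity.

Section Products.
Context {F : fieldType}.
Variables (p T : nat) (eta : F).
Hypothesis T_gt0 : (0 < T)%N.
Hypothesis T_inv : T%:R != 0 :> F.
Hypothesis charF : p \in [pchar F].
Hypothesis eta_prim : T.-primitive_root eta.
Context {W : lmodType F}.
Variable W_ : bool -> set W.
Hypothesis W_sub : forall al, subspace (W_ al).
Implicit Types (a b c : series W) (r s t : nat) (al be ga : bool).

Local Notation deg r := ((r%:R / T%:R) : rat).
Local Notation fld a := (field (md a)).
Local Notation mloc := mutually_local.
Local Notation hom := (homog T eta W_).

Let T0 : T%:R != 0 :> rat. Proof. by rewrite pnatr_eq0 -lt0n. Qed.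

Lemma homog_field r al a : hom r al a -> fld a.
Proof. by case/(homogP T_gt0 eta_prim). Qed.

Lemma mloc_sym al be a b : mloc al be a b -> mloc be al b a.
Proof.
move=> /mutually_localP[k lab]; apply/mutually_localP; exists k; rewrite sgnC.
by apply: loc_sym => //; exact: sgn_sqr.
Qed.

Lemma mloc_lin1 al be (d : F) a a' b : fld a -> fld a' -> fld b ->
  mloc al be a b -> mloc al be a' b -> mloc al be (d *: a + a') b.
Proof.
move=> fa fa' fb /mutually_localP[k lab] /mutually_localP[k' lab'].
apply/mutually_localP; exists (maxn k k').
exact: (loc_lincomb1 T_inv charF d fa fa' fb lab lab').
Qed.

Lemma mloc_lin2 al be (d : F) a b b' : fld a -> fld b -> fld b' ->
  mloc al be a b -> mloc al be a b' -> mloc al be a (d *: b + b').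
Proof.
by move=> fa fb fb' lab lab'; apply/mloc_sym/mloc_lin1 => //; exact/mloc_sym.
Qed.

Lemma mloc_zero al be b : fld b -> mloc al be 0 b.
Proof.
move=> fb; apply/mutually_localP; exists 0%N => w m n.
rewrite /oprod !dpow0 expr0 mulr1 /two /=.
by rewrite [in RHS](_ : md 0 m w = 0) // field0 // scaler0.
Qed.

Lemma mloc_idser be b : fld b -> mloc false be (idser W) b.
Proof.
move=> fb; apply/mutually_localP; exists 0%N => w m n.
rewrite /oprod !dpow0 expr0 mulr1 /two /= /sgn /= expr0 scale1r /md /idser.
case: eqP => // _; by rewrite -[RHS]/(md b n 0) field0.
Qed.

Lemma nprod_lin1 r al be (d : F) n a a' b : fld a -> fld a' -> fld b ->
  mloc al be a b -> mloc al be a' b ->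
  nprod T r al be n (d *: a + a') b = d *: nprod T r al be n a b + nprod T r al be n a' b.
Proof.
move=> fa fa' fb /mutually_localP[k lab] /mutually_localP[k' lab'].
apply: md_inj => q w; rewrite -[RHS]/(d *: md (nprod T r al be n a b) q w + md (nprod T r al be n a' b) q w).
rewrite !nprodE //; last exact: (field_lincomb d fa fa').
exact: (rprod_lincomb1 T_inv charF _ d _ _ _ fa fa' fb lab lab').
Qed.

Lemma nprod_lin2 r al be (d : F) n a b b' : fld a -> fld b -> fld b' ->
  mloc al be a b -> mloc al be a b' ->
  nprod T r al be n a (d *: b + b') = d *: nprod T r al be n a b + nprod T r al be n a b'.
Proof.
move=> fa fb fb' /mutually_localP[k lab] /mutually_localP[k' lab'].
apply: md_inj => q w; rewrite -[RHS]/(d *: md (nprod T r al be n a b) q w + md (nprod T r al be n a b') q w).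
rewrite !nprodE //; last exact: (field_lincomb d fb fb').
exact: (rprod_lincomb2 T_inv charF _ d _ _ _ fa fb fb' lab lab').
Qed.

Lemma nprod_rprod r al be n a b : fld a -> fld b ->
  md (nprod T r al be n a b) = rprod (deg r) (sgn al be) n (md a) (md b).
Proof. by move=> fa fb; apply/funext => q; apply/funext => w; exact: nprodE. Qed.

Lemma nprod_field r al be n a b : fld a -> fld b -> mloc al be a b ->
  fld (nprod T r al be n a b).
Proof.
move=> fa fb /mutually_localP[k lab]; rewrite nprod_rprod //.
exact: (rprod_field T_inv charF fa fb lab n (tint_frac T_inv r)).
Qed.

Lemma nprod_parity r al be n a b : fld a -> fld b ->
  op_parity W_ al a -> op_parity W_ be b -> op_parity W_ (al (+) be) (nprod T r al be n a b).
Proof.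
move=> fa fb pa pb e ga w Ww; rewrite md_series nprodE // /rprod.
have sub := W_sub (al (+) be (+) ga).
apply: subspace_nsum => // i; apply: subspaceZ => //.
apply: subspaceB => //; last apply: subspaceZ => //.
  rewrite oprodE; apply: subspace_nsum => // j; apply: subspaceZ => //.
  by rewrite -addbA; apply/pa/pb.
rewrite oprodE; apply: subspace_nsum => // j; apply: subspaceZ => //.
by rewrite (addbC al) -addbA; apply/pb/pa.
Qed.

Lemma deg_add r s : exists z : int, deg r + deg s = deg ((r + s) %% T) + z%:~R.
Proof.
exists ((r + s) %/ T)%N%:Z; rewrite -mulrDl -natrD {1}(divn_eq (r + s) T) natrD natrM.
by rewrite mulrDl mulfK // addrC -pmulrn.
Qed.

Lemma nprod_homog r s al be n a b : hom r al a -> hom s be b -> mloc al be a b ->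
  hom ((r + s) %% T) (al (+) be) (nprod T r al be n a b).
Proof.
move=> /(homogP T_gt0 eta_prim)[rT fa sa pa] /(homogP T_gt0 eta_prim)[sT fb sb pb] lab.
apply/(homogP T_gt0 eta_prim); split.
- by rewrite ltn_mod.
- exact: nprod_field.
- rewrite nprod_rprod // => m w Em.
  apply: (@rprod_supp _ _ (deg r) (deg s)) => //.
  have [z ->] := deg_add r s; apply: contra Em => Em.
  have -> : m - deg ((r + s) %% T) = m - (deg ((r + s) %% T) + z%:~R) + z%:~R by ring.
  by rewrite rpredD ?intr_int.
- exact: nprod_parity.
Qed.

Lemma mloc_le al be a b k : fld a -> fld b -> loc (sgn al be) k (md a) (md b) ->
  forall k', (k <= k')%N -> loc (sgn al be) k' (md a) (md b).
Proof. by move=> fa fb lab k' kk'; exact: (loc_le T_inv charF fa fb lab kk'). Qed.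

(** A common order of locality for three series. *)
Lemma mloc3 al be ga a b c : fld a -> fld b -> fld c ->
  mloc al be a b -> mloc al ga a c -> mloc be ga b c ->
  exists k, [/\ loc (sgn al be) k (md a) (md b), loc (sgn al ga) k (md a) (md c) &
                loc (sgn be ga) k (md b) (md c)].
Proof.
move=> fa fb fc /mutually_localP[k1 l1] /mutually_localP[k2 l2] /mutually_localP[k3 l3].
exists (k1 + k2 + k3)%N; split.
- by apply: (mloc_le fa fb l1); rewrite -addnA leq_addr.
- by apply: (mloc_le fa fc l2); rewrite addnAC leq_addl.
- by apply: (mloc_le fb fc l3); rewrite leq_addl.
Qed.

(** Dong's lemma for series. *)
Lemma mloc_nprod r al be ga n a b c : fld a -> fld b -> fld c ->
  mloc al be a b -> mloc al ga a c -> mloc be ga b c ->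
  mloc (al (+) be) ga (nprod T r al be n a b) c.
Proof.
move=> fa fb fc lab lac lbc; have [k [l1 l2 l3]] := mloc3 fa fb fc lab lac lbc.
have rr : deg r - deg r \is a Num.int by rewrite subrr rpred0.
have [K lK] := loc_rprod T_inv charF fa fb fc l1 l2 l3 (tint_frac T_inv r) rr n.
by apply/mutually_localP; exists K; rewrite nprod_rprod // sgnDl.
Qed.

End Products.

(** * The Jacobi identity in terms of modes *)

Section JacobiModes.
Context {F : fieldType} (T p : nat).
Hypothesis T_inv : T%:R != 0 :> F.
Hypothesis charF : p \in [pchar F].

Lemma smul_ratio0 (W : lmodType F) (u : expo -> W) :
  smul (ratiopow X1 X0 X2 0) u = u.
Proof.
apply/funext => -[[e0 e1] e2]; rewrite smul_ratio (@nsumE _ _ 1) => [|[//|i] _]; last first.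
  by rewrite bn_eq0S mulr0 scale0r.
by rewrite big_ord1 expr0 bn0 mulr1 scale1r subr0 subr0 !addr0.
Qed.

(** The Jacobi identity amounts to a formula for the brackets at the modes
    [m] in [rho + Z] of [u]; at the other indices both sides vanish. *)
Lemma jacobi_modes (V W : lmodType F) (Y : V -> series V) (YW : V -> series W)
    (rho : rat) (al be : bool) (u v : V) (w : W) :
  (forall q w, YW 0 q w = 0) -> tint T rho ->
  field (md (YW u)) -> field (md (YW v)) -> supp rho (md (YW u)) ->
  (forall e : rat, e \isn't a Num.int -> Y u e v = 0) ->
  truncated 0 (fun e => Y u e v) ->
  (forall (l : int) (m n : rat), m - rho \is a Num.int ->
    bra (sgn al be) (md (YW u)) (md (YW v)) w (l, m, n)
    = nsum (fun i => bn m i *: md (YW (Y u (- (l + i%:Z)%:~R - 1) v)) (m + n - i%:R) w)) ->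
  forall e, jacobi_lhs al be (YW u) (YW v) w e
    = smul (delta 1 X2 X1 X0)
        (smul (ratiopow X1 X0 X2 (- rho)) (iterate Y YW u v w)) e.
Proof.
move=> YW0 Trho fu fv su Yout Ytr E [[e0 e1] e2].
have Tal : tint T (- rho) by exact: tintN.
have [/intrP[z Ez]|e0_int] := boolP (e0 \is a Num.int); last first.
  rewrite jacobi_lhs_out //; have [e1_int|e1_int] := boolP (e1 - - rho \is a Num.int); last first.
    by rewrite jacobi_rhs_out.
  rewrite (jacobi_rhsE T_inv charF) // nsum0 // => h; rewrite Yout ?YW0 ?scaler0 //.
  by apply: contraNN e0_int => /rpredD/(_ (natr_int _ h)); rewrite subrK.
have -> : e0 = - (- z - 1)%:~R - 1 by rewrite Ez rmorphB rmorphN /=; ring.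
set l : int := - z - 1; set m := - e1 - 1; set n := - e2 - 1.
have [-> ->] : e1 = - m - 1 /\ e2 = - n - 1 by rewrite /m /n; split; ring.
clearbody l m n => {Ez z e0 e1 e2}.
rewrite (jacobi_lhsE w al be l m n fu fv).
have Em : - m - 1 - - rho = - (m - rho + 1) by ring.
have [m_int|m_int] := boolP (m - rho \is a Num.int); last first.
  rewrite (bra_supp1 _ _ _ _ fv su m_int) jacobi_rhs_out // Em rpredN.
  by apply: contraNN m_int => /rpredB/(_ (rpred1 _)); rewrite addrK.
rewrite E // (jacobi_rhsE T_inv charF) //; last by rewrite Em rpredN rpredD ?rpred1.
apply: eq_nsum => h.
have -> : - (- m - 1) - 1 = m by ring.
have -> : - l%:~R - 1 - h%:R = - (l + h%:Z)%:~R - 1 :> rat by rewrite rmorphD /=; ring.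
rewrite /md; have -> : - (m + n - h%:R) - 1 = - n - 1 + (- m - 1) + 1 + h%:R by ring.
by [].
Qed.

End JacobiModes.

(** * Products with the identity *)

Section IdentityModes.
Context {F : fieldType} (T p : nat) {W : lmodType F}.
Hypothesis T_inv : T%:R != 0 :> F.
Hypothesis charF : p \in [pchar F].
Implicit Types (w : W) (l n : int) (q : rat).

Lemma md_idser (m : rat) w : md (idser W) m w = if m == -1 then w else 0.
Proof.
rewrite /md /idser; congr (if _ then _ else _).
by rewrite subr_eq0 eqr_oppLR.
Qed.

Lemma md_idser_field : field (md (idser W)).
Proof.
split=> [m c w w'|w]; first by rewrite !md_idser; case: ifP => // _; rewrite scaler0 addr0.
by exists 0 => m m0; rewrite md_idser ifF //; apply/eqP; lra.
Qed.

Lemma md_idser0 (m : rat) w : m != -1 -> md (idser W) m w = 0.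
Proof. by rewrite md_idser => /negPf ->. Qed.

Lemma nsum_only j (f : nat -> W) : (forall i, i != j -> f i = 0) -> nsum f = f j.
Proof.
move=> f0; rewrite (@nsumE _ _ j.+1) => [|i ji]; last by apply: f0; rewrite neq_ltn ji orbT.
by rewrite big_ord_recr big1 /= ?add0r // => i _; apply: f0; rewrite neq_ltn ltn_ord.
Qed.

Lemma oprod_id1 l b w (m n : rat) j : field b -> m + l%:~R = j%:R - 1 ->
  oprod l (md (idser W)) b w m n = ((-1) ^+ j * bn l%:~R j) *: b (n + j%:R) w.
Proof.
move=> fb Em; rewrite oprodE (@nsum_only j) => [|i ij].
  by rewrite Em addrAC subrr add0r md_idser eqxx.
rewrite md_idser0 ?scaler0 // Em; apply: contra ij => /eqP E.
by rewrite -(eqr_nat rat); apply/eqP; lra.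
Qed.

Lemma oprod_id1_out l b w (m n : rat) : field b -> (forall j, m + l%:~R != j%:R - 1) ->
  oprod l (md (idser W)) b w m n = 0.
Proof.
move=> fb Em; rewrite oprodE nsum0 // => i; rewrite md_idser0 ?scaler0 //.
by apply: contra (Em i) => /eqP E; apply/eqP; lra.
Qed.

Lemma oprod_id2 l a w (m n : rat) j : field a -> n = - 1 - j%:R ->
  oprod l a (md (idser W)) w m n = ((-1) ^+ j * bn l%:~R j) *: a (m + l%:~R - j%:R) w.
Proof.
move=> fa ->; rewrite oprodE (@nsum_only j) => [|i ij].
  by rewrite subrK md_idser eqxx.
rewrite md_idser0 ?field0 ?scaler0 //; apply: contra ij => /eqP E.
by rewrite -(eqr_nat rat); apply/eqP; lra.
Qed.

Lemma oprod_id2_out l a w (m n : rat) : field a -> (forall j, n != - 1 - j%:R) ->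
  oprod l a (md (idser W)) w m n = 0.
Proof.
move=> fa En; rewrite oprodE nsum0 // => i; rewrite md_idser0 ?field0 ?scaler0 //.
by apply: contra (En i) => /eqP E; apply/eqP; lra.
Qed.

Lemma loc_idser b : field b -> loc 1 0 (md (idser W)) b.
Proof.
move=> fb w m n; rewrite /oprod !dpow0 expr0 mulr1 scale1r /two !md_idser.
by case: eqP => // _; rewrite field0.
Qed.

Lemma bn_m1 j : bn (-1) j = (-1) ^+ j :> F.
Proof. by rewrite bnN [1 + _]addrC addrK bn_nat binn mulr1. Qed.

Lemma rprod_id1 n b q w : field b ->
  rprod 0 1 n (md (idser W)) b q w = if n == -1 then b q w else 0.
Proof.
move=> fb; have fid := md_idser_field; have [n0|n_lt0] := leP 0 n.
  rewrite (rprod_loc T_inv charF fid fb (loc_idser fb)) // ifF //.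
  by apply/eqP => En; move: n0; rewrite En.
rewrite rprodE (@nsum_only 0) => [|[//|i] _]; last by rewrite bn_eq0S mulr0 scale0r.
rewrite expr0 bn0 mulr1 scale1r addr0 !subr0 braE [X in _ - _ *: X]oprod_id2_out //; last first.
  by move=> j; apply/eqP; have := ler0n rat j; lra.
rewrite scaler0 subr0; have [->|n1] := eqVneq n (-1).
  by rewrite (@oprod_id1 _ _ _ _ _ 0) // ?expr0 ?bn0 ?mul1r ?scale1r ?addr0 // add0r sub0r.
rewrite oprod_id1_out // => j; rewrite add0r; apply/eqP => E.
have : (n + 1)%:~R = j%:Z%:~R :> rat by rewrite rmorphD /= E subrK.
by move/intr_inj; move: n_lt0 n1 => /= n_lt0 /eqP n1; lia.
Qed.

Lemma rprod_id2 rho n a q w : field a -> supp rho a -> 0 <= n + 1 ->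
  rprod rho 1 n a (md (idser W)) q w = if n == -1 then a q w else 0.
Proof.
move=> fa sa n1; have fid := md_idser_field.
have lid : loc 1 0 a (md (idser W)) by apply: loc_sym; [rewrite mulr1|exact: loc_idser].
have [n0|n_lt0] := leP 0 n.
  rewrite (rprod_loc T_inv charF fa fid lid) // ifF //.
  by apply/eqP => En; move: n0; rewrite En.
have -> : n = -1 by move: n1 n_lt0 => /= n1 n_lt0; lia.
rewrite eqxx rprodE (@nsum_only 0) => [|[//|i] _]; last first.
  by rewrite (bra_loc T_inv charF w _ _ fa fid lid) ?scaler0 //; lia.
rewrite expr0 bn0 mulr1 scale1r addr0 subr0 braE.
have sg (j : nat) : (-1) ^+ j * bn (-1)%:~R j = 1 :> F.
  by rewrite (_ : (-1)%:~R = -1) // bn_m1 -exprD addnn -muln2 exprM sqrr_sign.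
have [/intrP[z Ez]|q_int] := boolP (q - rho \is a Num.int); last first.
  rewrite sa // oprod_id2_out // ?oprod_id1_out ?scaler0 ?subr0 // => j; apply: contra q_int => /eqP E.
    have -> : q - rho = j%:R by move: E; lra.
    exact: natr_int.
  by rewrite E rpredB ?rpredN ?rpred1 ?natr_int.
have -> : (1 * (-1) ^ (-1) : F) = -1 by rewrite mul1r exprN1 invrN1.
rewrite Ez; case: z Ez => j Ez.
  rewrite oprod_id2_out // => [|i]; last first.
    by apply/eqP => E; have := ler0n rat i; have := ler0n rat j; move: E; rewrite /=; lra.
  rewrite (@oprod_id1 _ _ _ _ _ j) // sg scale1r sub0r scaleN1r opprK.
  by have -> : q = rho + j%:R by move: Ez => /=; lra.
have Ej : (Negz j)%:~R = -1 - j%:R :> rat by rewrite NegzE rmorphN /= -pmulrn -natr1; ring.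
rewrite (@oprod_id2 _ _ _ _ _ j) // sg scale1r oprod_id1_out // => [|i]; last first.
  by apply/eqP; rewrite Ej; have := ler0n rat i; have := ler0n rat j; lra.
rewrite scaler0 subr0; have -> : q = rho + (-1)%:~R - j%:R by move: Ez; rewrite Ej; lra.
by [].
Qed.

End IdentityModes.

(** * The space generated by a local subspace *)

Section Closure.
Context {F : fieldType}.
Variables (p T : nat) (eta : F).
Hypothesis T_gt0 : (0 < T)%N.
Hypothesis T_inv : T%:R != 0 :> F.
Hypothesis charF : p \in [pchar F].
Hypothesis eta_prim : T.-primitive_root eta.
Context {W : lmodType F}.
Variable W_ : bool -> set W.
Variable S : set (series W).
Hypothesis localS : local_subspace T eta W_ S.
Variable pr : bool -> W -> W.
Hypothesis pr_lin : forall al, linear (pr al).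
Hypothesis pr_in : forall al v, W_ al (pr al v).
Hypothesis pr_sum : forall v, pr false v + pr true v = v.
Hypothesis pr_id : forall al be v, W_ be v -> pr al v = if al == be then v else 0.
Hypothesis W_sub : forall al, subspace (W_ al).
Implicit Types (a b c : series W) (r s t : nat) (al be ga : bool).

Local Notation deg r := ((r%:R / T%:R) : rat).
Local Notation fld a := (field (md a)).
Local Notation mloc := mutually_local.
Local Notation hom := (homog T eta W_).
Local Notation cmp := (hcomp T pr).
Local Notation homP := (homogP T_gt0 eta_prim).

(** The homogeneous elements obtained from those of [S] and the identity by
    iterating the products. *)
Inductive hgen : nat -> bool -> series W -> Prop :=
| HgenId : hgen 0 false (idser W)
| HgenIn r al a : S a -> hom r al a -> hgen r al a
| HgenProd r s al be (n : int) a b : hgen r al a -> hgen s be b -> mloc al be a b ->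
    hgen ((r + s) %% T) (al (+) be) (nprod T r al be n a b).

Lemma homog_idser : hom 0 false (idser W).
Proof.
apply/homP; split=> //; first exact: md_idser_field.
- move=> m w Em; rewrite /md /idser ifF //; apply: contraNF Em => /eqP Em.
  by rewrite (_ : m - _ = -1) ?rpredN ?rpred1 // mul0r; lra.
- move=> e be w Ww; rewrite /idser addFb; case: ifP => // _.
  by have /subspaceP[] := W_sub be.
Qed.

Lemma hgen_homog r al a : hgen r al a -> hom r al a.
Proof.
elim=> [|//|{}r s {}al be n {}a b _ ha _ hb lab]; first exact: homog_idser.
exact: (nprod_homog T_gt0 T_inv charF eta_prim W_sub n ha hb lab).
Qed.

Lemma hgen_field r al a : hgen r al a -> fld a.
Proof. by move=> /hgen_homog/(homog_field T_gt0 eta_prim). Qed.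

Lemma hgen_mloc_gen r al a s be b : S b -> hom s be b -> hgen r al a -> mloc al be a b.
Proof.
move=> Sb hb; elim=> [|{}r {}al {}a Sa ha|{}r t {}al ga n {}a c ha lab hc lcb lac].
- apply: mloc_idser => //; exact: (homog_field T_gt0 eta_prim hb).
- by have [_ _ _ loc] := localS; exact: (loc _ _ _ _ _ _ Sa Sb ha hb).
- have fb := homog_field T_gt0 eta_prim hb.
  exact: (mloc_nprod T_inv charF _ n (hgen_field ha) (hgen_field hc) fb lac lab lcb).
Qed.

Lemma hgen_mloc r al a s be b : hgen r al a -> hgen s be b -> mloc al be a b.
Proof.
move=> ha hb; elim: hb => [|{}s {}be {}b Sb hb|{}s t {}be ga n {}b c hb lab hc lac lbc].
- by apply: mloc_sym; apply: mloc_idser => //; exact: hgen_field ha.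
- exact: hgen_mloc_gen Sb hb ha.
- have [fa fb fc] := And3 (hgen_field ha) (hgen_field hb) (hgen_field hc).
  have [lba lca] := (mloc_sym lab, mloc_sym lac).
  exact/mloc_sym/(mloc_nprod T_inv charF _ n fb fc fa lbc lba lca).
Qed.

(** The spans of the elements of [hgen] of given degree and parity, and of all
    of them. *)
Definition sph r al : set (series W) := lspan [set a | hgen r al a].
Definition sp : set (series W) := lspan [set a | exists r al, hgen r al a].

Lemma homog_subspace r al : (r < T)%N -> subspace (hom r al).
Proof.
move=> rT; apply/subspaceP; split.
  apply/homP; split=> //; first exact: field_zero.
  by move=> e be w _; have /subspaceP[] := W_sub (al (+) be).
move=> c a b /homP[_ fa sa pa] /homP[_ fb sb pb]; apply/homP; split=> //.
- exact: (field_lincomb c fa fb).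
- by move=> m w Em; rewrite -[md _ m w]/(c *: md a m w + md b m w) sa // sb // scaler0 addr0.
- move=> e be w Ww; have /subspaceP[_ lin] := W_sub (al (+) be).
  by apply: lin; [exact: pa|exact: pb].
Qed.

Lemma sph_homog r al a : (r < T)%N -> sph r al a -> hom r al a.
Proof.
by move=> rT; apply: lspan_sub; [exact: homog_subspace|move=> b; exact: hgen_homog].
Qed.

Lemma sph_sp r al a : sph r al a -> sp a.
Proof.
apply: lspan_sub; first exact: lspan_subspace.
by move=> b hb; apply: sub_lspan; exists r, al.
Qed.

Lemma fld_subspace : subspace [set a : series W | fld a].
Proof.
apply/subspaceP; split=> [|c a b fa fb]; first exact: field_zero.
exact: (field_lincomb c fa fb).
Qed.

Lemma sp_field a : sp a -> fld a.
Proof.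
move=> spa; suff: [set a : series W | fld a] a by [].
apply: lspan_sub spa; first exact: fld_subspace.
by move=> b [r [al hb]]; exact: hgen_field hb.
Qed.

(** Locality and closure under products extend to spans. *)
Lemma sph_hgen_prod r al a s be b (n : int) : (r < T)%N -> sph r al a -> hgen s be b ->
  mloc al be a b /\ sph ((r + s) %% T) (al (+) be) (nprod T r al be n a b).
Proof.
move=> rT sa hb; have fb := hgen_field hb.
pose P : set (series W) := [set a | [/\ fld a, mloc al be a b &
  sph ((r + s) %% T) (al (+) be) (nprod T r al be n a b)]].
suff: P a by case.
apply: lspan_sub sa; last first.
  move=> c hc; split; [exact: hgen_field hc|exact: hgen_mloc hc hb|].
  by apply: sub_lspan; apply: HgenProd => //; exact: hgen_mloc hc hb.
have /subspaceP[sp0 splin] : subspace (sph ((r + s) %% T) (al (+) be)).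
  exact: lspan_subspace.
apply/subspaceP; split=> [|d c c' [fc lc sc] [fc' lc' sc']].
  split; [exact: field_zero|exact: mloc_zero|].
  have -> : nprod T r al be n 0 b = 0; last by [].
  rewrite -[X in nprod _ _ _ _ _ X _](scaler0 _ (-1)) -[X in nprod _ _ _ _ _ X _]addr0.
  rewrite (nprod_lin1 T_inv charF); try exact: mloc_zero; try exact: field_zero; last by [].
  by rewrite scaleN1r addNr.
split; [exact: (field_lincomb d fc fc')|exact: (mloc_lin1 T_inv charF)|].
by rewrite (nprod_lin1 T_inv charF) //; exact: splin.
Qed.

Lemma sph_prod r al a s be b (n : int) : (r < T)%N -> (s < T)%N ->
  sph r al a -> sph s be b ->
  mloc al be a b /\ sph ((r + s) %% T) (al (+) be) (nprod T r al be n a b).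
Proof.
move=> rT sT sa sb; have fa := sp_field (sph_sp sa).
pose P : set (series W) := [set b | [/\ fld b, mloc al be a b &
  sph ((r + s) %% T) (al (+) be) (nprod T r al be n a b)]].
suff: P b by case.
apply: lspan_sub sb; last first.
  by move=> c hc; have [] := sph_hgen_prod n rT sa hc; split=> //; exact: hgen_field hc.
have /subspaceP[sp0 splin] : subspace (sph ((r + s) %% T) (al (+) be)).
  exact: lspan_subspace.
have l0 : mloc al be a 0 by apply: mloc_sym; exact: mloc_zero.
apply/subspaceP; split=> [|d c c' [fc lc sc] [fc' lc' sc']].
  split; [exact: field_zero|exact: l0|].
  have -> : nprod T r al be n a 0 = 0; last by [].
  rewrite -[X in nprod _ _ _ _ _ _ X](scaler0 _ (-1)) -[X in nprod _ _ _ _ _ _ X]addr0.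
  rewrite (nprod_lin2 T_inv charF) //; try exact: field_zero.
  by rewrite scaleN1r addNr.
split; [exact: (field_lincomb d fc fc')|exact: (mloc_lin2 T_inv charF)|].
by rewrite (nprod_lin2 T_inv charF) //; exact: splin.
Qed.

Lemma linear0 (U V : lmodType F) (h : U -> V) : linear h -> h 0 = 0.
Proof. by move=> hlin; apply: (addrI (h 0)); rewrite addr0; have := hlin 1 0 0; rewrite !scale1r addr0 => <-. Qed.

Lemma cmp_sph r al a : (r < T)%N -> sp a -> sph r al (cmp r al a).
Proof.
move=> rT spa; pose P : set (series W) := [set a | sph r al (cmp r al a)].
suff: P a by [].
have clin := hcomp_linear T pr_lin r al.
have /subspaceP[sp0 splin] : subspace (sph r al) by exact: lspan_subspace.
apply: lspan_sub spa.
  apply/subspaceP; split=> [|c b b' Pb Pb']; first by rewrite /P /= (linear0 clin).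
  by rewrite /P /= clin; exact: splin.
move=> b [s [be hb]]; rewrite /P /= (hcomp_id T_gt0 eta_prim pr_in pr_sum pr_id al rT (hgen_homog hb)).
by case: ifP => // /andP[/eqP-> /eqP->]; exact: sub_lspan.
Qed.

Lemma cmp_id r s al be a : (r < T)%N -> hom s be a ->
  cmp r al a = if (r == s) && (al == be) then a else 0.
Proof. exact: (hcomp_id T_gt0 eta_prim pr_in pr_sum pr_id). Qed.

(** The component of parity [al] of an element of [sp]. *)
Definition parcomp al a : series W := \sum_(r < T) cmp r al a.

Lemma parcomp_linear al : linear (parcomp al).
Proof.
move=> c a b; rewrite /parcomp scaler_sumr -big_split; apply: eq_bigr => r _.
exact: hcomp_linear.
Qed.

Lemma sum_ord_if (V : zmodType) s (v : V) : (s < T)%N ->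
  \sum_(r < T) (if (r : nat) == s then v else 0) = v.
Proof.
move=> sT; rewrite (bigD1 (Ordinal sT)) //= eqxx big1 ?addr0 // => r nrs.
by rewrite ifF //; apply: contraNF nrs => /eqP rs; apply/eqP/val_inj.
Qed.

Lemma parcomp_homog al s be a : hom s be a -> parcomp al a = if al == be then a else 0.
Proof.
move=> ha; have [sT _ _ _] := (homP _ _ _ _).1 ha.
rewrite -(sum_ord_if (if al == be then a else 0) sT); apply: eq_bigr => r _.
by rewrite (cmp_id _ _ ha) //; case: eqP.
Qed.

Lemma sp_decomp a : sp a -> a = parcomp false a + parcomp true a.
Proof.
move=> spa; pose P : set (series W) := [set a | a = parcomp false a + parcomp true a].
suff: P a by [].
apply: lspan_sub spa.
  apply/subspaceP; split=> [|c b b' Pb Pb'].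
    by rewrite /P /= !(linear0 (parcomp_linear _)) addr0.
  by rewrite /P /= !parcomp_linear addrACA -scalerDr -Pb -Pb'.
move=> b [s [be hb]]; rewrite /P /= !(parcomp_homog _ (hgen_homog hb)).
by case: be hb => hb; rewrite ?add0r ?addr0.
Qed.

Lemma parcomp_sp al a : sp a -> sp (parcomp al a).
Proof.
move=> spa; apply: (@subspace_sum _ _ sp); first exact: lspan_subspace.
by move=> r; exact: (sph_sp (cmp_sph (ltn_ord r) spa)).
Qed.

Lemma cmp_parity r al be a : fld a -> op_parity W_ be a -> al != be -> cmp r al a = 0.
Proof.
move=> fa pa /negPf ne; apply/funext => e; rewrite /hcomp.
by rewrite (parc_id pr_in pr_sum pr_id _ fa pa) ne; case: ifP.
Qed.

Lemma parcomp_id al be a : sp a -> op_parity W_ be a ->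
  parcomp al a = if al == be then a else 0.
Proof.
move=> spa pa; have out ga : ga != be -> parcomp ga a = 0.
  by move=> ne; apply: big1 => r _; exact: (cmp_parity _ (sp_field spa) pa).
case: eqP => [->|/eqP/out //]; rewrite [RHS](sp_decomp spa).
by case: (be) out => out; [rewrite (out false) ?add0r|rewrite (out true) ?addr0].
Qed.

Lemma parcomp_parity al a : sp a -> op_parity W_ al (parcomp al a).
Proof.
move=> spa e be w Ww; have sub := W_sub (al (+) be).
pose A := [set b : series W | forall e w, W_ be w -> W_ (al (+) be) (b e w)].
suff: A (parcomp al a) by apply.
apply: (@subspace_sum _ _ A) => [|r].
  apply/subspaceP; split=> [f v Wv|c b b' Pb Pb' f v Wv].
    by have /subspaceP[] := sub.
  by have /subspaceP[_ lin] := sub; apply: lin; [exact: Pb|exact: Pb'].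
have /sph_homog : sph r al (cmp r al a) by exact: cmp_sph.
by move=> /(_ (ltn_ord r))/homP[_ _ _ pa] f v Wv; exact: pa.
Qed.

(** Induction on the homogeneous components of an element of parity [al]. *)
Lemma sp_par_ind al (P : series W -> Prop) :
  P 0 -> (forall (d : F) a b, sp a -> sp b -> op_parity W_ al a -> op_parity W_ al b ->
    P a -> P b -> P (d *: a + b)) ->
  (forall r a, (r < T)%N -> sp a -> hom r al a -> P a) ->
  forall a, sp a -> op_parity W_ al a -> P a.
Proof.
move=> P0 Plin Phom a spa pa; have := parcomp_id al spa pa; rewrite eqxx => <-.
have hc r : (r < T)%N -> [/\ sp (cmp r al a), op_parity W_ al (cmp r al a) & P (cmp r al a)].
  move=> rT; have sa : sph r al (cmp r al a) by exact: cmp_sph.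
  have ha := sph_homog rT sa.
  split; [exact: sph_sp sa|by have [] := (homP _ _ _ _).1 ha|].
  exact: (Phom r _ rT (sph_sp sa) ha).
rewrite /parcomp; have [] : [/\ sp (\sum_(r < T) cmp r al a),
    op_parity W_ al (\sum_(r < T) cmp r al a) & P (\sum_(r < T) cmp r al a)]; last by [].
have /subspaceP[sp0 splin] : subspace sp by exact: lspan_subspace.
elim/big_ind: _ => [|u v [su pu Pu] [sv pv Pv]|r _]; last exact: hc.
  split=> // e be w _; by have /subspaceP[] := W_sub (al (+) be).
rewrite -[u]scale1r; split; [exact: splin| |exact: Plin].
move=> e be w Ww; have /subspaceP[_ lin] := W_sub (al (+) be).
by apply: lin; [exact: pu|exact: pv].
Qed.

(** Induction on the homogeneous components. *)
Lemma sp_ind (P : series W -> Prop) :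
  P 0 -> (forall (d : F) a b, sp a -> sp b -> P a -> P b -> P (d *: a + b)) ->
  (forall r al a, (r < T)%N -> sp a -> hom r al a -> P a) -> forall a, sp a -> P a.
Proof.
move=> P0 Plin Phom a spa; rewrite (sp_decomp spa) -[parcomp false a]scale1r.
have Ppar al : P (parcomp al a).
  apply: (@sp_par_ind al) => //; [|by move=> r; exact: Phom|exact: parcomp_sp|exact: parcomp_parity].
  by move=> d b b' sb sb' _ _ Pb Pb'; apply: (Plin).
by apply: (Plin); rewrite ?Ppar //; exact: parcomp_sp.
Qed.

Lemma sp_sph r al a : hom r al a -> sp a -> sph r al a.
Proof.
move=> ha spa; have [rT _ _ _] := (homP _ _ _ _).1 ha.
have : sph r al (cmp r al a) by exact: cmp_sph.
by rewrite (cmp_id _ rT ha) !eqxx.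
Qed.

Lemma sp_mloc r s al be a b : sp a -> sp b -> hom r al a -> hom s be b -> mloc al be a b.
Proof.
move=> spa spb ha hb; have [rT _ _ _] := (homP _ _ _ _).1 ha.
have [sT _ _ _] := (homP _ _ _ _).1 hb.
by have [] := sph_prod 0 rT sT (sp_sph ha spa) (sp_sph hb spb).
Qed.

Lemma sp_nprod r s al be n a b : sp a -> sp b -> hom r al a -> hom s be b ->
  sp (nprod T r al be n a b).
Proof.
move=> spa spb ha hb; have [rT _ _ _] := (homP _ _ _ _).1 ha.
have [sT _ _ _] := (homP _ _ _ _).1 hb.
by have [_ /sph_sp] := sph_prod n rT sT (sp_sph ha spa) (sp_sph hb spb).
Qed.

Lemma sp_mloc_par al be a b : sp a -> sp b -> op_parity W_ al a -> op_parity W_ be b ->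
  mloc al be a b.
Proof.
move=> spa spb pa; move: b spb; apply: sp_par_ind.
- exact/mloc_sym/mloc_zero/sp_field.
- by move=> c b b' sb sb' _ _ lb lb'; apply: (mloc_lin2 T_inv charF) => //; exact: sp_field.
move=> s b sT spb hb; move: a spa pa; apply: sp_par_ind.
- exact/mloc_zero/sp_field.
- by move=> c a a' sa sa' _ _ la la'; apply: (mloc_lin1 T_inv charF) => //; exact: sp_field.
by move=> r a rT spa ha; exact: (sp_mloc spa spb ha hb).
Qed.

Lemma ET_subspace : subspace (@ET F T W).
Proof.
apply/subspaceP; split.
  split; last by move=> w; exists 0.
  split=> [e c u v|e]; last by rewrite eqxx.
  by rewrite -[RHS]/(c *: 0 + 0) scaler0 addr0.
move=> c a b [[alin aT] atr] [[blin bT] btr].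
have [|lin tr] := (field_mdP (c *: a + b)).1; first by apply: field_lincomb; apply/field_mdP.
split=> //; split=> // e; have [a0|/aT //] := eqVneq (a e) 0.
have [b0|/bT //] := eqVneq (b e) 0.
by rewrite -[(c *: a + b) e]/(c *: a e + b e) a0 b0 scaler0 addr0 eqxx.
Qed.

Lemma hom_ET r al a : hom r al a -> ET T a.
Proof. by case. Qed.

Lemma sp_ET : sp `<=` @ET F T W.
Proof.
apply: lspan_sub; first exact: ET_subspace.
by move=> a [r [al /hgen_homog/hom_ET]].
Qed.

(** The space generated by [S] is the linear span of the iterated products of
    homogeneous elements. *)
Lemma gen_sp : gen T eta W_ S = sp.
Proof.
apply/seteqP; split=> [a|].
  apply; split; first split.
  - exact: sp_ET.
  - exact: lspan_subspace.
  - by apply: sub_lspan; exists 0%N, false; exact: HgenId.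
  - by move=> r s al be b c n sb sc hb hc _; exact: (sp_nprod n sb sc hb hc).
  have [_ _ SE _] := localS; rewrite {1}SE; apply: lspan_sub; first exact: lspan_subspace.
  by move=> b [Sb [r [al hb]]]; apply: sub_lspan; exists r, al; exact: HgenIn.
apply: lspan_sub.
  apply/subspaceP; split=> [U [[_ /subspaceP[] //]]|c a b ga gb U US].
  by have [[_ /subspaceP[_ Ulin] _ _] _] := US; apply: Ulin; [exact: ga|exact: gb].
move=> a [r [al ha]] U [[UT Usub Uid Uprod] SU].
elim: ha => [//|{}r {}al {}a Sa _|{}r s {}al be n {}a b ha Ua hb Ub lab]; first exact: SU.
exact: (Uprod _ _ _ _ _ _ n Ua Ub (hgen_homog ha) (hgen_homog hb) lab).
Qed.

Lemma gen_local : local_subspace T eta W_ (gen T eta W_ S).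
Proof.
rewrite gen_sp; split; [exact: sp_ET|exact: lspan_subspace| |].
  apply/seteqP; split; last by apply: lspan_sub; [exact: lspan_subspace|move=> a []].
  apply: lspan_sub; first exact: lspan_subspace.
  move=> a [r [al ha]]; apply: sub_lspan; split; last by exists r, al; exact: hgen_homog.
  by apply: sub_lspan; exists r, al.
by move=> r s al be a b sa sb ha hb; exact: (sp_mloc sa sb ha hb).
Qed.

(** * The vertex superalgebra and its twisted module *)

Lemma nprod_zero1 r al be n b : fld b -> nprod T r al be n 0 b = 0.
Proof.
move=> fb; have f0 : fld (0 : series W) by exact: field_zero.
have l0 := mloc_zero al be fb.
have := nprod_lin1 T_inv charF r 1 n f0 f0 fb l0 l0; rewrite scaler0 addr0 scale1r => E.
by apply: (addrI (nprod T r al be n 0 b)); rewrite -E addr0.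
Qed.

Lemma nprod_zero2 r al be n a : fld a -> nprod T r al be n a 0 = 0.
Proof.
move=> fa; have f0 : fld (0 : series W) by exact: field_zero.
have l0 := mloc_sym (mloc_zero be al fa).
have := nprod_lin2 T_inv charF r 1 n fa f0 f0 l0 l0; rewrite scaler0 addr0 scale1r => E.
by apply: (addrI (nprod T r al be n a 0)); rewrite -E addr0.
Qed.

(** The bilinear extension of the products: the coefficient of [x0^e] in
    [Y(a(x), x0) b(x)]. *)
Definition prodV (e : rat) a b : series W :=
  if e \is a Num.int then
    \sum_(i : 'I_T * bool) \sum_(j : 'I_T * bool)
      nprod T i.1 i.2 j.2 (- Num.floor e - 1) (cmp i.1 i.2 a) (cmp j.1 j.2 b)
  else 0.

Lemma prodV_int (n : int) a b : prodV (- n%:~R - 1) a b =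
  \sum_(i : 'I_T * bool) \sum_(j : 'I_T * bool)
      nprod T i.1 i.2 j.2 n (cmp i.1 i.2 a) (cmp j.1 j.2 b).
Proof.
have E : - n%:~R - 1 = (- n - 1)%:~R :> rat by rewrite rmorphB rmorphN.
have K : - Num.floor ((- n - 1)%:~R : rat) - 1 = n by rewrite (@intrKfloor rat); ring.
by rewrite /prodV E (@intr_int rat) K.
Qed.

Lemma prodV_out (e : rat) a b : e \isn't a Num.int -> prodV e a b = 0.
Proof. by rewrite /prodV => /negPf ->. Qed.

Lemma int_mode (e : rat) : e \is a Num.int -> exists n : int, e = - n%:~R - 1.
Proof.
move=> /intrP[z ->]; exists (- z - 1); rewrite rmorphB rmorphN /=; ring.
Qed.

Lemma cmp_sp r al a : (r < T)%N -> sp a -> sp (cmp r al a).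
Proof. by move=> rT spa; exact: (sph_sp (cmp_sph rT spa)). Qed.

Lemma cmp_homog r al a : (r < T)%N -> sp a -> hom r al (cmp r al a).
Proof. by move=> rT spa; apply: (sph_homog rT); exact: cmp_sph. Qed.

Lemma sp_sub : subspace sp. Proof. exact: lspan_subspace. Qed.
Lemma sp0 : sp 0. Proof. by have /subspaceP[] := sp_sub. Qed.
Lemma sp_lin (d : F) a b : sp a -> sp b -> sp (d *: a + b).
Proof. by have /subspaceP[_] := sp_sub; exact. Qed.

Lemma prodV_sp e a b : sp a -> sp b -> sp (prodV e a b).
Proof.
move=> spa spb; rewrite /prodV; case: ifP => _; last exact: sp0.
apply: (@subspace_sum _ _ sp) => [|i]; first exact: sp_sub.
apply: (@subspace_sum _ _ sp) => [|j]; first exact: sp_sub.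
have [iT jT] := (ltn_ord i.1, ltn_ord j.1).
by apply: (sp_nprod _ _ _ (cmp_homog i.2 iT spa) (cmp_homog j.2 jT spb)); exact: cmp_sp.
Qed.

Lemma cmp_facts r s al be a b : (r < T)%N -> (s < T)%N -> sp a -> sp b ->
  [/\ fld (cmp r al a), fld (cmp s be b) & mloc al be (cmp r al a) (cmp s be b)].
Proof.
move=> rT sT spa spb; have sa := cmp_sp al rT spa; have sb := cmp_sp be sT spb.
split; [exact: sp_field|exact: sp_field|].
exact: (sp_mloc sa sb (cmp_homog al rT spa) (cmp_homog be sT spb)).
Qed.

Lemma prodV_lin1 e (d : F) a a' b : sp a -> sp a' -> sp b ->
  prodV e (d *: a + a') b = d *: prodV e a b + prodV e a' b.
Proof.
move=> sa sa' sb; rewrite /prodV; case: ifP => _; last by rewrite scaler0 addr0.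
rewrite scaler_sumr -big_split; apply: eq_bigr => i _.
rewrite scaler_sumr -big_split; apply: eq_bigr => j _.
have [iT jT] := (ltn_ord i.1, ltn_ord j.1).
have [f1 f2 l1] := cmp_facts i.2 j.2 iT jT sa sb.
have [f1' _ l1'] := cmp_facts i.2 j.2 iT jT sa' sb.
by rewrite hcomp_linear //; exact: (nprod_lin1 T_inv charF).
Qed.

Lemma prodV_lin2 e (d : F) a b b' : sp a -> sp b -> sp b' ->
  prodV e a (d *: b + b') = d *: prodV e a b + prodV e a b'.
Proof.
move=> sa sb sb'; rewrite /prodV; case: ifP => _; last by rewrite scaler0 addr0.
rewrite scaler_sumr -big_split; apply: eq_bigr => i _.
rewrite scaler_sumr -big_split; apply: eq_bigr => j _.
have [iT jT] := (ltn_ord i.1, ltn_ord j.1).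
have [f1 f2 l1] := cmp_facts i.2 j.2 iT jT sa sb.
have [_ f2' l1'] := cmp_facts i.2 j.2 iT jT sa sb'.
by rewrite hcomp_linear //; exact: (nprod_lin2 T_inv charF).
Qed.

Lemma prodV_hom r s al be n a b : sp a -> sp b -> hom r al a -> hom s be b ->
  prodV (- n%:~R - 1) a b = nprod T r al be n a b.
Proof.
move=> spa spb ha hb; rewrite prodV_int.
have [rT _ _ _] := (homP _ _ _ _).1 ha; have [sT _ _ _] := (homP _ _ _ _).1 hb.
have out (i : 'I_T * bool) (t : nat) (ga : bool) (tT : (t < T)%N) c : hom t ga c ->
    i != (Ordinal tT, ga) -> cmp i.1 i.2 c = 0.
  move=> hc ne; rewrite (cmp_id _ _ hc) // ifF //; apply: contraNF ne => /andP[/eqP Et /eqP Eg].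
  by case: i Et Eg => i1 i2 /= Et ->; apply/eqP; congr (_, _); exact: val_inj.
rewrite (bigD1 (Ordinal rT, al)) //= [X in _ + X]big1 ?addr0; last first.
  move=> i /(out _ _ _ _ _ ha) ->; apply: big1 => j _; apply: nprod_zero1.
  by apply: sp_field; apply: cmp_sp => //; exact: ltn_ord.
rewrite (bigD1 (Ordinal sT, be)) //= [X in _ + X]big1 ?addr0; last first.
  move=> j /(out _ _ _ _ _ hb) ->; apply: nprod_zero2.
  by apply: sp_field; exact: cmp_sp.
by rewrite (cmp_id _ rT ha) (cmp_id _ sT hb) !eqxx.
Qed.

Lemma prodV_zero1 e b : sp b -> prodV e 0 b = 0.
Proof.
move=> spb; have := prodV_lin1 e 1 sp0 sp0 spb; rewrite scaler0 addr0 scale1r => E.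
by apply: (addrI (prodV e 0 b)); rewrite -E addr0.
Qed.

Lemma prodV_zero2 e a : sp a -> prodV e a 0 = 0.
Proof.
move=> spa; have := prodV_lin2 e 1 spa sp0 sp0; rewrite scaler0 addr0 scale1r => E.
by apply: (addrI (prodV e a 0)); rewrite -E addr0.
Qed.

(** The second factor need not be homogeneous for the degree. *)
Lemma prodV_par r al be n a b : sp a -> hom r al a -> sp b -> op_parity W_ be b ->
  prodV (- n%:~R - 1) a b = nprod T r al be n a b.
Proof.
move=> spa ha; have [_ fa _ pa] := (homP _ _ _ _).1 ha.
move: b; apply: sp_par_ind; first by rewrite prodV_zero2 // nprod_zero2.
  move=> d b b' sb sb' pb pb' E E'; rewrite prodV_lin2 // E E'.
  have [lb lb'] := (sp_mloc_par spa sb pa pb, sp_mloc_par spa sb' pa pb').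
  by rewrite (nprod_lin2 T_inv charF r d n fa (sp_field sb) (sp_field sb') lb lb').
by move=> s b sT sb hb; exact: (prodV_hom n spa sb ha hb).
Qed.

Lemma prodV_parity e al be a b : sp a -> op_parity W_ al a -> sp b -> op_parity W_ be b ->
  op_parity W_ (al (+) be) (prodV e a b).
Proof.
have zero : op_parity W_ (al (+) be) 0.
  by move=> e' ga w _; have /subspaceP[] := W_sub (al (+) be (+) ga).
have [/int_mode[n ->]|/negP e_int] := boolP (e \is a Num.int); last by rewrite prodV_out //; apply/negP.
move=> spa pa spb pb; move: a spa pa; apply: sp_par_ind; first by rewrite prodV_zero1.
  move=> d a a' sa sa' _ _ pa pa'; rewrite prodV_lin1 // => e' ga w Ww.
  have /subspaceP[_ lin] := W_sub (al (+) be (+) ga).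
  by apply: lin; [exact: pa|exact: pa'].
move=> r a rT sa ha; rewrite (prodV_par n sa ha spb pb).
have [_ fa _ pa] := (homP _ _ _ _).1 ha.
exact: (nprod_parity _ W_sub _ _ fa (sp_field spb) pa pb).
Qed.

Lemma prodV_trunc a b : sp a -> sp b -> truncated 0 (fun e => prodV e a b).
Proof.
move=> spa spb; move: a spa; apply: sp_ind.
- by exists 0 => e _; exact: prodV_zero1.
- move=> d a a' sa sa' [N aN] [N' aN']; exists (Num.min N N') => e; rewrite lt_min => /andP[eN eN'].
  by rewrite prodV_lin1 // aN // aN' // scaler0 addr0.
move=> r al a rT sa ha; move: b spb; apply: sp_ind.
- by exists 0 => e _; exact: prodV_zero2.
- move=> d b b' sb sb' [N bN] [N' bN']; exists (Num.min N N') => e; rewrite lt_min => /andP[eN eN'].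
  by rewrite prodV_lin2 // bN // bN' // scaler0 addr0.
move=> s be b sT sb hb; have /mutually_localP[k lab] := sp_mloc sa sb ha hb.
exists (- k%:R) => e lte; have [/int_mode[n En]|] := boolP (e \is a Num.int); last exact: prodV_out.
rewrite En (prodV_hom n sa sb ha hb).
have [fa fb] := (sp_field sa, sp_field sb).
apply: md_inj => q w; rewrite nprodE // (rprod_loc T_inv charF fa fb lab) //.
have : k%:R < (n + 1)%:~R :> rat by rewrite rmorphD /=; move: lte; rewrite En; lra.
by rewrite -[k%:R]/(k%:Z%:~R) ltr_int; lia.
Qed.

Local Notation ix n := (- n%:~R - 1 : rat).

(** The difference of the two sides of the Borcherds identity, with the sums cut
    at [N]: a form which is linear in each series, and which has to vanish for
    [N] large. *)
Definition bor (N : nat) (l m n : int) (k : F) a b c : series W :=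
  \sum_(i < N) ((-1) ^+ i * bn l%:~R i) *:
     prodV (ix (m + l - i%:Z)) a (prodV (ix (n + i%:Z)) b c)
  - k *: (\sum_(i < N) ((-1) ^+ i * bn l%:~R i) *:
     prodV (ix (n + l - i%:Z)) b (prodV (ix (m + i%:Z)) a c))
  - \sum_(i < N) bn m%:~R i *: prodV (ix (m + n - i%:Z)) (prodV (ix (l + i%:Z)) a b) c.

Lemma scale_lincomb (U : lmodType F) (d k : F) (u v : U) :
  k *: (d *: u + v) = d *: (k *: u) + k *: v.
Proof. by rewrite scalerDr !scalerA mulrC. Qed.

Lemma lincomb3 (U : lmodType F) (d k : F) (x y z x' y' z' : U) :
  d *: x + x' - k *: (d *: y + y') - (d *: z + z')
  = d *: (x - k *: y - z) + (x' - k *: y' - z').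
Proof.
rewrite !scalerBr [k *: (_ + _)]scalerDr !opprD !scalerA [k * d]mulrC.
by rewrite [d *: x + x' + _]addrACA [LHS]addrACA.
Qed.

Lemma bor_lin1 N l m n k (d : F) a a' b c : sp a -> sp a' -> sp b -> sp c ->
  bor N l m n k (d *: a + a') b c = d *: bor N l m n k a b c + bor N l m n k a' b c.
Proof.
move=> sa sa' sb sc; rewrite /bor -lincomb3; congr (_ - k *: _ - _).
- rewrite scaler_sumr -big_split; apply: eq_bigr => i _.
  by rewrite prodV_lin1 ?scale_lincomb //; exact: prodV_sp.
- rewrite scaler_sumr -big_split; apply: eq_bigr => i _.
  by rewrite prodV_lin1 // prodV_lin2 ?scale_lincomb //; exact: prodV_sp.
- rewrite scaler_sumr -big_split; apply: eq_bigr => i _.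
  by rewrite [prodV _ _ b]prodV_lin1 // prodV_lin1 ?scale_lincomb //; exact: prodV_sp.
Qed.

Lemma bor_lin2 N l m n k (d : F) a b b' c : sp a -> sp b -> sp b' -> sp c ->
  bor N l m n k a (d *: b + b') c = d *: bor N l m n k a b c + bor N l m n k a b' c.
Proof.
move=> sa sb sb' sc; rewrite /bor -lincomb3; congr (_ - k *: _ - _).
- rewrite scaler_sumr -big_split; apply: eq_bigr => i _.
  by rewrite prodV_lin1 // prodV_lin2 ?scale_lincomb //; exact: prodV_sp.
- rewrite scaler_sumr -big_split; apply: eq_bigr => i _.
  by rewrite prodV_lin1 ?scale_lincomb //; exact: prodV_sp.
- rewrite scaler_sumr -big_split; apply: eq_bigr => i _.
  by rewrite [prodV _ a _]prodV_lin2 // prodV_lin1 ?scale_lincomb //; exact: prodV_sp.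
Qed.

Lemma bor_lin3 N l m n k (d : F) a b c c' : sp a -> sp b -> sp c -> sp c' ->
  bor N l m n k a b (d *: c + c') = d *: bor N l m n k a b c + bor N l m n k a b c'.
Proof.
move=> sa sb sc sc'; rewrite /bor -lincomb3; congr (_ - k *: _ - _).
- rewrite scaler_sumr -big_split; apply: eq_bigr => i _.
  by rewrite [prodV _ b _]prodV_lin2 // prodV_lin2 ?scale_lincomb //; exact: prodV_sp.
- rewrite scaler_sumr -big_split; apply: eq_bigr => i _.
  by rewrite [prodV _ a _]prodV_lin2 // prodV_lin2 ?scale_lincomb //; exact: prodV_sp.
- rewrite scaler_sumr -big_split; apply: eq_bigr => i _.
  by rewrite prodV_lin2 ?scale_lincomb //; exact: prodV_sp.
Qed.

Lemma prodV_bound a b (x : int) : sp a -> sp b ->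
  exists N : nat, forall i : nat, (N <= i)%N -> prodV (ix (x + i%:Z)) a b = 0.
Proof.
move=> sa sb; have [M ltM] := prodV_trunc sa sb; have [N ltN] := rat_lt_nat (- x%:~R - M).
exists N => i; rewrite -(ler_nat rat) => Ni; apply: ltM.
rewrite rmorphD /= -[i%:Z%:~R]/(i%:R); lra.
Qed.

Lemma bor_hom l m n r s t al be ga a b c : sp a -> sp b -> sp c ->
  hom r al a -> hom s be b -> hom t ga c ->
  exists N0 : nat, forall N, (N0 <= N)%N -> bor N l m n (sgn al be * (-1) ^ l) a b c = 0.
Proof.
move=> sa sb sc ha hb hc.
have [N1 bc0] := prodV_bound n sb sc; have [N2 ac0] := prodV_bound m sa sc.
have [N3 ab0] := prodV_bound l sa sb.
exists (N1 + N2 + N3)%N => N ltN.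
have {N1 ltN bc0} [{}bc0 {}ac0 {}ab0] : [/\ forall i : nat, (N <= i)%N -> prodV (ix (n + i%:Z)) b c = 0,
    forall i : nat, (N <= i)%N -> prodV (ix (m + i%:Z)) a c = 0 &
    forall i : nat, (N <= i)%N -> prodV (ix (l + i%:Z)) a b = 0].
  split=> i Ni; [apply: bc0|apply: ac0|apply: ab0]; apply: leq_trans Ni;
  apply: leq_trans ltN; [by rewrite -addnA leq_addr|by rewrite addnAC leq_addl|by rewrite leq_addl].
have [fa fb fc] := And3 (sp_field sa) (sp_field sb) (sp_field sc).
have [lab lac lbc] := And3 (sp_mloc sa sb ha hb) (sp_mloc sa sc ha hc) (sp_mloc sb sc hb hc).
have [k [kab kac kbc]] := mloc3 T_inv charF fa fb fc lab lac lbc.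
have [z Ez] := deg_add T_gt0 r s.
have z_int : deg r + deg s - deg ((r + s) %% T) \is a Num.int by rewrite Ez addrC addKr intr_int.
have hab i := nprod_homog T_gt0 T_inv charF eta_prim W_sub i ha hb lab.
have hbc i := nprod_homog T_gt0 T_inv charF eta_prim W_sub i hb hc lbc.
have hac i := nprod_homog T_gt0 T_inv charF eta_prim W_sub i ha hc lac.
have Eab i : md (nprod T r al be i a b) = rprod (deg r) (sgn al be) i (md a) (md b).
  by apply/funext => q; apply/funext => w; exact: nprodE.
have Ebc i : md (nprod T s be ga i b c) = rprod (deg s) (sgn be ga) i (md b) (md c).
  by apply/funext => q; apply/funext => w; exact: nprodE.
have Eac i : md (nprod T r al ga i a c) = rprod (deg r) (sgn al ga) i (md a) (md c).
  by apply/funext => q; apply/funext => w; exact: nprodE.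
have sab i := sp_nprod i sa sb ha hb; have sbc i := sp_nprod i sb sc hb hc.
have sac i := sp_nprod i sa sc ha hc.
apply: md_inj => q w.
have conv (f : nat -> F) (x : nat -> series W) (y : nat -> W) :
    (forall i, (N <= i)%N -> x i = 0) -> (forall i, md (x i) q w = y i) ->
    md (\sum_(i < N) f i *: x i) q w = nsum (fun i => f i *: y i).
  move=> x0 xy; rewrite (@nsumE _ _ N) => [|i /x0 xi]; last by rewrite -xy xi /md scaler0.
  transitivity (\sum_(i < N) f i *: md (x i) q w); last by apply: eq_bigr => i _; rewrite xy.
  by rewrite /md; elim/big_ind2: _ => // u u' v v' <- <-.
have B := rprod_borcherds T_inv charF fa fb fc kab kac kbc (sgn_sqr _ _) (sgn_sqr _ _)
  (sgn_sqr _ _) (tint_frac T_inv r) (tint_frac T_inv s) l m n q w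
  (tint_frac T_inv ((r + s) %% T)) z_int.
have E1 := conv (fun i => (-1) ^+ i * bn l%:~R i)
  (fun i => prodV (ix (m + l - i%:Z)) a (prodV (ix (n + i%:Z)) b c))
  (fun i => rprod (deg r) (sgn al be * sgn al ga) (m + l - i%:Z) (md a)
    (rprod (deg s) (sgn be ga) (n + i%:Z) (md b) (md c)) q w).
have E2 := conv (fun i => (-1) ^+ i * bn l%:~R i)
  (fun i => prodV (ix (n + l - i%:Z)) b (prodV (ix (m + i%:Z)) a c))
  (fun i => rprod (deg s) (sgn al be * sgn be ga) (n + l - i%:Z) (md b)
    (rprod (deg r) (sgn al ga) (m + i%:Z) (md a) (md c)) q w).
have E3 := conv (fun i => bn m%:~R i)
  (fun i => prodV (ix (m + n - i%:Z)) (prodV (ix (l + i%:Z)) a b) c)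
  (fun i => rprod (deg ((r + s) %% T)) (sgn al ga * sgn be ga) (m + n - i%:Z)
    (rprod (deg r) (sgn al be) (l + i%:Z) (md a) (md b)) (md c) q w).
transitivity (md (\sum_(i < N) ((-1) ^+ i * bn l%:~R i) *:
     prodV (ix (m + l - i%:Z)) a (prodV (ix (n + i%:Z)) b c)) q w
  - (sgn al be * (-1) ^ l) *: md (\sum_(i < N) ((-1) ^+ i * bn l%:~R i) *:
     prodV (ix (n + l - i%:Z)) b (prodV (ix (m + i%:Z)) a c)) q w
  - md (\sum_(i < N) bn m%:~R i *:
     prodV (ix (m + n - i%:Z)) (prodV (ix (l + i%:Z)) a b) c) q w); first by [].
rewrite E1 => [|i Ni|i].
- rewrite E2 => [|i Ni|i].
  + rewrite E3 => [|i Ni|i]; first by rewrite B subrr.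
      by rewrite ab0 // prodV_zero1.
    rewrite (prodV_hom _ sa sb ha hb) (prodV_hom _ (sab _) sc (hab _) hc) nprodE ?Eab ?sgnDl //.
    rewrite -Eab; exact: (sp_field (sab _)).
  + by rewrite ac0 // prodV_zero2.
  rewrite (prodV_hom _ sa sc ha hc) (prodV_hom _ sb (sac _) hb (hac _)) nprodE ?Eac ?sgnDr //.
    by rewrite [sgn be al]sgnC.
  by rewrite -Eac; exact: (sp_field (sac _)).
- by rewrite bc0 // prodV_zero2.
- rewrite (prodV_hom _ sb sc hb hc) (prodV_hom _ sa (sbc _) ha (hbc _)) nprodE ?Ebc ?sgnDr //.
  by rewrite -Ebc; exact: (sp_field (sbc _)).
Qed.

Lemma bor_par l m n al be a b c : sp a -> sp b -> sp c -> op_parity W_ al a -> op_parity W_ be b ->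
  exists N0 : nat, forall N, (N0 <= N)%N -> bor N l m n (sgn al be * (-1) ^ l) a b c = 0.
Proof.
move=> sa sb sc pa pb; set k := _ * _.
pose P a b c := exists N0 : nat, forall N, (N0 <= N)%N -> bor N l m n k a b c = 0.
have lin (x y z : nat -> series W) (d : F) : (forall N, z N = d *: x N + y N) ->
    (exists N0 : nat, forall N, (N0 <= N)%N -> x N = 0) ->
    (exists N0 : nat, forall N, (N0 <= N)%N -> y N = 0) ->
    exists N0 : nat, forall N, (N0 <= N)%N -> z N = 0.
  move=> E [N1 x0] [N2 y0]; exists (maxn N1 N2) => N; rewrite geq_max => /andP[le1 le2].
  by rewrite E x0 // y0 // scaler0 addr0.
suff: P a b c by [].
have P10 b' c' : sp b' -> sp c' -> P 0 b' c'.
  move=> sb' sc'; exists 0%N => N _; have := bor_lin1 N l m n k (-1) sp0 sp0 sb' sc'.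
  by rewrite scaler0 addr0 scaleN1r addNr.
have P20 a' c' : sp a' -> sp c' -> P a' 0 c'.
  move=> sa' sc'; exists 0%N => N _; have := bor_lin2 N l m n k (-1) sa' sp0 sp0 sc'.
  by rewrite scaler0 addr0 scaleN1r addNr.
have P30 a' b' : sp a' -> sp b' -> P a' b' 0.
  move=> sa' sb'; exists 0%N => N _; have := bor_lin3 N l m n k (-1) sa' sb' sp0 sp0.
  by rewrite scaler0 addr0 scaleN1r addNr.
move: a sa pa; apply: sp_par_ind => [|d a a' sa sa' _ _ Pa Pa'|r a rT sa ha].
- exact: P10.
- by apply: (lin _ _ _ d) Pa Pa' => N; exact: bor_lin1.
move: b sb pb; apply: sp_par_ind => [|d b b' sb sb' _ _ Pb Pb'|s b sT sb hb].
- exact: P20.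
- by apply: (lin _ _ _ d) Pb Pb' => N; exact: bor_lin2.
move: c sc; apply: sp_ind => [|d c c' sc sc' Pc Pc'|t ga c tT sc hc].
- exact: P30.
- by apply: (lin _ _ _ d) Pc Pc' => N; exact: bor_lin3.
exact: (bor_hom l m n sa sb sc ha hb hc).
Qed.

Local Notation V := (gen_space T eta W_ S).

Lemma val_sp (u : V) : sp (val u).
Proof. by rewrite -gen_sp; have := valP u; rewrite /gen_pred inE. Qed.

Lemma val_linear : linear (val : V -> series W).
Proof. by move=> d u v. Qed.

(** The element of the generated space given by a series of [sp] (the vacuum for
    a series outside of [sp]). *)
Definition mk a : V := insubd (gen_vac T eta W_ S) a.

Lemma val_mk a : sp a -> val (mk a) = a.
Proof. by move=> sa; apply: insubdK; rewrite /gen_pred inE gen_sp. Qed.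

(** The vertex operators of the generated space. *)
Definition YV (u : V) : series V := fun e v => mk (prodV e (val u) (val v)).

Lemma val_YV u e v : val (YV u e v) = prodV e (val u) (val v).
Proof. by rewrite val_mk //; apply: prodV_sp; exact: val_sp. Qed.

Lemma YV_linear : linear YV.
Proof.
move=> d u u'; apply/funext => e; apply/funext => v; apply: val_inj.
rewrite val_YV -[RHS]/(val (d *: YV u e v + YV u' e v)) !val_linear !val_YV.
by apply: prodV_lin1; exact: val_sp.
Qed.

Lemma YV_linear2 u e : linear (YV u e).
Proof.
move=> d v v'; apply: val_inj; rewrite val_linear !val_YV val_linear.
by apply: prodV_lin2; exact: val_sp.
Qed.

Lemma YV_out u (e : rat) v : e \isn't a Num.int -> YV u e v = 0.
Proof. by move=> e_int; apply: val_inj; rewrite val_YV prodV_out ?linear0. Qed.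

Lemma YV_trunc u v : truncated 0 (fun e => YV u e v).
Proof.
have [N uv0] := prodV_trunc (val_sp u) (val_sp v).
by exists N => e /uv0 E; apply: val_inj; rewrite val_YV E.
Qed.

Lemma YV_field u : field (md (YV u)).
Proof. by apply/field_mdP; split=> [e|v]; [exact: YV_linear2|exact: YV_trunc]. Qed.

Lemma YV_supp u : supp 0 (md (YV u)).
Proof.
move=> m v; rewrite subr0 => m_int; apply: YV_out; apply: contra m_int.
by move=> /rpredD/(_ (rpred1 _)); rewrite subrK rpredN.
Qed.

Lemma YV_bound u v (x : int) :
  exists N : nat, forall i : nat, (N <= i)%N -> YV u (ix (x + i%:Z)) v = 0.
Proof.
have [N uv0] := prodV_bound x (val_sp u) (val_sp v).
by exists N => i /uv0 E; apply: val_inj; rewrite val_YV E.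
Qed.

(** The Jacobi identity of the generated space, in terms of modes. *)
Lemma YV_bra (l m n : int) al be (u v w : V) :
  gen_parity T eta W_ S al u -> gen_parity T eta W_ S be v ->
  bra (sgn al be) (md (YV u)) (md (YV v)) w (l, m%:~R, n%:~R)
  = nsum (fun i => bn m%:~R i *:
      md (YV (YV u (ix (l + i%:Z)) v)) (m%:~R + n%:~R - i%:R) w).
Proof.
move=> pu pv; have [N0 B] := bor_par l m n (val_sp u) (val_sp v) (val_sp w) pu pv.
have [N1 vw0] := YV_bound v w n; have [N2 uw0] := YV_bound u w m.
have [N3 uv0] := YV_bound u v l.
set N := maxn (maxn N0 N1) (maxn N2 N3).
have [ltN0 ltN1 ltN2 ltN3] : [/\ (N0 <= N)%N, (N1 <= N)%N, (N2 <= N)%N & (N3 <= N)%N].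
  by rewrite /N !leq_max !leqnn !orbT.
have Ed (x y : int) (i : nat) : x%:~R + y%:~R - i%:R = (x + y - i%:Z)%:~R :> rat.
  by rewrite rmorphB rmorphD.
have Es (x : int) (i : nat) : x%:~R + i%:R = (x + i%:Z)%:~R :> rat by rewrite rmorphD.
have f0 u' e : md (YV u') e 0 = 0 := field0 e (YV_field u').
have Y0 e v' : YV 0 e v' = 0 by rewrite (linear0 YV_linear).
rewrite braE !oprodE; rewrite (@nsumE _ _ N); last first.
  by move=> i Ni; rewrite Es {2}/md vw0 ?f0 ?scaler0 //; exact: leq_trans Ni.
rewrite (@nsumE _ _ N); last first.
  by move=> i Ni; rewrite Es {2}/md uw0 ?f0 ?scaler0 //; exact: leq_trans Ni.
rewrite (@nsumE _ _ N); last first.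
  by move=> i Ni; rewrite uv0 /md ?Y0 ?scaler0 //; exact: leq_trans Ni.
apply/eqP; rewrite -subr_eq0; apply/eqP/val_inj; rewrite -[RHS](B N ltN0) /bor.
have vsum (f : 'I_N -> F) (x : 'I_N -> V) :
    val (\sum_(i < N) f i *: x i) = \sum_(i < N) f i *: val (x i).
  by elim/big_ind2: _ => // u1 u2 v1 v2 <- <-.
rewrite -[LHS]/(val (\sum_(i < N) _) - _ *: val (\sum_(i < N) _) - val (\sum_(i < N) _)).
congr (_ - _ *: _ - _).
- rewrite vsum; apply: eq_bigr => i _; congr (_ *: _).
  by rewrite Ed Es /md !val_YV.
- rewrite vsum; apply: eq_bigr => i _; congr (_ *: _).
  by rewrite Ed Es /md !val_YV.
- rewrite vsum; apply: eq_bigr => i _; congr (_ *: _).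
  by rewrite Ed /md !val_YV.
Qed.

Local Notation gpar := (gen_parity T eta W_ S).
Local Notation vac := (gen_vac T eta W_ S).

Lemma gen_graded : graded gpar.
Proof.
split=> [al|v|v pf pt].
- apply/subspaceP; split=> [e be w Ww|d u v pu pv e be w Ww].
    by have /subspaceP[] := W_sub (al (+) be).
  have /subspaceP[_ lin] := W_sub (al (+) be); rewrite val_linear.
  by apply: lin; [exact: pu|exact: pv].
- have sv := val_sp v; have sc al := parcomp_sp al sv.
  exists (mk (parcomp false (val v))), (mk (parcomp true (val v))); split.
  + by rewrite /gen_parity /= val_mk //; exact: parcomp_parity.
  + by rewrite /gen_parity /= val_mk //; exact: parcomp_parity.
  apply: val_inj; rewrite -[RHS]/(val (mk _) + val (mk _)) !val_mk //; exact: sp_decomp.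
apply: val_inj; have := parcomp_id false (val_sp v) pt.
by rewrite (parcomp_id false (val_sp v) pf).
Qed.

Lemma vac_par : gpar false vac.
Proof. by have /homP[_ _ _] := homog_idser. Qed.

Lemma vac_sp : sp (idser W). Proof. exact: (val_sp vac). Qed.

Lemma prodV_id1 e b : sp b -> prodV e (idser W) b = if e == 0 then b else 0.
Proof.
have [/int_mode[n ->]|e_int] := boolP (e \is a Num.int); last first.
  by rewrite prodV_out // ifF //; apply: contraNF e_int => /eqP ->; exact: rpred0.
have -> : (ix n == 0) = (n == -1).
  by rewrite -(@eqr_int rat) [RHS](_ : _ = (n%:~R == - 1 :> rat)) // subr_eq0 eqr_oppLR.
move: b; apply: sp_ind; first by rewrite prodV_zero2 ?if_same //; exact: vac_sp.
  move=> d b b' sb sb' E E'; rewrite prodV_lin2 ?E ?E' //; last exact: vac_sp.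
  by case: ifP => // _; rewrite scaler0 addr0.
move=> r al b rT sb hb; rewrite (prodV_hom _ vac_sp sb homog_idser hb).
apply: md_inj => q w; rewrite nprodE; [|exact: md_idser_field|exact: sp_field].
rewrite mul0r -[sgn false al]/1 (rprod_id1 T_inv charF) //; last exact: sp_field.
by case: ifP.
Qed.

Lemma prodV_id2 (e : rat) a : sp a -> e <= 0 -> prodV e a (idser W) = if e == 0 then a else 0.
Proof.
have [/int_mode[n ->]|e_int] := boolP (e \is a Num.int); last first.
  by rewrite prodV_out // ifF //; apply: contraNF e_int => /eqP ->; exact: rpred0.
have -> : (ix n == 0) = (n == -1).
  by rewrite -(@eqr_int rat) [RHS](_ : _ = (n%:~R == - 1 :> rat)) // subr_eq0 eqr_oppLR.
move=> sa n0; have {}n0 : 0 <= n + 1.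
  by rewrite -(ler_int rat) rmorphD /=; move: n0; rewrite -[1%:~R]/(1 : rat); lra.
move: a sa; apply: sp_ind; first by rewrite prodV_zero1 ?if_same //; exact: vac_sp.
  move=> d b b' sb sb' E E'; rewrite prodV_lin1 ?E ?E' //; last exact: vac_sp.
  by case: ifP => // _; rewrite scaler0 addr0.
move=> r al a rT sa ha; rewrite (prodV_hom _ sa vac_sp ha homog_idser).
have [_ fa suppa _] := (homP _ _ _ _).1 ha.
apply: md_inj => q w; rewrite nprodE //; last exact: md_idser_field.
have -> : sgn al false = 1 :> F by rewrite /sgn andbF.
by rewrite (rprod_id2 T_inv charF _ _ fa suppa n0); case: ifP.
Qed.

Lemma YV0 q w : YV 0 q w = 0.
Proof. by rewrite (linear0 YV_linear). Qed.

Lemma YV_jacobi al be (u v : V) : gpar al u -> gpar be v -> forall w e,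
  jacobi_lhs al be (YV u) (YV v) w e
  = smul (delta 1 X2 X1 X0) (iterate YV YV u v w) e.
Proof.
move=> pu pv w e; have [fu fv] := (YV_field u, YV_field v).
rewrite -(smul_ratio0 (iterate _ _ _ _ _)) -oppr0.
apply: (jacobi_modes T_inv charF) => //.
- exact: YV0.
- exact: tint_nat 0%N.
- exact: YV_supp.
- by move=> e0; exact: YV_out.
- exact: YV_trunc.
move=> l m n; rewrite subr0 => /intrP[m' ->].
have [/intrP[n' ->]|n_int] := boolP (n \is a Num.int); first exact: YV_bra.
rewrite (bra_supp2 _ _ _ _ fu (YV_supp v)) ?subr0 // nsum0 // => i.
rewrite (YV_supp _) ?scaler0 // subr0; apply: contra n_int => E.
have -> : n = m'%:~R + n - i%:R - m'%:~R + i%:R by ring.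
by rewrite rpredD ?natr_int // rpredB // intr_int.
Qed.

Lemma gen_vertex_superalgebra : vertex_superalgebra gpar vac YV.
Proof.
split.
- exact: gen_graded.
- exact: vac_par.
- exact: YV_linear.
- move=> v; split=> [e|e]; first exact: YV_linear2.
  rewrite mul1r; apply: contraR => e_int; apply/eqP/funext => w; exact: YV_out.
- move=> al be u v e pu pv; rewrite /gen_parity /= val_YV.
  by apply: prodV_parity => //; exact: val_sp.
- exact: YV_trunc.
- apply/funext => e; apply/funext => v; apply: val_inj.
  by rewrite val_YV prodV_id1 /idser; [case: ifP|exact: val_sp].
- move=> v; split=> [e e0|]; apply: val_inj; rewrite val_YV prodV_id2 ?eqxx //.
  + by rewrite lt_eqF.
  + exact: val_sp.
  + exact: ltW.
  + exact: val_sp.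
- exact: YV_jacobi.
Qed.

(** ** The automorphism *)

Lemma gmap_linear : linear (@gmap F T eta W).
Proof.
move=> d a b; apply/funext => e; rewrite /gmap -[RHS]/(d *: (_ *: a e) + _ *: b e).
by rewrite -[(d *: a + b) e]/(d *: a e + b e) scale_lincomb.
Qed.

Lemma gmap_hom r al a : hom r al a -> gmap T eta a = eta ^+ r *: a.
Proof. by case. Qed.

Lemma gmap_sp a : sp a -> sp (gmap T eta a).
Proof.
move: a; apply: sp_ind; first by rewrite (linear0 gmap_linear); exact: sp0.
  by move=> d b b' _ _ gb gb'; rewrite gmap_linear; exact: sp_lin.
by move=> r al b _ sb /gmap_hom ->; apply: (subspaceZ _ sp_sub).
Qed.

(** The automorphism of the generated space induced by [gmap]. *)
Definition gV (u : V) : V := mk (gmap T eta (val u)).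

Lemma val_gV u : val (gV u) = gmap T eta (val u).
Proof. by rewrite val_mk //; apply: gmap_sp; exact: val_sp. Qed.

Lemma gV_linear : linear gV.
Proof.
by move=> d u v; apply: val_inj; rewrite val_linear !val_gV val_linear gmap_linear.
Qed.

Lemma gmap_iter a : sp a -> iter T (@gmap F T eta W) a = a.
Proof.
have iter_lin n : linear (iter n (@gmap F T eta W)).
  elim: n => [|n IH] d b b' //=; by rewrite IH gmap_linear.
move: a; apply: sp_ind; first by rewrite (linear0 (iter_lin _)).
  by move=> d b b' _ _ E E'; rewrite iter_lin E E'.
move=> r al b _ _ /gmap_hom gb.
have -> n : iter n (@gmap F T eta W) b = (eta ^+ r) ^+ n *: b.
  elim: n => [|n IH]; first by rewrite scale1r.
  have := gmap_linear ((eta ^+ r) ^+ n) b 0; rewrite (linear0 gmap_linear) !addr0 => E.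
  by rewrite iterS IH E gb scalerA exprSr.
by rewrite exprAC (prim_expr_order eta_prim) expr1n scale1r.
Qed.

Lemma gV_iter u : iter T gV u = u.
Proof.
have E n : val (iter n gV u) = iter n (@gmap F T eta W) (val u).
  by elim: n => // n IH; rewrite !iterS val_gV IH.
by apply: val_inj; rewrite E gmap_iter //; exact: val_sp.
Qed.

Lemma gmap_prodV e a b : sp a -> sp b ->
  gmap T eta (prodV e a b) = prodV e (gmap T eta a) (gmap T eta b).
Proof.
have [/int_mode[n ->]|e_int] := boolP (e \is a Num.int); last first.
  by rewrite !prodV_out // (linear0 gmap_linear).
move=> sa sb; move: a sa; apply: sp_ind.
- by rewrite prodV_zero1 // (linear0 gmap_linear) prodV_zero1 //; exact: gmap_sp.
- move=> d a a' sa sa' E E'; rewrite prodV_lin1 // !gmap_linear prodV_lin1 ?E ?E' //; exact: gmap_sp.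
move=> r al a rT sa ha; move: b sb; apply: sp_ind.
- by rewrite prodV_zero2 // (linear0 gmap_linear) prodV_zero2 //; exact: gmap_sp.
- move=> d b b' sb sb' E E'; rewrite prodV_lin2 // !gmap_linear prodV_lin2 ?E ?E' //; exact: gmap_sp.
move=> s be b sT sb hb; have lab := sp_mloc sa sb ha hb.
have hab := nprod_homog T_gt0 T_inv charF eta_prim W_sub n ha hb lab.
rewrite (prodV_hom _ sa sb ha hb) (gmap_hom hab) (gmap_hom ha) (gmap_hom hb).
have Zl (d : F) a' b' : sp a' -> sp b' -> prodV (ix n) (d *: a') b' = d *: prodV (ix n) a' b'.
  by move=> sa' sb'; have := prodV_lin1 (ix n) d sa' sp0 sb'; rewrite prodV_zero1 // !addr0.
have Zr (d : F) a' b' : sp a' -> sp b' -> prodV (ix n) a' (d *: b') = d *: prodV (ix n) a' b'.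
  by move=> sa' sb'; have := prodV_lin2 (ix n) d sa' sb' sp0; rewrite prodV_zero2 // !addr0.
rewrite Zl ?Zr //; last by apply: (subspaceZ _ sp_sub).
by rewrite (prodV_hom _ sa sb ha hb) scalerA -exprD prim_expr_mod.
Qed.

Lemma gV_automorphism : automorphism vac YV gV.
Proof.
split.
- exact: gV_linear.
- exists (iter T.-1 gV) => u; rewrite -?iterSr -?iterS prednK //; exact: gV_iter.
- by apply: val_inj; rewrite val_gV (gmap_hom homog_idser) expr0 scale1r.
- move=> u e v; apply: val_inj; rewrite val_gV !val_YV !val_gV.
  by apply: gmap_prodV; exact: val_sp.
Qed.

(** ** The twisted module *)

Local Notation YW := (fun u : V => val u).

Lemma gV_supp r u : (r < T)%N -> gV u = eta ^+ r *: u -> supp (deg r) (md (val u)).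
Proof.
move=> rT gu; have [opu _] := sp_ET (val_sp u); apply/(gmap_suppP T_gt0 eta_prim opu rT).
by rewrite -val_gV gu; have := val_linear (eta ^+ r) u 0; rewrite !addr0.
Qed.

Lemma gV_hom r al u : (r < T)%N -> gV u = eta ^+ r *: u -> gpar al u -> hom r al (val u).
Proof.
move=> rT gu pu; apply/homP; split=> //; [exact: (sp_field (val_sp u))|exact: (gV_supp rT gu)].
Qed.

Lemma gen_twisted_module : twisted_module T eta gpar vac YV gV YW.
Proof.
split.
- exact: val_linear.
- by move=> u; have [] := sp_ET (val_sp u).
- move=> r u rT gu; exact/supp_mdP/gV_supp.
- move=> r u _ _; by have [_] := sp_ET (val_sp u).
- by [].
move=> r al be u v rT gu pu pv w e.
have [fu fv] := (sp_field (val_sp u), sp_field (val_sp v)).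
have hu := gV_hom rT gu pu.
have /mutually_localP[k lab] := sp_mloc_par (val_sp u) (val_sp v) pu pv.
apply: (@jacobi_modes _ T p T_inv charF _ _ YV YW) => //.
- exact: (tint_frac T_inv r).
- exact: (gV_supp rT gu).
- by move=> e0; exact: YV_out.
- exact: YV_trunc.
move=> l m n m_int; rewrite (bra_rprod T_inv charF fu fv lab l n w (tint_frac T_inv r) m_int).
apply: eq_nsum => i; congr (_ *: _).
by rewrite val_YV (prodV_par _ (val_sp u) hu (val_sp v) pv) nprodE.
Qed.

Lemma gen_structure : graded W_ ->
  exists (Y : V -> series V) (g : V -> V),
    [/\ forall r s al be (a b : V) (n : int),
          homog T eta W_ r al (val a) -> homog T eta W_ s be (val b) ->
          val (Y a (- n%:~R - 1) b) = nprod T r al be n (val a) (val b),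
        vertex_superalgebra gpar vac Y,
        [/\ forall a : V, val (g a) = gmap T eta (val a),
            automorphism vac Y g
          & forall a : V, iter T g a = a],
        twisted_module T eta gpar vac Y g YW
      & super_module gpar W_ YW /\ injective YW].
Proof.
move=> gradedW; exists YV, gV; split.
- move=> r s al be a b n ha hb; rewrite val_YV.
  by apply: (prodV_hom _ _ _ ha hb); exact: val_sp.
- exact: gen_vertex_superalgebra.
- split; [exact: val_gV|exact: gV_automorphism|exact: gV_iter].
- exact: gen_twisted_module.
- split; last exact: val_inj.
  by split=> // al be u w e pu Ww; exact: pu.
Qed.

End Closure.

Theorem theorem3p5 (F : closedFieldType) (p T : nat) (eta : F)
    (W : lmodType F) (W_ : bool -> set W) (S : set (series W))
    (charF : p \in [pchar F]) (p_gt2 : (2 < p)%N)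
    (T_gt0 : (0 < T)%N) (coTp : coprime T p)
    (eta_prim : T.-primitive_root eta)
    (gradedW : graded W_)
    (localS : local_subspace T eta W_ S) :
  local_subspace T eta W_ (gen T eta W_ S) /\
  exists (Y : gen_space T eta W_ S -> series (gen_space T eta W_ S))
         (g : gen_space T eta W_ S -> gen_space T eta W_ S),
    [/\ forall r s al be (a b : gen_space T eta W_ S) (n : int),
          homog T eta W_ r al (val a) -> homog T eta W_ s be (val b) ->
          val (Y a (- n%:~R - 1) b) = nprod T r al be n (val a) (val b),
        vertex_superalgebra (gen_parity T eta W_ S) (gen_vac T eta W_ S) Y,
        [/\ forall a, val (g a) = gmap T eta (val a),
            automorphism (gen_vac T eta W_ S) Y g
          & forall a, iter T g a = a],
        twisted_module T eta (gen_parity T eta W_ S) (gen_vac T eta W_ S)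
          Y g (fun a : gen_space T eta W_ S => val a)
      & super_module (gen_parity T eta W_ S) W_
          (fun a : gen_space T eta W_ S => val a) /\
        injective (fun a : gen_space T eta W_ S => val a)].
Proof.
have T_inv : T%:R != 0 :> F.
  rewrite -(dvdn_pcharf charF) -prime_coprime ?(pcharf_prime charF) //.
  by rewrite coprime_sym.
have [pr [pr_lin pr_in pr_sum pr_id]] := graded_proj gradedW.
have [W_sub _ _] := gradedW.
split; first exact: (gen_local T_gt0 T_inv charF eta_prim localS pr_lin pr_in pr_sum pr_id W_sub).
exact: (gen_structure T_gt0 T_inv charF eta_prim localS pr_lin pr_in pr_sum pr_id W_sub gradedW).
Qed.
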